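(* Let $d\ge1$, $\frac{d-1}{d}<p<\infty$ and $q>0$. For every $N\geq1$, there is a collection $A(N)$ of Haar functions, all supported in $[0,1]^d$, with $\# (A(N))\le 2^d N$, and such that the orthogonal projection operators $P_{A(N)}$ satisfy the estimates $$\|P_{A(N)} \|_{B^{d(\frac 1p-1)}_{p,q}\to B^{d(\frac 1p-1)}_{p,q}} \ge c\, N^{1/q},\qquad \|P_{A(N)} \|_{F^{d(\frac 1p-1)}_{p,q}\to F^{d(\frac 1p-1)}_{p,q}} \ge c\, N^{1/p},$$ with a constant $c>0$ independent of $N$.
   Context: $B^s_{p,q}=B^s_{p,q}(\mathbb{R}^d)$ and $F^s_{p,q}=F^s_{p,q}(\mathbb{R}^d)$ are the usual inhomogeneous Besov and Triebel-Lizorkin spaces. Haar functions are the elements of $\mathscr{H}_d$: let $h^{(0)}=\mathbf{1}_{[0,1)}$, $h^{(1)}=\mathbf{1}_{[0,1/2)}-\mathbf{1}_{[1/2,1)}$, $h^{\epsilon}_{k,\mu}(x)=\prod_{i=1}^d h^{(\epsilon_i)}(2^kx_i-\mu_i)$ for $\epsilon\in\{0,1\}^d$, $k\in\mathbb{N}_0$, $\mu\in\mathbb{Z}^d$; with $\Upsilon=\{0,1\}^d\setminus\{\vec 0\}$, $\mathscr{H}_d=\{h^{\vec 0}_{0,\mu}\}_{\mu\in\mathbb{Z}^d}\cup\{h^{\epsilon}_{k,\mu}: k\in\mathbb{N}_0,\mu\in\mathbb{Z}^d,\epsilon\in\Upsilon\}$. For a finite $A\subset\mathscr{H}_d$, $P_A$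 is the ($L^2$-)orthogonal projection onto $\operatorname{span}A$: $P_Af=\sum_{u\in A}\|u\|_2^{-2}\langle f,u\rangle u$, for locally integrable $f$. The operator norm $\|P_A\|_{X\to X}\in[0,\infty]$ is the supremum of $\|P_Af\|_X$ over locally integrable $f\in X$ with $\|f\|_X\le1$. *)

(* Defs.v *)
From HB Require Import structures.
From mathcomp Require Import all_boot all_order all_algebra finmap complex.
From mathcomp Require Import all_classical all_reals all_analysis.

Set Implicit Arguments.
Unset Strict Implicit.
Unset Printing Implicit Defensive.

Import Order.TTheory GRing.Theory Num.Theory.
Import numFieldNormedType.Exports.

Local Open Scope classical_set_scope.
Local Open Scope ring_scope.
Local Open Scope complex_scope.

(* R^n is 'rV[R]_n, with the sigma-algebra generated by the coordinates, i.e.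
   the Borel sigma-algebra. *)
Definition measure_rV_display : measure_display.
Proof. exact: default_measure_display. Qed.

Section measurable_rV.
Variables (R : realType) (n : nat).

Let coor (i : 'I_n) (x : 'rV[R]_n) : measurableTypeR R := x ord0 i.

Let rV_set0 : g_sigma_preimage coor set0.
Proof. exact: sigma_algebra0. Qed.

Let rV_setC A : g_sigma_preimage coor A -> g_sigma_preimage coor (~` A).
Proof. exact: sigma_algebraC. Qed.

Let rV_bigcup (F : (set 'rV[R]_n)^nat) : (forall i, g_sigma_preimage coor (F i)) ->
  g_sigma_preimage coor (\bigcup_i (F i)).
Proof. exact: sigma_algebra_bigcup. Qed.

HB.instance Definition _ := @isMeasurable.Build measure_rV_display
  'rV[R]_n (g_sigma_preimage coor) rV_set0 rV_setC rV_bigcup.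

Lemma measurable_coord (i : 'I_n) :
  measurable_fun [set: 'rV[R]_n] (fun x => x ord0 i : measurableTypeR R).
Proof.
move=> _ Y mY; rewrite setTI; apply: sub_sigma_algebra => /=.
rewrite -bigcup_seq/=; exists i => /=; first by rewrite mem_index_enum.
by exists Y => //; rewrite setTI.
Qed.

Lemma measurable_fun_rV d (T : measurableType d) (f : T -> 'rV[R]_n) :
  (forall i, measurable_fun [set: T] (fun t => f t ord0 i : measurableTypeR R)) ->
  measurable_fun [set: T] f.
Proof.
move=> mf; have : g_sigma_preimage (fun i => coor i \o f) `<=` measurable.
  apply: smallest_sub; first exact: sigma_algebra_measurable.
  rewrite -bigcup_seq => A [i _ [B mB <-]]; exact: mf.
rewrite g_sigma_preimage_comp => prefS _ A mA.
by rewrite setTI; apply: prefS; exists A => //; rewrite setTI.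
Qed.

End measurable_rV.

Section lebesgue_rV.
Variable R : realType.

Definition rV_cons n (z : measurableTypeR R * 'rV[R]_n) : 'rV[R]_n.+1 :=
  row_mx (const_mx z.1 : 'rV[R]_1) z.2.

Definition rV_uncons n (v : 'rV[R]_n.+1) : measurableTypeR R * 'rV[R]_n :=
  (v ord0 ord0, \row_j v ord0 (lift ord0 j)).

Lemma rV_cons0 n z : @rV_cons n z ord0 ord0 = z.1.
Proof.
rewrite /rV_cons (_ : ord0 = lshift n (ord0 : 'I_1)); last exact: val_inj.
by rewrite (row_mxEl (const_mx z.1 : 'rV_1)) mxE.
Qed.

Lemma rV_consS n z i : @rV_cons n z ord0 (lift ord0 i) = z.2 ord0 i.
Proof.
rewrite /rV_cons (_ : lift ord0 i = rshift 1 i); last exact: val_inj.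
by rewrite (row_mxEr (const_mx z.1 : 'rV_1)).
Qed.

Lemma rV_consK n : cancel (@rV_cons n) (@rV_uncons n).
Proof.
move=> [x v]; rewrite /rV_uncons rV_cons0; congr (_, _).
by apply/rowP => j; rewrite mxE rV_consS.
Qed.

Lemma rV_unconsK n : cancel (@rV_uncons n) (@rV_cons n).
Proof.
move=> v; apply/rowP => j; case: (unliftP ord0 j) => [i|] ->.
  by rewrite rV_consS mxE.
by rewrite rV_cons0.
Qed.

Lemma measurable_rV_cons n : measurable_fun setT (@rV_cons n).
Proof.
apply: measurable_fun_rV => j; case: (unliftP ord0 j) => [i|] ->.
  rewrite (_ : (fun _ => _) = (fun x : 'rV[R]_n => x ord0 i) \o snd).
    exact: (measurableT_comp (@measurable_coord R n i)).
  by apply/funext => z; rewrite rV_consS.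
rewrite (_ : (fun _ => _) = fst)//.
by apply/funext => z; rewrite rV_cons0.
Qed.

Lemma measurable_rV_uncons n : measurable_fun setT (@rV_uncons n).
Proof.
apply: measurable_fun_pair; first exact: measurable_coord.
apply: measurable_fun_rV => i.
rewrite [X in measurable_fun _ X](_ : _ = fun v : 'rV[R]_n.+1 => v ord0 (lift ord0 i)).
  exact: measurable_coord.
by apply/funext => v /=; rewrite mxE.
Qed.

Section step.
Local Open Scope ereal_scope.
Variables (m1 : {sigma_finite_measure set (measurableTypeR R) -> \bar R}).
Variables (n : nat) (m : {sigma_finite_measure set 'rV[R]_n -> \bar R}).

Definition rV_product_step : set 'rV[R]_n.+1 -> \bar R :=
  pushforward (m1 \x m) (@rV_cons n).

Let step0 : rV_product_step set0 = 0.
Proof. by rewrite /rV_product_step /pushforward preimage_set0 measure0. Qed.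

Let step_ge0 A : 0 <= rV_product_step A.
Proof. by rewrite /rV_product_step /pushforward measure_ge0. Qed.

Let step_sigma_additive : semi_sigma_additive rV_product_step.
Proof.
have mc A : measurable A -> measurable (@rV_cons n @^-1` A).
  by move=> mA; rewrite -[X in measurable X]setTI; exact: measurable_rV_cons.
move=> F mF tF mUF; rewrite /rV_product_step /pushforward preimage_bigcup.
apply: measure_semi_sigma_additive.
- by move=> i; exact: mc.
- apply/trivIsetP => /= i j _ _ ij; rewrite -preimage_setI.
  by move/trivIsetP : tF => /(_ _ _ _ _ ij) ->//; rewrite preimage_set0.
- by rewrite -preimage_bigcup; exact: mc.
Qed.

HB.instance Definition _ := isMeasure.Build _ _ _ rV_product_step
  step0 step_ge0 step_sigma_additive.

Let step_sigma_finite : sigma_finite setT rV_product_step.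
Proof.
have /sigma_finiteP[F [FT ndF Foo]] := sigma_finiteT m1.
have /sigma_finiteP[G [GT ndG Goo]] := sigma_finiteT m.
exists (fun i => @rV_uncons n @^-1` (F i `*` G i)).
  rewrite -preimage_bigcup (_ : \bigcup_i _ = setT) ?preimage_setT//.
  apply/seteqP; split=> // -[x y] _.
  have [i _ Fx] : (\bigcup_i F i) x by rewrite -FT.
  have [j _ Gy] : (\bigcup_i G i) y by rewrite -GT.
  exists (maxn i j) => //; split => /=.
  - by move: x Fx; exact/subsetPset/ndF/leq_maxl.
  - by move: y Gy; exact/subsetPset/ndG/leq_maxr.
move=> i; have [mF Fi] := Foo i; have [mG Gi] := Goo i; split.
  rewrite -[X in measurable X]setTI; apply: measurable_rV_uncons => //.
  exact: measurableX.
rewrite /rV_product_step /pushforward -comp_preimage.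
rewrite (_ : @rV_uncons n \o @rV_cons n = id) ?preimage_id; last first.
  by apply/funext => z /=; rewrite rV_consK.
by rewrite product_measure1E// lte_mul_pinfty// ge0_fin_numE.
Qed.

HB.instance Definition _ := Measure_isSigmaFinite.Build _ _ _ rV_product_step
  step_sigma_finite.

End step.

Fixpoint lebesgue_rV n : {sigma_finite_measure set 'rV[R]_n -> \bar R} :=
  if n is n'.+1 then rV_product_step lebesgue_measure (lebesgue_rV n') else dirac (0 : 'rV[R]_0).

Lemma lebesgue_rV_box n (A : 'I_n -> set (measurableTypeR R)) :
  (forall i, measurable (A i)) ->
  lebesgue_rV n [set x | forall i, A i (x ord0 i)] =
  (\prod_(i < n) lebesgue_measure (A i))%E.
Proof.
elim: n A => [|n IH] A mA.
  rewrite big_ord0 /= diracE mem_set// => -[].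
  by [].
have mbox : measurable [set x : 'rV[R]_n | forall i, A (lift ord0 i) (x ord0 i)].
  rewrite (_ : mkset _ = \bigcap_(i in [set: 'I_n])
     ((fun x : 'rV[R]_n => x ord0 i : measurableTypeR R) @^-1` A (lift ord0 i))).
    apply: fin_bigcap_measurable => // i _.
    by rewrite -[X in measurable X]setTI; exact: measurable_coord.
  by apply/seteqP; split=> x /= h i; [move=> _|]; exact: h.
rewrite big_ord_recl -IH//.
rewrite -(product_measure1E (@lebesgue_measure R))//.
rewrite /= /rV_product_step /pushforward; congr (_ _).
apply/seteqP; split=> [z/= h|z/= [h0 h] i].
  split; first by have := h ord0; rewrite rV_cons0.
  by move=> i; have := h (lift ord0 i); rewrite rV_consS.
by case: (unliftP ord0 i) => [j|] ->; rewrite ?rV_cons0 ?rV_consS//; exact: h.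
Qed.

End lebesgue_rV.

Section complex_valued.
Variables (R : realType) (d : nat).
Local Notation V := 'rV[R]_d.
Local Notation mu := (lebesgue_rV R d).
Implicit Types (f g phi psi : V -> R[i]).

Local Notation normc := (@Normc.normc R).

Definition cintegral f : R[i] :=
  (\int[mu]_x complex.Re (f x)) +i* (\int[mu]_x complex.Im (f x)).

Definition Lp_norm (p : \bar R) f : \bar R := Lnorm mu p (fun x => (normc (f x))%:E).

Definition locally_integrable_rV f : Prop :=
  [/\ measurable_fun setT (fun x => complex.Re (f x) : measurableTypeR R),
      measurable_fun setT (fun x => complex.Im (f x) : measurableTypeR R) &
      forall K : set V, compact K -> (\int[mu]_(x in K) (normc (f x))%:E < +oo)%E].

(* The iterated partial derivative along the multi-index that lists the
   coordinates [s] (with repetition). *)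
Definition pderive (s : seq 'I_d) (f : V -> R) : V -> R :=
  foldr (fun i (h : V -> R) => 'D_(delta_mx ord0 i) h) f s.

Definition smooth (f : V -> R) : Prop :=
  forall s : seq 'I_d, continuous (pderive s f) /\
    forall i x, derivable (pderive s f) x (delta_mx ord0 i).

Definition csmooth f : Prop :=
  smooth (fun x => complex.Re (f x)) /\ smooth (fun x => complex.Im (f x)).

Definition cpderive (s : seq 'I_d) f : V -> R[i] := fun x =>
  pderive s (fun y => complex.Re (f y)) x +i* pderive s (fun y => complex.Im (f y)) x.

Definition test_function phi : Prop :=
  csmooth phi /\ exists M : R, forall x, M < `|x| -> phi x = 0.

Definition schwartz_seminorm (m : nat) phi : \bar R :=
  ereal_sup [set ((1 + `|z.2|) ^+ m * normc (cpderive z.1 phi z.2))%:E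
            | z in [set z : seq 'I_d * V | (size z.1 <= m)%N]].

Definition schwartz phi : Prop :=
  csmooth phi /\ forall m, (schwartz_seminorm m phi < +oo)%E.

(* Only the values of [T] on Schwartz functions matter. *)
Definition tempered_distribution (T : (V -> R[i]) -> R[i]) : Prop :=
  (forall (a : R[i]) phi psi, schwartz phi -> schwartz psi ->
     T (fun x => a * phi x + psi x) = a * T phi + T psi) /\
  exists (C : R) (m : nat), forall phi, schwartz phi ->
    ((normc (T phi))%:E <= C%:E * schwartz_seminorm m phi)%E.

(* [T] is a tempered distribution which coincides with [f] in D'(R^d); since
   test functions are dense in the Schwartz space, [f] determines [T] on
   Schwartz functions. *)
Definition distribution_of f (T : (V -> R[i]) -> R[i]) : Prop :=
  tempered_distribution T /\
  forall phi, test_function phi -> T phi = cintegral (fun x => f x * phi x).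

Definition dotv (x y : V) : R := \sum_(i < d) x ord0 i * y ord0 i.

Definition euclid_norm (x : V) : R := Num.sqrt (dotv x x).

(* Inverse of the Fourier transform [F g xi = \int g x e^{-i <x, xi>} dx]. *)
Definition inverse_fourier g : V -> R[i] := fun x =>
  ((2 * pi) ^- d)%:C *
  cintegral (fun xi => (cos (dotv x xi) +i* sin (dotv x xi)) * g xi).

Definition LP_generator (phi0 : V -> R) : Prop :=
  [/\ smooth phi0,
      forall xi, euclid_norm xi <= 1 -> phi0 xi = 1 &
      forall xi, 2 < euclid_norm xi -> phi0 xi = 0].

Definition LP_symbol (phi0 : V -> R) (k : nat) : V -> R := fun xi =>
  if k is k'.+1 then phi0 (2 ^- k *: xi) - phi0 (2 ^- k' *: xi) else phi0 xi.

(* F^{-1}(phi_k F T), a smooth function by Paley-Wiener-Schwartz, in its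
   convolution form T * F^{-1} phi_k. *)
Definition LP_block (phi0 : V -> R) (k : nat) (T : (V -> R[i]) -> R[i]) : V -> R[i] :=
  fun x => T (fun y => inverse_fourier (fun xi => (LP_symbol phi0 k xi)%:C) (x - y)).

Definition besov_norm_distr (phi0 : V -> R) (s p : R) (q : \bar R) T : \bar R :=
  Lnorm counting q
    (fun k : nat => ((2 `^ (k%:R * s))%:E * Lp_norm p%:E (LP_block phi0 k T))%E).

Definition triebel_lizorkin_norm_distr (phi0 : V -> R) (s p : R) (q : \bar R) T : \bar R :=
  Lnorm mu p%:E (fun x => Lnorm counting q
    (fun k : nat => (2 `^ (k%:R * s) * normc (LP_block phi0 k T x))%:E)).

(* The norm of the (essentially unique) tempered distribution given by [f];
   it is +oo when [f] is not a tempered distribution. *)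
Definition norm_of_function (X : ((V -> R[i]) -> R[i]) -> \bar R) f : \bar R :=
  ereal_inf [set X T | T in distribution_of f].

Definition besov_norm (phi0 : V -> R) (s p : R) (q : \bar R) : (V -> R[i]) -> \bar R :=
  norm_of_function (besov_norm_distr phi0 s p q).

Definition triebel_lizorkin_norm (phi0 : V -> R) (s p : R) (q : \bar R) : (V -> R[i]) -> \bar R :=
  norm_of_function (triebel_lizorkin_norm_distr phi0 s p q).

Definition operator_norm (X : (V -> R[i]) -> \bar R)
    (P : (V -> R[i]) -> (V -> R[i])) : \bar R :=
  ereal_sup [set X (P f) | f in [set f | locally_integrable_rV f /\ (X f <= 1)%E]].

Definition haar1 (e : bool) (t : R) : R :=
  if e then \1_`[0, 2^-1[%classic t - \1_`[2^-1, 1[%classic t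
  else \1_`[0, 1[%classic t.

Definition haar (eps : {ffun 'I_d -> bool}) (k : nat) (m : 'I_d -> int) : V -> R :=
  fun x => \prod_(i < d) haar1 (eps i) (2 ^+ k * x ord0 i - (m i)%:~R).

Definition haar_system : set (V -> R) :=
  [set u | exists m, u = haar [ffun=> false] 0 m] `|`
  [set u | exists eps k m, eps != [ffun=> false] /\ u = haar eps k m].

Definition haar_projection (A : {fset (V -> R)}) f : V -> R[i] := fun x =>
  \sum_(u <- A) ((fine (Lnorm mu 2%:E (EFin \o u))) ^- 2)%:C *
                cintegral (fun y => f y * (u y)%:C) * (u x)%:C.

Definition unit_cube : set V := [set x | forall i, 0 <= x ord0 i <= 1].

Definition supp (u : V -> R) : set V := closure [set x | u x != 0].

End complex_valued.

(* Main.v *)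
Require Import Defs.
From HB Require Import structures.
From mathcomp Require Import all_boot all_order all_algebra finmap complex.
From mathcomp Require Import all_classical all_reals all_analysis.
From mathcomp Require Import measurable_realfun.
From mathcomp Require Import ring lra zify.

Import Order.TTheory GRing.Theory Num.Theory.
Import numFieldNormedType.Exports.
Local Open Scope classical_set_scope.
Local Open Scope ring_scope.

Set Implicit Arguments.
Unset Strict Implicit.
Unset Printing Implicit Defensive.

Local Notation "''e_' i" := (delta_mx (ord0 : 'I_1) i) (at level 8, i at level 2, format "''e_' i").

(** Put [s = d (1/p - 1)].  The dilates [f_M (x) = 2^(M d) f (2^M x)] keep the
integral of [f], and [s] is the exponent that is critical for them: for
[k >= 1] the number [2^(k s) || phi_k * f_M ||_p] depends only on [k - M], where
[phi_k * f_M] is the k-th Littlewood-Paley block.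

If [f] is a smooth function with compact support and integral 0, these numbers
decay geometrically in [|k - M|], so that the functions [f_M] are bounded in
[B^s_(p,q)] and in [F^s_(p,q)] ([norms_upper_bound]).  If [f] is the indicator
function of the unit cell, whose integral is 1, then for frequencies below [2^n]
the dilate [f_n] cannot be told from a point mass: for [1 <= k <= n - J] its
block has size [2^(k d)] on a ball of radius proportional to [2^(-k)]
([block_cell_high]).  Each of these [n - J] blocks contributes a constant to the
Besov norm ([besov_lower_bound]), which is thus at least of order [n^(1/q)].
The balls are pairwise disjoint, so in the Triebel-Lizorkin norm the p-th powers
add up, and the order is [n^(1/p)] ([triebel_lizorkin_lower_bound]).

A projection onto few Haar functions turns the first situation into the second.
Let [f (x) = w (x - a) - w (x + a)] with a bump [w] and a point [a] on the
diagonal, such that the two bumps lie in the positive and in the negative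
orthant.  For [M >= n + 4] the Haar functions [h^e_(k,0)] with [k <= n] vanish
on the second bump of [f_M] and are equal to 1 on the first one.  So all
coefficients of [f_M] are the same up to normalization, and summing the Haar
functions of the levels [k < n] telescopes: the projection of [f_M] is
a constant times [2^(n d)] times the indicator function of [[0, 2^(-n))^d]
([haar_telescope], [haar_projection_test_bump]).  This uses
[(2^d - 1) n + 1] Haar functions.  For small [N] the single function
[h^0_(0,0)] suffices, because the block 0 of its projection is not zero
([block_cell_low]).

For the estimates, the symbols are real, hence a block is a pair of real
oscillatory integrals, and the block [k] of a dilate [f_n] is a convolution that
involves only the ratio [2^k / 2^n] ([LP_block_dilate]).  The decay for [k <= n]
is the gain of one derivative by the vanishing integral ([conv_low]).
For [k > n] the symbol vanishes near the origin and can be divided by [|xi|^2],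
after which integration by parts moves derivatives to the smooth function [f]
([conv_high]).  The lower bounds need only that certain oscillatory integrals do
not vanish identically ([osc_neq0], [conv_neq0]); this follows from testing them
with high powers of a trigonometric bump.  Finally, the norms range over all
tempered distributions which agree with a function on test functions, and
[distribution_of_rapid] identifies their blocks with those integrals. *)

(** * Lebesgue measure on row vectors *)

Section rV_measure.
Variable R : realType.

Lemma norm_coord d (x : 'rV[R]_d) i : `|x ord0 i| <= `|x|.
Proof.
rewrite [leRHS]/Num.norm/= mx_normrE.
exact: (le_bigmax _ (fun ij : 'I_1 * 'I_d => `|x ij.1 ij.2|) (ord0, i)).
Qed.

Lemma norm_rV_le d (x : 'rV[R]_d) e :
  0 <= e -> (forall i, `|x ord0 i| <= e) -> `|x| <= e.
Proof.
move=> e0 H; rewrite [leLHS]/Num.norm/= mx_normrE.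
by apply/bigmax_leP; split=> // -[i j] _ /=; rewrite ord1.
Qed.

Lemma norm_rV_lt d (x : 'rV[R]_d) e :
  0 < e -> (forall i, `|x ord0 i| < e) -> `|x| < e.
Proof.
move=> e0 H; rewrite [ltLHS]/Num.norm/= mx_normrE.
by apply/bigmax_ltP; split=> // -[i j] _ /=; rewrite ord1.
Qed.

Lemma measurable_rV_box d (A : 'I_d -> set (measurableTypeR R)) :
  (forall i, measurable (A i)) ->
  measurable [set x : 'rV[R]_d | forall i, A i (x ord0 i)].
Proof.
move=> mA; rewrite (_ : mkset _ = \bigcap_(i in [set: 'I_d])
   ((fun x : 'rV[R]_d => x ord0 i : measurableTypeR R) @^-1` A i)).
  apply: fin_bigcap_measurable => // i _.
  by rewrite -[X in measurable X]setTI; exact: measurable_coord.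
by apply/seteqP; split=> x /= h i; [move=> _|]; exact: h.
Qed.

(** The half-open cubes of side [1/m] with corners in [(1/m) Z^d], [m >= 1], are
countably many, and every open set is the union of those it contains. *)
Lemma open_measurable_rV d (U : set 'rV[R]_d) : open U -> measurable U.
Proof.
move=> oU.
pose B (a : nat * 'rV[int]_d) := [set x : 'rV[R]_d |
  forall i, [set t | (a.2 ord0 i)%:~R <= a.1.+1%:R * t < (a.2 ord0 i + 1)%:~R] (x ord0 i)].
have mB a : measurable (B a).
  apply: (measurable_rV_box (A := fun i => [set t | (a.2 ord0 i)%:~R <= a.1.+1%:R * t < (a.2 ord0 i + 1)%:~R])) => i.
  rewrite (_ : mkset _ = `[a.1.+1%:R^-1 * (a.2 ord0 i)%:~R, a.1.+1%:R^-1 * (a.2 ord0 i + 1)%:~R[%classic).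
    exact: measurable_itv.
  apply/seteqP; split=> t /=; rewrite in_itv/=.
    by rewrite ler_pdivrMl// ltr_pdivlMl.
  by rewrite ler_pdivrMl// ltr_pdivlMl.
rewrite (_ : U = \bigcup_(a in [set a | B a `<=` U]) B a).
  have -> : \bigcup_(a in [set a | B a `<=` U]) B a =
    \bigcup_a (if `[< B a `<=` U >] then B a else set0).
    apply/seteqP; split=> x [a].
      by move=> aU Bx; exists a => //; case: asboolP.
    by move=> _; case: asboolP => // aU Bx; exists a.
  apply: countable_bigcupT_measurable => // a.
  by case: asboolP => _; [exact: mB|exact: measurable0].
apply/seteqP; split=> x; last by move=> [a]; exact.
move=> Ux; have : nbhs x U by apply: open_nbhs_nbhs.
move=> /nbhs_ballP[e /= e0 eU].
have [n en] : exists n : nat, e^-1 < n%:R.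
  by exists (Num.bound e^-1); apply: archi_boundP; rewrite invr_ge0; exact: ltW.
pose z : 'rV[int]_d := \row_i Num.floor (n.+1%:R * x ord0 i).
exists (n, z); last first.
  move=> i /=; rewrite mxE; apply/andP; split; first exact: ge_floor.
  exact: floorD1_gt.
move=> y Byz; apply: eU; rewrite -ball_normE/=.
apply: norm_rV_lt => // i.
have := Byz i; rewrite /= !mxE => /andP[h1 h2].
have h3 := ge_floor (n.+1%:R * x ord0 i); have h4 := floorD1_gt (n.+1%:R * x ord0 i).
have n0 : 0 < n.+1%:R :> R by [].
rewrite -(ltr_pM2l n0) -[X in X * `|_|](gtr0_norm n0) -normrM mulrBr.
have : 1 < n.+1%:R * e.
  rewrite -ltr_pdivrMr// div1r; apply: lt_trans en _; by rewrite ltr_nat.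
rewrite intrD mulr1z in h2 h4; move: h1 h2 h3 h4.
move: (_ * x _ _) (_ * y _ _) (_ * e) (_ %:~R) => X Y E Z ? ? ? ? ?.
by rewrite ltr_norml; lra.
Qed.

Lemma continuous_measurable_rV d (f : 'rV[R]_d -> R) :
  continuous f -> measurable_fun [set: 'rV[R]_d] f.
Proof.
move=> /continuousP cf; apply: (measurability _ (RGenOpens.measurableE R)).
move=> _ [_ [a [b ->] <-]]; rewrite setTI; apply: open_measurable_rV.
by apply: cf; exact: interval_open.
Qed.

Lemma measurable_fun_affine d (l : R) (b : 'rV[R]_d) :
  measurable_fun [set: 'rV[R]_d] (fun x : 'rV[R]_d => l *: x + b).
Proof.
apply: measurable_fun_rV => i.
rewrite (_ : (fun _ => _) = (fun t : R => l * t + b ord0 i) \o (fun x : 'rV[R]_d => x ord0 i)).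
  apply: (@measurableT_comp _ _ _ _ _ _ (fun t : R => l * t + b ord0 i)).
    by apply: measurable_funD => //; apply: measurable_funM.
  exact: measurable_coord.
by apply/funext => x /=; rewrite !mxE.
Qed.

Local Open Scope ereal_scope.

(** The scaled image of Lebesgue measure gives each interval its length, which
characterizes Lebesgue measure. *)
Lemma ge0_integral_affine1 (l b : R) (F : measurableTypeR R -> \bar R) : (0 < l)%R ->
  measurable_fun [set: measurableTypeR R] F -> (forall x, 0 <= F x) ->
  l%:E * \int[@lebesgue_measure R]_t F (l * t + b)%R = \int[@lebesgue_measure R]_t F t.
Proof.
move=> l0 mF F0.
pose phi := fun t : measurableTypeR R => (l * t + b)%R : measurableTypeR R.
have mphi : measurable_fun setT phi.
  by apply: measurable_funD => //; apply: measurable_funM.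
pose l' := NngNum (ltW l0).
have E A : measurable A -> lebesgue_measure A = mscale l' (pushforward (@lebesgue_measure R) phi) A.
  apply: lebesgue_measure_unique => _ [[x y]] /= _ <-.
  rewrite /mscale/= /pushforward.
  rewrite (_ : phi @^-1` _ = `]((x - b) / l)%R, ((y - b) / l)%R]%classic); last first.
    apply/seteqP; split=> t /=; rewrite !in_itv/= /phi.
      by rewrite ltr_pdivrMr// ler_pdivlMr// ltrBlDr lerBrDr mulrC.
    by rewrite ltr_pdivrMr// ler_pdivlMr// ltrBlDr lerBrDr mulrC.
  rewrite !lebesgue_measure_itv/= !lte_fin ltr_pM2r ?invr_gt0// ltrD2r.
  case: ifPn => _; last by rewrite mule0.
  rewrite -!EFinD -EFinM; congr EFin; field; exact: lt0r_neq0.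
rewrite [RHS](eq_measure_integral (mscale l' (pushforward (@lebesgue_measure R) phi))); last first.
  by move=> A mA _; exact: E.
rewrite ge0_integral_mscale//=; congr (_ * _).
by rewrite ge0_integral_pushforward// preimage_setT.
Qed.

Lemma lebesgue_rVS n (F : 'rV[R]_n.+1 -> \bar R) : measurable_fun [set: 'rV[R]_n.+1] F -> (forall x, 0 <= F x) ->
  \int[lebesgue_rV R n.+1]_x F x =
  \int[@lebesgue_measure R]_t \int[lebesgue_rV R n]_v F (rV_cons (t, v)).
Proof.
move=> mF F0; rewrite /= /rV_product_step.
rewrite [LHS]ge0_integral_pushforward//; last exact: measurable_rV_cons.
rewrite preimage_setT fubini_tonelli1//=.
exact: (measurableT_comp mF (@measurable_rV_cons R n)).
Qed.

(** Tonelli reduces this to the real line, one coordinate at a time. *)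
Lemma ge0_integral_affine d (l : R) (b : 'rV[R]_d) (F : 'rV[R]_d -> \bar R) : (0 < l)%R ->
  measurable_fun [set: 'rV[R]_d] F -> (forall x, 0 <= F x) ->
  (l ^+ d)%:E * \int[lebesgue_rV R d]_x F (l *: x + b)%R = \int[lebesgue_rV R d]_x F x.
Proof.
move=> l0; elim: d b F => [|n IH] b F mF F0.
  rewrite expr0 mul1e; apply: eq_integral => x _; congr F.
  by apply/rowP => -[].
have mF' : measurable_fun [set: 'rV[R]_n.+1] (fun x : 'rV[R]_n.+1 => F (l *: x + b)%R).
  exact: (measurableT_comp mF (measurable_fun_affine l b)).
rewrite !lebesgue_rVS//.
have mFc : measurable_fun setT (fun z => F (rV_cons z)).
  exact: (measurableT_comp mF (@measurable_rV_cons R n)).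
have mFc1 : measurable_fun setT (fun t : measurableTypeR R => \int[lebesgue_rV R n]_v F (rV_cons (t, v))).
  by have := @measurable_fun_fubini_tonelli_F _ _ _ _ _ (lebesgue_rV R n) _ mFc (fun z => F0 _).
rewrite -[RHS](ge0_integral_affine1 (b ord0 ord0) l0)//; last first.
  by move=> t; exact: integral_ge0.
rewrite exprS EFinM -muleA; congr (_ * _).
rewrite -ge0_integralZl//; first last.
- by rewrite lee_fin exprn_ge0// ltW.
- by move=> t _; exact: integral_ge0.
- apply: (@measurable_fun_fubini_tonelli_F _ _ _ _ _ (lebesgue_rV R n) (fun z => F (l *: rV_cons z + b)%R)) => //.
  exact: (measurableT_comp mF' (@measurable_rV_cons R n)).
apply: eq_integral => t _.
rewrite -[RHS](IH (\row_j b ord0 (lift ord0 j)))//; last first.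
  exact: (measurableT_comp mFc (measurable_pair1 _)).
congr (_ * _); apply: eq_integral => v _; congr F.
apply/rowP => j.
have -> : (l *: rV_cons (t, v) + b)%R ord0 j = (l * rV_cons (t, v) ord0 j + b ord0 j)%R.
  by rewrite mxE [X in (X + _)%R]mxE.
case: (unliftP ord0 j) => [i|] ->; first by rewrite !rV_consS/= !mxE.
by rewrite !rV_cons0.
Qed.

End rV_measure.

(** * Bounded functions with compact support *)

Section compactly_supported.
Variables (R : realType) (d : nat).
Local Notation V := 'rV[R]_d.
Local Notation mu := (lebesgue_rV R d).
Implicit Types (f g : V -> R) (x b : V).

Lemma measurable_norm_ball x (r : R) : measurable [set y : V | `|y - x| < r].
Proof.
apply: open_measurable_rV; rewrite (_ : mkset _ = ball x r); first exact: ball_open.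
by rewrite -ball_normE; apply/seteqP; split=> y /=; rewrite distrC.
Qed.

Lemma lebesgue_rV_ball x (r : R) : 0 < r ->
  mu [set y | `|y - x| < r] = ((2 * r) ^+ d)%:E.
Proof.
move=> r0; rewrite (_ : mkset _ =
    [set y : V | forall i, `](x ord0 i - r), (x ord0 i + r)[%classic (y ord0 i)]).
  rewrite (lebesgue_rV_box (A := fun i => `](x ord0 i - r), (x ord0 i + r)[%classic))//.
  rewrite (eq_bigr (fun=> (2 * r)%:E)).
    by rewrite prodEFin prodr_const card_ord.
  move=> i _; rewrite lebesgue_measure_itv/= lte_fin ltrBlDr -addrA ltrDl addr_gt0//.
  by rewrite -EFinD; congr EFin; ring.
apply/seteqP; split=> y /= h.
  move=> i; rewrite in_itv/=; have := le_lt_trans (norm_coord (y - x) i) h.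
  by rewrite !mxE ltr_distl.
by apply: norm_rV_lt => // i; have := h i; rewrite in_itv/= !mxE ltr_distl.
Qed.

(** The working class of integrands.  Since its members are integrable and it is
closed under all the operations below, linearity, comparison and change of
variables for their integrals carry no integrability condition. *)
Definition bcs f := measurable_fun [set: V] f /\
  exists2 M : R, 0 < M & forall x, `|f x| <= M /\ (M < `|x| -> f x = 0).

Lemma bcs_integrable f : bcs f -> mu.-integrable [set: V] (EFin \o f).
Proof.
move=> [mf [M M0 fM]]; pose A := [set y : V | `|y - 0| < M + 1].
have mA : measurable A by exact: measurable_norm_ball.
have -> : EFin \o f = (EFin \o f) \_ A.
  apply/funext => x /=; rewrite patchE; case: ifPn => //.
  rewrite notin_setE /A/= subr0 => /negP; rewrite -leNgt => h.
  by rewrite (proj2 (fM x))//; apply: lt_le_trans h; rewrite ltrDl.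
apply: (proj1 (integrable_mkcond (mu := mu) (EFin \o f) mA)).
apply: (@measurable_bounded_integrable _ _ _ mu f A mA).
- have h : (lebesgue_rV R d A < +oo)%E by rewrite lebesgue_rV_ball ?ltry// addr_gt0.
  exact: h.
- exact: measurable_funTS.
- exists M; split; first exact: num_real.
  by move=> y My z _ /=; apply: le_trans (ltW My); exact: (proj1 (fM z)).
Qed.

Lemma bcsD f g : bcs f -> bcs g -> bcs (fun x => f x + g x).
Proof.
move=> [mf [M M0 fM]] [mg [N N0 gN]]; split; first exact: measurable_funD.
exists (M + N); first exact: addr_gt0.
move=> x; split.
  by apply: le_trans (ler_normD _ _) _; rewrite lerD//; [case: (fM x)|case: (gN x)].
move=> h; rewrite (proj2 (fM x)) ?(proj2 (gN x)) ?addr0//.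
  by apply: le_lt_trans h; rewrite lerDr ltW.
by apply: le_lt_trans h; rewrite lerDl ltW.
Qed.

(** Closed balls are compact, and continuous functions attain a maximum there. *)
Lemma continuous_bounded_ball g (M : R) : continuous g ->
  exists2 K : R, 0 < K & forall x, `|x| <= M -> `|g x| <= K.
Proof.
move=> cg.
have [M0|M0] := ltP M 0.
  by exists 1 => // x xM; have := le_lt_trans (le_trans (normr_ge0 x) xM) M0; rewrite ltxx.
pose B := [set x : V | `|x| <= M].
have cB : compact B.
  apply: bounded_closed_compact.
    exists M; split; first exact: num_real.
    by move=> y My z /= zM; apply: le_trans zM (ltW My).
  have -> : B = (fun x : V => `|x|) @^-1` [set t | t <= M] by [].
  by apply: closed_comp; [move=> x _; exact: norm_continuous | exact: closed_le].
have B0 : B !=set0 by exists 0; rewrite /B/= normr0.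
have cg' : {within B, continuous (fun x => `|g x|)}.
  apply: continuous_subspaceT => x; apply: continuous_comp; first exact: cg.
  exact: norm_continuous.
have [x _ xK] := EVT_max_rV B0 cB cg'.
exists (`|g x| + 1); first by rewrite ltr_wpDl.
by move=> y yM; apply: (le_trans (xK y _)); rewrite ?inE// lerDl.
Qed.

Lemma bcsM f g : bcs f -> continuous g -> bcs (fun x => f x * g x).
Proof.
move=> [mf [M M0 fM]] cg; split.
  by apply: measurable_funM => //; exact: continuous_measurable_rV.
have [K K0 gK] := continuous_bounded_ball M cg.
exists (M * K + M); first by rewrite addr_gt0// mulr_gt0.
move=> x; split; last first.
  move=> h; rewrite (proj2 (fM x)) ?mul0r//; apply: le_lt_trans h.
  by rewrite lerDr mulr_ge0// ltW.
have [xM|Mx] := leP `|x| M.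
  rewrite normrM; apply: (@le_trans _ _ (M * K)); last by rewrite lerDl ltW.
  by apply: ler_pM => //; [case: (fM x)|exact: gK].
by rewrite (proj2 (fM x))// mul0r normr0 addr_ge0 ?mulr_ge0 ?ltW.
Qed.

Lemma bcsZ f (k : R) : bcs f -> bcs (fun x => k * f x).
Proof.
move=> bf; rewrite (_ : (fun _ => _) = (fun x => f x * k)).
  by apply: bcsM => // x; exact: cst_continuous.
by apply/funext => x; rewrite mulrC.
Qed.

Lemma bcs_norm f : bcs f -> bcs (fun x => `|f x|).
Proof.
move=> [mf [M M0 fM]]; split; first exact: measurableT_comp.
exists M => // x; have [h1 h2] := fM x; split; first by rewrite normr_id.
by move=> /h2 ->; rewrite normr0.
Qed.

Lemma bcs_affine f (l : R) b : 0 < l -> bcs f -> bcs (fun x => f (l *: x + b)).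
Proof.
move=> l0 [mf [M M0 fM]]; split.
  exact: (measurableT_comp mf (measurable_fun_affine l b)).
exists (M + (M + `|b|) / l).
  by rewrite addr_gt0// divr_gt0// ltr_wpDr.
move=> x; split.
  apply: (@le_trans _ _ M); first by case: (fM (l *: x + b)).
  by rewrite lerDl divr_ge0 ?addr_ge0// ltW.
move=> h; apply: (proj2 (fM _)).
have {}h : (M + `|b|) / l < `|x| by apply: le_lt_trans h; rewrite lerDr ltW.
rewrite ltr_pdivrMr// mulrC -[X in X * `|x|](gtr0_norm l0) -normrZ in h.
rewrite -ltrBrDr in h; apply: lt_le_trans h _.
exact: lerB_normD.
Qed.

Lemma Rintegral_affine f (l : R) b : 0 < l -> bcs f ->
  l ^+ d * \int[mu]_x f (l *: x + b) = \int[mu]_x f x.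
Proof.
move=> l0 bf; have [mf _] := bf.
have mF : measurable_fun [set: V] (EFin \o f) by exact/measurable_EFinP.
rewrite /Rintegral.
have <- : ((l ^+ d)%:E * \int[mu]_x (f (l *: x + b))%:E = \int[mu]_x (f x)%:E)%E.
  rewrite integralE [in RHS]integralE.
  rewrite -(ge0_integral_affine b l0 (measurable_funepos mF))//.
  rewrite -(ge0_integral_affine b l0 (measurable_funeneg mF))//.
  rewrite muleBr//; last first.
  have /integral_funeneg_lt_pinfty h := bcs_integrable (bcs_affine b l0 bf).
    rewrite fin_num_adde_defl// fin_numN ge0_fin_numE; last by apply: integral_ge0.
    exact: h.
  by congr (_ * _ - _ * _)%E; apply: eq_integral => x _; rewrite ?funeposE ?funenegE.
rewrite fineM//; apply: integrable_fin_num => //.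
exact: bcs_integrable (bcs_affine b l0 bf).
Qed.

Lemma le_norm_Rintegral f g : bcs f -> bcs g -> (forall x, `|f x| <= g x) ->
  `|\int[mu]_x f x| <= \int[mu]_x g x.
Proof.
move=> bf bg fg; apply: le_trans (le_normr_Rintegral _ _) _ => //.
  exact: bcs_integrable.
by apply: le_Rintegral => //; apply: bcs_integrable => //; exact: bcs_norm.
Qed.

Lemma bcs_RintegralD f g : bcs f -> bcs g ->
  \int[mu]_x (f x + g x) = \int[mu]_x f x + \int[mu]_x g x.
Proof. by move=> bf bg; apply: RintegralD => //; exact: bcs_integrable. Qed.

Lemma bcs_RintegralZ f (k : R) : bcs f ->
  \int[mu]_x (k * f x) = k * \int[mu]_x f x.
Proof. by move=> bf; apply: RintegralZl => //; exact: bcs_integrable. Qed.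

Lemma bcsB f g : bcs f -> bcs g -> bcs (fun x => f x - g x).
Proof.
move=> bf bg; rewrite (_ : (fun _ => _) = (fun x => f x + (-1) * g x)).
  by apply: bcsD => //; exact: bcsZ.
by apply/funext => x; rewrite mulN1r.
Qed.

Lemma bcs_RintegralB f g : bcs f -> bcs g ->
  \int[mu]_x (f x - g x) = \int[mu]_x f x - \int[mu]_x g x.
Proof. by move=> bf bg; apply: RintegralB => //; exact: bcs_integrable. Qed.

Lemma bcs0 : bcs (fun=> 0).
Proof.
split; first exact: measurable_cst.
by exists 1 => // x; rewrite normr0.
Qed.

Lemma bcs_sum (I : Type) (r : seq I) (F : I -> V -> R) :
  (forall i, bcs (F i)) -> bcs (fun x => \sum_(i <- r) F i x).
Proof.
move=> bF; elim: r => [|i r IH].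
  by rewrite (_ : (fun _ => _) = fun=> 0) ?(funext (fun x => big_nil _ _ _ _))//; exact: bcs0.
under eq_fun do rewrite big_cons; exact: bcsD.
Qed.

Lemma bcs_Rintegral_sum (I : Type) (r : seq I) (F : I -> V -> R) :
  (forall i, bcs (F i)) ->
  \int[mu]_x (\sum_(i <- r) F i x) = \sum_(i <- r) \int[mu]_x F i x.
Proof.
move=> bF; elim: r => [|i r IH].
  under eq_Rintegral do rewrite big_nil.
  by rewrite big_nil /Rintegral integral0.
under eq_Rintegral do rewrite big_cons.
by rewrite big_cons bcs_RintegralD ?IH//; exact: bcs_sum.
Qed.

Lemma bcs_ball x (r : R) : 0 < r -> bcs (fun y => \1_[set y : V | `|y - x| < r] y).
Proof.
move=> r0; split; first exact: measurable_indic (measurable_norm_ball x r).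
exists (1 + `|x| + r); first by rewrite addr_gt0// ltr_wpDr.
move=> y; rewrite indicE; split.
  have h : 0 <= `|x| + r by rewrite addr_ge0// ltW.
  by case: (_ \in _); rewrite /= ?normr0 ?normr1; move: h; move: `|x| => a; lra.
move=> h; rewrite memNset//= => h'; have := ler_normD (y - x) x.
rewrite subrK => /(lt_le_trans h); move: h h'; move: `|y| `|x| `|y - x| => a b c; lra.
Qed.

Lemma Rintegral_ball x (r : R) : 0 < r ->
  \int[mu]_y (\1_[set y : V | `|y - x| < r] y) = (2 * r) ^+ d.
Proof.
move=> r0; rewrite /Rintegral integral_indic//; last exact: measurable_norm_ball.
by rewrite setIT; exact: (congr1 fine (lebesgue_rV_ball x r0)).
Qed.

End compactly_supported.

(** * Second-order Taylor estimates *)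

Section one_variable.
Variable R : realType.

Lemma mvt_at (g g' : R -> R) (a b : R) : (forall s : R, is_derive s 1 g (g' s)) ->
  exists2 c, `|c - a| <= `|b - a| & g b - g a = g' c * (b - a).
Proof.
move=> dg.
have cg (x y : R) : {within `[x, y], continuous g}.
  apply: continuous_subspaceT => s; apply: differentiable_continuous.
  by apply/derivable1_diffP; case: (dg s).
have [ab|/ltW ba] := leP a b.
  have [c cab e] := MVT_segment ab (fun s _ => dg s) (cg a b).
  exists c => //; move: cab; rewrite in_itv/= => /andP[? ?].
  by rewrite !ger0_norm ?subr_ge0// lerD2r.
have [c cab e] := MVT_segment ba (fun s _ => dg s) (cg b a).
exists c.
  move: cab; rewrite in_itv/= => /andP[? ?].
  by rewrite !ler0_norm ?subr_le0// !opprB lerD2l lerN2.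
by rewrite -[LHS]opprB e -mulrN opprB.
Qed.

(** Two applications of the mean value theorem; the constant is not optimal. *)
Lemma taylor2 (g g' g'' : R -> R) (K t : R) :
  (forall s : R, is_derive s 1 g (g' s)) -> (forall s : R, is_derive s 1 g' (g'' s)) ->
  (forall s, `|g'' s| <= K) -> `|g t - g 0 - t * g' 0| <= K * t ^+ 2.
Proof.
move=> dg dg' gK; have [c ct ->] := mvt_at 0 t dg.
rewrite subr0 mulrC -mulrBr; have [e _ ->] := mvt_at 0 c dg'.
rewrite !subr0 in ct *; rewrite !normrM -[t ^+ 2]real_normK ?num_real// expr2 [leRHS]mulrCA.
by rewrite ler_wpM2l//; exact: ler_pM.
Qed.

(** The derivative of the cosine is its translate by [pi / 2]; with this form of
the derivative the oscillatory integrals below are closed under differentiation. *)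
Lemma cos_taylor (a h : R) : `|cos (a + h) - cos a - h * cos (a + pi / 2)| <= h ^+ 2.
Proof.
have D (b s : R) : is_derive s 1 (fun s => cos (s + b)) (cos (s + b + pi / 2)).
  rewrite cosDpihalf -[- sin _]mulr1.
  exact: (@is_derive1_comp _ (@cos R) (shift b) s _ _ _ (is_derive_shift s 1 b)).
rewrite -[leRHS]mul1r.
have := @taylor2 (fun s => cos (s + a)) (fun s => cos (s + (a + pi / 2)))
  (fun s => cos (s + (a + pi / 2) + pi / 2)) 1 h.
rewrite !add0r ![h + _]addrC; apply => s; do ?[exact: D|exact: cos_max].
by have := D a s; rewrite addrA.
Qed.

Lemma cos_lip (a b : R) : `|cos a - cos b| <= `|a - b|.
Proof.
have D (s : R) : is_derive s 1 (@cos R) (- sin s) by exact: is_derive_cos.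
have [c _ ->] := mvt_at b a D.
rewrite normrM normrN -[leRHS]mul1r ler_wpM2r//.
by rewrite -[c](subrK (pi / 2)) sinDpihalf cos_max.
Qed.

End one_variable.

Section line_derivative.
Variables (R : realType) (d : nat).
Local Notation V := 'rV[R]_d.
Implicit Types (u : V -> R) (x v : V).

Lemma is_derive_line u x v (t l : R) :
  is_derive (x + t *: v) v u l -> is_derive t 1 (fun s => u (x + s *: v)) l.
Proof.
move=> [du <-].
have E : (fun h : R => h^-1 *: (((fun s => u (x + s *: v)) \o shift t) (h *: 1) - u (x + t *: v)))
       = (fun h : R => h^-1 *: ((u \o shift (x + t *: v)) (h *: v) - u (x + t *: v))).
  apply/funext => h /=; congr (_ *: (u _ - _)).
  by rewrite [_%:A]mulr1 scalerDl addrCA.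
by split; rewrite ?/derivable ?/derive E.
Qed.

(** Uniform first-order Taylor expansions with quadratic remainder in the
direction [v].  They pass under the integral sign by a mere comparison of
integrals, which replaces dominated convergence for difference quotients. *)
Definition quad_derive v u u' := exists K : R, forall x t,
  `|u (x + t *: v) - u x - t * u' x| <= K * t ^+ 2.

Lemma quad_derive_is_derive v u u' x : quad_derive v u u' -> is_derive x v u (u' x).
Proof.
move=> [K HK].
have H : (fun h : R => h^-1 *: ((u \o shift x) (h *: v) - u x)) @ 0^' --> u' x.
  apply/cvgrPdist_le => /= e e0.
  near=> h.
  have h0 : h != 0 by near: h; exact: nbhs_dnbhs_neq.
  rewrite distrC -(ler_pM2l (_ : 0 < `|h|)) ?normr_gt0// -normrM mulrBr.
  rewrite [h * (_ *: _)]mulrA mulfV// mul1r.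
  rewrite [h *: v + x]addrC; apply: le_trans (HK x h) _.
  rewrite -[h ^+ 2]real_normK ?num_real// expr2 mulrCA ler_wpM2l//.
  have : `|h| <= e / (`|K| + 1).
    near: h; apply: dnbhs0_le; rewrite divr_gt0// ltr_wpDl//.
  rewrite ler_pdivlMr ?ltr_wpDl// => h1.
  apply: le_trans h1; rewrite mulrC ler_wpM2l//.
  by rewrite (le_trans (ler_norm K))// lerDl.
by split; [apply/cvg_ex; exists (u' x)|apply/cvg_lim].
Unshelve. all: by end_near. Qed.

Lemma taylor_quad_derive v u u' u'' (K : R) :
  (forall x, is_derive x v u (u' x)) -> (forall x, is_derive x v u' (u'' x)) ->
  (forall x, `|u'' x| <= K) -> quad_derive v u u'.
Proof.
move=> du du' HK; exists K => x t.
have := @taylor2 R (fun s => u (x + s *: v)) (fun s => u' (x + s *: v))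
  (fun s => u'' (x + s *: v)) K t.
rewrite scale0r addr0; apply => // s; exact: is_derive_line.
Qed.

End line_derivative.

(** * Smooth functions and integration by parts *)

Section smooth_functions.
Variables (R : realType) (d : nat).
Local Notation V := 'rV[R]_d.
Implicit Types (f g u : V -> R) (x v : V).

Lemma smooth_continuous f : smooth f -> continuous f.
Proof. by move=> sf; case: (sf [::]). Qed.

Lemma smooth_is_derive f i x : smooth f -> is_derive x 'e_i f ('D_'e_i f x).
Proof. by move=> sf; apply: DeriveDef => //; case: (sf [::]) => _; exact. Qed.

Lemma pderive_rcons s i f : pderive (rcons s i) f = pderive s ('D_'e_i f).
Proof. by rewrite /pderive foldr_rcons. Qed.

Lemma smooth_derive f i : smooth f -> smooth ('D_'e_i f).
Proof. by move=> sf s; rewrite -pderive_rcons; exact: sf. Qed.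

(** A coinduction principle: a class of continuous functions that is stable under
partial derivatives consists of smooth functions. *)
Lemma smooth_ind (P : (V -> R) -> Prop) :
  (forall f, P f -> continuous f) ->
  (forall f i, P f -> exists2 g, P g & forall x, is_derive x 'e_i f (g x)) ->
  forall f, P f -> smooth f.
Proof.
move=> Pc Pd f Pf.
have Ps s : P (pderive s f).
  elim: s => //= i s IH; have [g Pg dg] := Pd _ i IH.
  by rewrite (_ : 'D_'e_i _ = g)//; apply/funext => x; exact: derive_val.
move=> s; split; first exact: Pc.
by move=> i x; have [g _ /(_ x)[]] := Pd _ i (Ps s).
Qed.

Lemma smoothD f g : smooth f -> smooth g -> smooth (fun x => f x + g x).
Proof.
move=> sf sg; pose P h := exists a b : V -> R, [/\ smooth a, smooth b & h = a \+ b].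
apply: (smooth_ind (P := P)); last by exists f, g.
  by move=> _ [a [b [sa sb ->]]] x; apply: continuousD; exact: smooth_continuous.
move=> _ i [a [b [sa sb ->]]]; exists ('D_'e_i a \+ 'D_'e_i b).
  exists ('D_'e_i a), ('D_'e_i b).
  by split; [exact: (smooth_derive i sa)|exact: (smooth_derive i sb)|].
by move=> x; apply: is_deriveD; exact: smooth_is_derive.
Qed.

Lemma smooth_cst (c : R) : smooth (fun _ : V => c).
Proof.
apply: (smooth_ind (P := fun h => exists c : R, h = cst c)); last by exists c.
  by move=> _ [b ->] x; exact: cst_continuous.
by move=> _ i [b ->]; exists (cst 0); [exists 0|move=> x; exact: is_derive_cst].
Qed.

Lemma smooth_sum (I : Type) (r : seq I) (F : I -> V -> R) :
  (forall i, smooth (F i)) -> smooth (fun x => \sum_(i <- r) F i x).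
Proof.
move=> sF; elim: r => [|i r IH].
  by under eq_fun do rewrite big_nil; exact: (smooth_cst 0).
by under eq_fun do rewrite big_cons; exact: (smoothD (sF i) IH).
Qed.

(** Products are not stable under differentiation, but finite sums of products
of smooth functions are. *)
Lemma smoothM f g : smooth f -> smooth g -> smooth (fun x => f x * g x).
Proof.
move=> sf sg.
pose P h := exists2 r : seq ((V -> R) * (V -> R)),
  (forall ab, ab \in r -> smooth ab.1 /\ smooth ab.2) &
  h = fun x => \sum_(ab <- r) ab.1 x * ab.2 x.
have Pfg : P (fun x => f x * g x).
  exists [:: (f, g)]; first by move=> ab; rewrite inE => /eqP ->; split.
  by apply/funext => x; rewrite big_seq1.
apply: (smooth_ind (P := P)) Pfg.
  move=> _ [r sr ->]; elim: r sr => [|[a b] r IH] sr.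
    by under eq_fun do rewrite big_nil; move=> x; exact: cst_continuous.
  have [/= sa sb] := sr _ (mem_head _ _).
  rewrite (_ : (fun _ => _) = (fun x => a x * b x) \+ (fun x => \sum_(ab <- r) ab.1 x * ab.2 x)).
    move=> x; apply: continuousD; last first.
      by apply: IH => ab abr; apply: sr; rewrite inE abr orbT.
    by apply: continuousM; [exact: (smooth_continuous sa)|exact: (smooth_continuous sb)].
  by apply/funext => x; rewrite big_cons.
move=> _ i [r sr ->].
exists (fun x => \sum_(ab <- [seq ('D_'e_i ab.1, ab.2) | ab <- r] ++ [seq (ab.1, 'D_'e_i ab.2) | ab <- r]) ab.1 x * ab.2 x).
  eexists; last reflexivity.
  move=> ab; rewrite mem_cat => /orP[] /mapP[ab' /sr[sa sb] ->]/=.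
    by split; [exact: (smooth_derive i sa)|].
  by split; [|exact: (smooth_derive i sb)].
move=> x; elim: r sr => [|[a b] r IH] sr.
  under eq_fun do rewrite big_nil.
  by rewrite big_nil; exact: is_derive_cst.
under eq_fun do rewrite big_cons/=.
have [/= sa sb] := sr _ (mem_head _ _).
have {}IH := IH (fun ab abr => sr ab (mem_behead (s := _ :: r) abr)).
rewrite big_cons big_cat/= big_cons/=.
have := is_deriveD (is_deriveM (smooth_is_derive i x sa) (smooth_is_derive i x sb)) IH.
move=> /is_derive_eq; apply; rewrite big_cat/= /GRing.scale/=.
by move: (\sum_(_ <- _) _) (\sum_(_ <- _) _) ('D_'e_i a x) ('D_'e_i b x) (a x) (b x) => A B C D E F; ring.
Qed.

Lemma smoothZ f (c : R) : smooth f -> smooth (fun x => c * f x).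
Proof. by move=> sf; exact: (smoothM (smooth_cst c) sf). Qed.

Lemma smoothB f g : smooth f -> smooth g -> smooth (fun x => f x - g x).
Proof.
move=> sf sg; rewrite (_ : (fun _ => _) = fun x => f x + (-1) * g x).
  exact: (smoothD sf (smoothZ (-1) sg)).
by apply/funext => x; rewrite mulN1r.
Qed.

Lemma is_derive_coord i j x : is_derive x 'e_i (fun y : V => y ord0 j) (i == j)%:R.
Proof.
have : quad_derive 'e_i (fun y : V => y ord0 j) (fun=> (i == j)%:R).
  exists 0 => y t; rewrite !mxE/= mul0r.
  by rewrite eq_sym addrC addrK subrr normr0.
exact: quad_derive_is_derive.
Qed.

Lemma smooth_coord j : smooth (fun y : V => y ord0 j).
Proof.
apply: (smooth_ind (P := fun h => (exists c : R, h = cst c) \/ h = fun y : V => y ord0 j)); last by right.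
  move=> _ [[b ->]|->]; first by move=> x; exact: cst_continuous.
  exact: coord_continuous.
move=> _ i [[b ->]|->].
  by exists (cst 0); [left; exists 0|move=> x; exact: is_derive_cst].
by exists (cst (i == j)%:R); [left; exists (i == j)%:R|move=> x; exact: is_derive_coord].
Qed.

Lemma is_derive_affine u (l : R) x b v w : is_derive (l *: x + b) v u w ->
  is_derive x v (fun y => u (l *: y + b)) (l * w).
Proof.
move=> du.
have [->|l0] := eqVneq l 0.
  rewrite mul0r (_ : (fun _ => _) = cst (u b)); first exact: is_derive_cst.
  by apply/funext => y; rewrite scale0r add0r.
have E : (fun h : R => h^-1 *: (((fun y => u (l *: y + b)) \o shift x) (h *: v) - u (l *: x + b)))
       = (fun h : R => l *: ((h * l)^-1 *: ((u \o shift (l *: x + b)) ((h * l) *: v) - u (l *: x + b)))).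
  apply/funext => h /=; rewrite scalerA invfM mulrCA mulfV// mulr1.
  by congr (_ *: (u _ - _)); rewrite scalerDr scalerA addrA [l * h]mulrC.
have H : (fun h : R => h^-1 *: (((fun y => u (l *: y + b)) \o shift x) (h *: v) - u (l *: x + b))) @ 0^' --> l * w.
  rewrite E; apply: cvgZr.
  have [du1 <-] := du.
  have := du1; rewrite /derivable => /cvg_ex[w' hw'].
  have -> : 'D_v u (l *: x + b) = w' by apply/cvg_lim.
  have hl : (fun h : R => h * l) @ 0^' --> (0 : R)^'.
    move=> A /nbhs_ballP[e /= e0 eA].
    suff : \forall h \near (0 : R)^', A (h * l) by [].
    near=> h; apply: eA.
      rewrite -ball_normE/= sub0r normrN normrM -ltr_pdivlMr ?normr_gt0//.
      by near: h; apply: dnbhs0_lt; rewrite divr_gt0 ?normr_gt0.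
    rewrite mulf_neq0//; near: h; exact: nbhs_dnbhs_neq.
  exact: (cvg_comp _ _ hl hw').
by split; [apply/cvg_ex; exists (l * w)|apply/cvg_lim].
Unshelve. all: by end_near. Qed.

(** The class stable under differentiation is that of the multiples
[c * g (l *: x + b)]. *)
Lemma smooth_affine f (l : R) b : smooth f -> smooth (fun x => f (l *: x + b)).
Proof.
move=> sf; pose P h := exists c : R, exists2 g, smooth g & h = fun x => c * g (l *: x + b).
apply: (smooth_ind (P := P)); last by exists 1, f => //; apply/funext => x; rewrite mul1r.
  move=> _ [c [g sg ->]] x; apply: continuousM; first exact: cst_continuous.
  apply: continuous_comp; last exact: smooth_continuous.
  by apply: continuousD; [exact: scaler_continuous|exact: cst_continuous].
move=> _ i [c [g sg ->]].
exists (fun x => c * l * ('D_'e_i g) (l *: x + b)).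
  by exists (c * l), ('D_'e_i g); [exact: (smooth_derive i sg)|].
move=> x; have := is_derive_affine (smooth_is_derive i (l *: x + b) sg).
move=> /(is_deriveZ c); rewrite /GRing.scale/= mulrA; exact.
Qed.

End smooth_functions.

Section smooth_compact_support.
Variables (R : realType) (d : nat).
Local Notation V := 'rV[R]_d.
Local Notation mu := (lebesgue_rV R d).
Implicit Types (f u phi : V -> R) (x v : V).

Definition smoothc phi := smooth phi /\ exists M : R, forall x, M < `|x| -> phi x = 0.

Lemma bcs_continuous f : continuous f -> (exists M : R, forall x, M < `|x| -> f x = 0) -> bcs f.
Proof.
move=> cf [M fM]; split; first exact: continuous_measurable_rV.
have [K K0 fK] := continuous_bounded_ball M cf.
exists (K + `|M|); first by rewrite ltr_wpDr.
move=> x; split; last first.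
  by move=> h; apply: fM; apply: le_lt_trans h; rewrite (le_trans (ler_norm M))// lerDr ltW.
have [xM|Mx] := leP `|x| M; first by rewrite (le_trans (fK _ xM))// lerDl.
by rewrite fM// normr0 addr_ge0// ltW.
Qed.

Lemma continuous_shift b : continuous (fun x : V => x + b).
Proof.
move=> x; apply: (@continuousD _ _ _ (fun x : V => x) (cst b)); last exact: cst_continuous.
by move=> A.
Qed.

Lemma smoothc_bcs phi : smoothc phi -> bcs phi.
Proof. by move=> [sp cp]; apply: bcs_continuous => //; exact: smooth_continuous. Qed.

Lemma smoothc_continuous phi : smoothc phi -> continuous phi.
Proof. by move=> [sp _]; exact: smooth_continuous. Qed.

Lemma smoothc_derive i phi : smoothc phi -> smoothc ('D_'e_i phi).
Proof.
move=> [sp [M pM]]; split; first exact: smooth_derive.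
exists M => x Mx; rewrite -(derive_cst (0 : R) x 'e_i); apply: near_eq_derive.
have H : nbhs x [set y : V | M < `|y|] := @norm_continuous R V x _ (lt_nbhsr Mx).
by apply: (@filterS _ (nbhs x) _ _ _ _ H) => y /= My; exact: pM.
Qed.

Lemma smoothcM phi f : smoothc phi -> smooth f -> smoothc (fun x => phi x * f x).
Proof.
move=> [sp [M pM]] sf; split; first exact: (smoothM sp sf).
by exists M => x /pM ->; rewrite mul0r.
Qed.

Lemma smoothcB phi f : smoothc phi -> smoothc f -> smoothc (fun x => phi x - f x).
Proof.
move=> [sp [M pM]] [sf [N fN]]; split; first exact: (smoothB sp sf).
by exists (Num.max M N) => x; rewrite gt_max => /andP[/pM -> /fN ->]; rewrite subr0.
Qed.

Lemma smoothc_affine phi (l : R) b : 0 < l -> smoothc phi -> smoothc (fun x => phi (l *: x + b)).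
Proof.
move=> l0 [sp [M pM]]; split; first exact: (smooth_affine l b sp).
exists ((M + `|b|) / l) => x; rewrite ltr_pdivrMr// mulrC => h; apply: pM.
rewrite -[X in X * `|x|](gtr0_norm l0) -normrZ -ltrBrDr in h.
by apply: lt_le_trans h _; exact: lerB_normD.
Qed.

Lemma smoothc_is_derive phi i x : smoothc phi -> is_derive x 'e_i phi ('D_'e_i phi x).
Proof. by move=> [sp _]; exact: smooth_is_derive. Qed.

Lemma bcs_bounded f : bcs f -> exists2 K : R, 0 < K & forall x, `|f x| <= K.
Proof. by move=> [_ [M M0 fM]]; exists M => // x; case: (fM x). Qed.

Lemma smoothc_quad_derive phi i : smoothc phi -> quad_derive 'e_i phi ('D_'e_i phi).
Proof.
move=> sp; have sp' := smoothc_derive i sp.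
have [K _ HK] := bcs_bounded (smoothc_bcs (smoothc_derive i sp')).
exact: (taylor_quad_derive (fun x => smoothc_is_derive i x sp)
  (fun x => smoothc_is_derive i x sp') HK).
Qed.

(** Translation invariance moves the increment [t *: v] from [f] to [u].  Comparing
the first-order expansions of both sides shows that the sum of the two integrals
is [O(t)], hence 0. *)
Lemma integration_by_parts v f f' u u' : continuous u -> continuous u' ->
  bcs f -> bcs f' -> quad_derive v f f' -> quad_derive v u u' ->
  \int[mu]_x (f' x * u x) = - \int[mu]_x (f x * u' x).
Proof.
move=> cu cu' bf bf' [K1 H1] [K2 H2].
have [_ [M M0 fM]] := bf; have [_ [M' M'0 fM']] := bf'.
set A := \int[mu]_x _; set B := \int[mu]_x (_ * u' _).
apply/eqP; rewrite -addr_eq0 -normr_le0.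
(* f, f' and the translates of f by [t *: v], 0 < t <= 1, vanish outside the ball of radius r *)
pose r := M + M' + `|v| + 1.
have r0 : 0 < r by rewrite /r; move: (normr_ge0 v); lra.
have [U U0 uU] := continuous_bounded_ball r cu.
pose J := fun y => \1_[set y : V | `|y - 0| < r] y : R.
pose C := `|K1| * U * (\int[mu]_x J x) + `|K2| * (\int[mu]_x `|f x|).
have J0 : bcs J by exact: bcs_ball.
have key t : 0 < t -> t <= 1 -> `|A + B| <= t * C.
  move=> t0 t1.
  have bft : bcs (fun x => f (x + t *: v)).
    have := bcs_affine (t *: v) ltr01 bf.
    by under eq_fun do rewrite scale1r.
  have cut : continuous (fun x => u (x - t *: v)).
    move=> x; apply: continuous_comp; last exact: cu.
    exact: continuous_shift.
  have b1 : bcs (fun x => f x * u x) by exact: bcsM.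
  have b2 : bcs (fun x => f' x * u x) by exact: bcsM.
  have b3 : bcs (fun x => f x * u' x) by exact: bcsM.
  have E : \int[mu]_x (f (x + t *: v) * u x) = \int[mu]_x (f x * u (x - t *: v)).
    rewrite -(@Rintegral_affine _ _ _ 1 (t *: v) ltr01 (bcsM bf cut)) expr1n mul1r.
    by apply: eq_Rintegral => x _; rewrite scale1r addrK.
  have b4 := bcsM bft cu; have b5 := bcsM bf cut.
  have tAB : t * (A + B) =
     (- (\int[mu]_x ((f (x + t *: v) - f x - t * f' x) * u x))) +
     (\int[mu]_x (f x * (u (x - t *: v) - u x - (- t) * u' x))).
    under eq_Rintegral do rewrite !mulrBl -mulrA.
    rewrite (bcs_RintegralB (bcsB b4 b1) (bcsZ t b2)) (bcs_RintegralB b4 b1).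
    rewrite (bcs_RintegralZ t b2).
    under [in X in _ = _ + X]eq_Rintegral => x _.
      rewrite (_ : f x * _ = f x * u (x - t *: v) - f x * u x + t * (f x * u' x)); last by ring.
      over.
    rewrite (bcs_RintegralD (bcsB b5 b1) (bcsZ t b3)) (bcs_RintegralB b5 b1).
    rewrite (bcs_RintegralZ t b3).
    by rewrite E -/A -/B; ring.
  rewrite -(ler_pM2l t0) -{1}(gtr0_norm t0) -normrM tAB.
  apply: le_trans (ler_normD _ _) _; rewrite normrN.
  have -> : t * (t * C) = (\int[mu]_x (`|K1| * U * t ^+ 2 * J x)) + (\int[mu]_x (`|K2| * t ^+ 2 * `|f x|)).
    rewrite (bcs_RintegralZ _ J0) (bcs_RintegralZ _ (bcs_norm bf)).
    by rewrite /C; ring.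
  apply: lerD.
    apply: le_norm_Rintegral.
    - by apply: bcsM => //; apply: bcsB; [exact: bcsB|exact: bcsZ].
    - exact: bcsZ.
    move=> x; rewrite /J indicE; have [xr|xr] := ltP `|x| r.
      rewrite mem_set/= ?subr0// mulr1 normrM mulrAC ler_pM//; last by rewrite uU// ltW.
      by rewrite (le_trans (H1 x t))// ler_wpM2r ?sqr_ge0// ler_norm.
    rewrite memNset/= ?subr0; last by apply/negP; rewrite -leNgt.
    have fx0 : f x = 0.
      apply: (fM _).2; apply: lt_le_trans xr; rewrite /r.
      by move: (normr_ge0 v); lra.
    have fx'0 : f' x = 0.
      apply: (fM' _).2; apply: lt_le_trans xr; rewrite /r.
      by move: (normr_ge0 v); lra.
    have ftx0 : f (x + t *: v) = 0.
      apply: (fM _).2; have := lerB_normD x (t *: v); apply: lt_le_trans.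
      rewrite normrZ gtr0_norm//; have : t * `|v| <= `|v| by rewrite ler_piMl.
      by move: xr; rewrite /r; move: `|x| `|v| (t * _) => a b c; lra.
    by rewrite fx0 fx'0 ftx0 mulr0 !subr0 mul0r normr0 mulr0.
  apply: le_norm_Rintegral.
  - rewrite (_ : (fun _ => _) = (fun x => (f x * u (x - t *: v) - f x * u x) + t * (f x * u' x))).
      exact: (bcsD (bcsB b5 b1) (bcsZ t b3)).
    by apply/funext => x; ring.
  - by apply: bcsZ; exact: bcs_norm.
  move=> x; rewrite normrM mulrC ler_wpM2r//.
  have := H2 x (- t); rewrite scaleNr sqrrN => /le_trans; apply.
  by rewrite ler_wpM2r ?sqr_ge0// ler_norm.
apply/ler_addgt0Pl => e e0; rewrite addr0.
have C0 : 0 <= C.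
  by have := key 1 ltr01 (lexx _); rewrite mul1r; apply: le_trans.
pose t := Num.min 1 (e / (C + 1)).
have t0 : 0 < t by rewrite lt_min ltr01 divr_gt0// ltr_wpDl.
apply: le_trans (key t t0 _) _; first by rewrite ge_min lexx.
apply: (@le_trans _ _ (t * (C + 1))); first by rewrite ler_wpM2l ?lerDl// ltW.
by rewrite -ler_pdivlMr ?ltr_wpDl// ge_min lexx orbT.
Qed.

End smooth_compact_support.

(** * Oscillatory integrals *)

Section oscillatory_integral.
Variables (R : realType) (d : nat).
Local Notation V := 'rV[R]_d.
Local Notation mu := (lebesgue_rV R d).
Implicit Types (f phi : V -> R) (x y v xi : V) (th : R).

Lemma dotvDl x v t xi : dotv (x + t *: v) xi = dotv x xi + t * dotv v xi.
Proof.
rewrite /dotv mulr_sumr -big_split/=; apply: eq_bigr => i _.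
by rewrite !mxE mulrDl mulrA.
Qed.

Lemma dotvC x y : dotv x y = dotv y x.
Proof. by apply: eq_bigr => i _; rewrite mulrC. Qed.

Lemma dotvZl (t : R) v xi : dotv (t *: v) xi = t * dotv v xi.
Proof. by rewrite /dotv mulr_sumr; apply: eq_bigr => i _; rewrite mxE mulrA. Qed.

Lemma dotvBl x y xi : dotv (x - y) xi = dotv x xi - dotv y xi.
Proof. by have := dotvDl x y (-1) xi; rewrite scaleN1r mulN1r. Qed.

Lemma dotv_delta i xi : dotv 'e_i xi = xi ord0 i.
Proof.
rewrite /dotv (bigD1 i)//= big1 ?addr0; last first.
  by move=> j ji; rewrite mxE (negbTE ji) andbF mul0r.
by rewrite mxE !eqxx mul1r.
Qed.

Lemma abs_dotv x y : `|dotv x y| <= d%:R * `|x| * `|y|.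
Proof.
apply: le_trans (ler_norm_sum _ _ _) _.
have -> : d%:R * `|x| * `|y| = \sum_(i < d) (`|x| * `|y|).
  by rewrite sumr_const card_ord -mulrA mulr_natl.
by apply: ler_sum => i _; rewrite normrM ler_pM// norm_coord.
Qed.

Lemma smooth_dotv x : smooth (fun xi => dotv x xi).
Proof.
apply: (smooth_sum (index_enum 'I_d) (F := fun i xi => x ord0 i * xi ord0 i)) => i.
exact: (smoothZ (x ord0 i) (@smooth_coord R d i)).
Qed.

(** The phase [th] makes the real and the imaginary part of [exp (i <x, xi>)]
members of one family, which contains its own derivatives up to factors. *)
Definition wave x th : V -> R := fun xi => cos (dotv x xi + th).

Lemma continuous_wave x th : continuous (wave x th).
Proof.
move=> xi; apply: continuous_comp; last exact: continuous_cos.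
apply: (@continuousD _ _ _ (dotv x) (cst th)); last exact: cst_continuous.
exact: (smooth_continuous (smooth_dotv x)).
Qed.

Lemma quad_derive_wave v x th :
  quad_derive v (wave x th) (fun xi => dotv x v * wave x (th + pi / 2) xi).
Proof.
exists (dotv x v ^+ 2) => xi t.
rewrite /wave (dotvC x (xi + _)) dotvDl !(dotvC _ x).
have -> : dotv x xi + t * dotv x v + th = dotv x xi + th + t * dotv x v by ring.
have -> : t * (dotv x v * cos (dotv x xi + (th + pi / 2))) =
  (t * dotv x v) * cos (dotv x xi + th + pi / 2) by rewrite addrA mulrA.
by rewrite -exprMn [dotv x v * t]mulrC; exact: cos_taylor.
Qed.

(** Up to a constant, [osc 0 phi] and [osc (- (pi / 2)) phi] are the real and the
imaginary part of the inverse Fourier transform of [phi]. *)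
Definition osc th phi x := \int[mu]_xi (phi xi * wave x th xi).

Lemma bcs_osc th phi x : bcs phi -> bcs (fun xi => phi xi * wave x th xi).
Proof. by move=> bp; apply: bcsM => //; exact: continuous_wave. Qed.

Lemma oscZ th phi (k : R) x : bcs phi ->
  osc th (fun xi => k * phi xi) x = k * osc th phi x.
Proof.
move=> bp; rewrite /osc -(bcs_RintegralZ k (bcs_osc th x bp)).
by apply: eq_Rintegral => xi _; rewrite mulrA.
Qed.

Lemma osc_sum th (I : Type) (r : seq I) (F : I -> V -> R) x : (forall i, bcs (F i)) ->
  osc th (fun xi => \sum_(i <- r) F i xi) x = \sum_(i <- r) osc th (F i) x.
Proof.
move=> bF; rewrite /osc -(bcs_Rintegral_sum r (fun i => bcs_osc th x (bF i))).
by apply: eq_Rintegral => xi _; rewrite mulr_suml.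
Qed.

Lemma osc_scale th phi (l : R) x : 0 < l -> bcs phi ->
  osc th (fun xi => phi (l^-1 *: xi)) x = l ^+ d * osc th phi (l *: x).
Proof.
move=> l0 bp; have l'0 : 0 < l^-1 by rewrite invr_gt0.
rewrite {2}/osc -(Rintegral_affine 0 l'0 (bcs_osc th (l *: x) bp)) mulrA -exprMn.
rewrite divff ?gt_eqF// expr1n mul1r; apply: eq_Rintegral => xi _.
rewrite addr0 /wave dotvZl [dotv x (_ *: _)]dotvC dotvZl dotvC mulrA divff ?gt_eqF//.
by rewrite mul1r.
Qed.

Lemma osc_le th phi x : bcs phi -> `|osc th phi x| <= \int[mu]_xi `|phi xi|.
Proof.
move=> bp; apply: le_norm_Rintegral (bcs_norm bp) _; first exact: bcs_osc.
by move=> xi; rewrite normrM ler_piMr// cos_max.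
Qed.

Lemma bcs_dotv phi v : bcs phi -> bcs (fun xi => phi xi * dotv v xi).
Proof. by move=> bp; apply: bcsM => //; exact: (smooth_continuous (smooth_dotv v)). Qed.

(** Differentiation under the integral sign, by applying [cos_taylor] to the
integrand. *)
Lemma osc_quad_derive th phi v : bcs phi ->
  quad_derive v (osc th phi) (osc (th + pi / 2) (fun xi => phi xi * dotv v xi)).
Proof.
move=> bp; have bpv := bcs_dotv v bp; have bpvv := bcs_dotv v bpv.
exists (\int[mu]_xi `|phi xi * dotv v xi * dotv v xi|) => x t.
rewrite /osc -(bcs_RintegralB (bcs_osc _ _ bp) (bcs_osc _ _ bp)).
rewrite -(bcs_RintegralZ t (bcs_osc _ _ bpv)).
rewrite -(bcs_RintegralB (bcsB (bcs_osc _ _ bp) (bcs_osc _ _ bp)) (bcsZ t (bcs_osc _ _ bpv))).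
rewrite [leRHS]mulrC -(bcs_RintegralZ _ (bcs_norm bpvv)).
apply: le_norm_Rintegral.
- exact: (bcsB (bcsB (bcs_osc _ _ bp) (bcs_osc _ _ bp)) (bcsZ t (bcs_osc _ _ bpv))).
- exact: (bcsZ _ (bcs_norm bpvv)).
move=> xi; rewrite /wave.
have -> : phi xi * cos (dotv (x + t *: v) xi + th) - phi xi * cos (dotv x xi + th) -
   t * (phi xi * dotv v xi * cos (dotv x xi + (th + pi / 2))) =
   phi xi * (cos (dotv x xi + th + t * dotv v xi) - cos (dotv x xi + th) -
     (t * dotv v xi) * cos (dotv x xi + th + pi / 2)).
  rewrite dotvDl (addrA (dotv x xi) th).
  have -> : dotv x xi + t * dotv v xi + th = dotv x xi + th + t * dotv v xi by ring.
  by ring.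
rewrite normrM; apply: le_trans (ler_wpM2l (normr_ge0 _) (cos_taylor _ _)) _.
rewrite -[phi xi * _ * _]mulrA normrM [leRHS]mulrCA; apply: ler_wpM2l => //.
rewrite exprMn ler_wpM2l ?sqr_ge0//.
by rewrite -expr2 ler_norm.
Qed.

Lemma osc_lip th phi x y : bcs phi ->
  `|osc th phi x - osc th phi y| <= d%:R * `|x - y| * \int[mu]_xi `|phi xi * `|xi| |.
Proof.
move=> bp; have bpn : bcs (fun xi => phi xi * `|xi|).
  by apply: bcsM => // xi; exact: norm_continuous.
rewrite /osc -(bcs_RintegralB (bcs_osc _ _ bp) (bcs_osc _ _ bp)).
rewrite -(bcs_RintegralZ _ (bcs_norm bpn)).
apply: le_norm_Rintegral.
- exact: (bcsB (bcs_osc _ _ bp) (bcs_osc _ _ bp)).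
- exact: (bcsZ _ (bcs_norm bpn)).
move=> xi; rewrite -mulrBr normrM [in leRHS]normrM normr_id mulrCA ler_wpM2l//.
apply: le_trans (cos_lip _ _) _.
have -> : dotv x xi + th - (dotv y xi + th) = dotv (x - y) xi by rewrite dotvBl; ring.
by rewrite abs_dotv.
Qed.

Lemma osc_continuous th phi : bcs phi -> continuous (osc th phi).
Proof.
move=> bp x; set K := \int[mu]_xi `|phi xi * `|xi| |.
apply/(@cvgrPdist_le _ _ _ (nbhs (x : V))) => e e0.
have K0 : 0 <= d%:R * K by rewrite mulr_ge0// Rintegral_ge0.
near=> y.
apply: le_trans (osc_lip th x y bp) _; rewrite -/K mulrAC.
have : `|x - y| <= e / (d%:R * K + 1).
  by near: y; apply: cvgr_dist_le; [exact: cvg_id|rewrite divr_gt0// ltr_wpDl].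
rewrite ler_pdivlMr ?ltr_wpDl// => h; apply: le_trans h.
by rewrite mulrC ler_wpM2l// lerDl.
Unshelve. all: by end_near. Qed.

(** The functions [osc th f] form a class that is stable under differentiation, as
the derivative multiplies [f] by a linear function. *)
Lemma smooth_osc th phi : bcs phi -> smooth (osc th phi).
Proof.
move=> bp; pose P h := exists2 f, bcs f & exists th, h = osc th f.
have Pp : P (osc th phi) by exists phi => //; exists th.
apply: (smooth_ind (P := P)) Pp.
  by move=> _ [f bf [t ->]]; exact: osc_continuous.
move=> _ i [f bf [t ->]].
exists (osc (t + pi / 2) (fun xi => f xi * dotv 'e_i xi)).
  by exists (fun xi => f xi * dotv 'e_i xi); [exact: bcs_dotv|exists (t + pi / 2)].
by move=> x; apply: quad_derive_is_derive; exact: osc_quad_derive.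
Qed.

Lemma osc_derive th phi i x : bcs phi ->
  'D_'e_i (osc th phi) x = osc (th + pi / 2) (fun xi => phi xi * xi ord0 i) x.
Proof.
move=> bp; have := quad_derive_is_derive x (osc_quad_derive th 'e_i bp).
by move=> /(@derive_val _ _ _ _ _ _ _) ->; apply: eq_Rintegral => xi _; rewrite dotv_delta.
Qed.

(** The Fourier transform turns derivatives into multiplications by coordinates. *)
Lemma osc_coord th phi i x : smoothc phi ->
  x ord0 i * osc th phi x = osc (th + pi / 2) ('D_'e_i phi) x.
Proof.
move=> sp; have bp := smoothc_bcs sp; have bp' := smoothc_bcs (smoothc_derive i sp).
have cw : continuous (fun xi => dotv x 'e_i * wave x (th + pi / 2 + pi / 2) xi).
  move=> xi; apply: (@continuousM _ _ (cst (dotv x 'e_i)) (wave x _)); first exact: cst_continuous.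
  exact: continuous_wave.
have := integration_by_parts (@continuous_wave x (th + pi / 2)) cw bp bp'
  (smoothc_quad_derive i sp) (quad_derive_wave _ _ _).
rewrite {2}/osc => ->; rewrite -mulN1r /osc.
rewrite -(bcs_RintegralZ _ (bcs_osc _ _ bp)) -(bcs_RintegralZ _ (bcsM bp cw)).
apply: eq_Rintegral => xi _; rewrite /wave [dotv x 'e_i]dotvC dotv_delta !addrA.
by rewrite cosDpihalf sinDpihalf; ring.
Qed.

Lemma norm_le_sum_coord x : `|x| <= \sum_(i < d) `|x ord0 i|.
Proof.
apply: norm_rV_le; first exact: sumr_ge0.
by move=> i; rewrite (bigD1 i)//= lerDl sumr_ge0.
Qed.

(** Each power of [|x|] costs one derivative of [phi]. *)
Lemma osc_decay (L : nat) phi : smoothc phi ->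
  exists2 C : R, 0 < C & forall th x, (1 + `|x|) ^+ L * `|osc th phi x| <= C.
Proof.
elim: L phi => [|L IH] phi sp.
  exists (\int[mu]_xi `|phi xi| + 1).
    by rewrite ltr_wpDl// Rintegral_ge0.
  move=> th x; rewrite expr0 mul1r; apply: le_trans (osc_le _ _ (smoothc_bcs sp)) _.
  by rewrite lerDl.
have [C C0 HC] := IH _ sp.
have /choice [D HD] : forall i : 'I_d, exists D : R, forall th x,
    (1 + `|x|) ^+ L * `|osc th ('D_'e_i phi) x| <= D.
  by move=> i; have [D _ HD] := IH _ (smoothc_derive i sp); exists D.
exists (C + \sum_(i < d) `|D i|); first by rewrite ltr_wpDr// sumr_ge0.
move=> th x; rewrite exprSr -mulrA mulrDl mul1r mulrDr lerD//.
apply: (@le_trans _ _ (\sum_(i < d) (1 + `|x|) ^+ L * (`|x ord0 i| * `|osc th phi x|))).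
  by rewrite -mulr_sumr ler_wpM2l// -mulr_suml ler_wpM2r// norm_le_sum_coord.
apply: ler_sum => i _; rewrite -normrM osc_coord//.
by apply: le_trans (HD i _ _) (ler_norm _).
Qed.

End oscillatory_integral.

(** * Convolutions at two scales *)

Section division.
Variables (R : realType) (d : nat).
Local Notation V := 'rV[R]_d.
Implicit Types (f phi : V -> R) (x y xi : V).

Definition vanish_near0 (r : R) phi := forall xi, `|xi| < r -> phi xi = 0.

Lemma sqr_le_dotv x i : x ord0 i ^+ 2 <= dotv x x.
Proof.
by rewrite /dotv (bigD1 i)//= expr2 lerDl sumr_ge0// => j _; rewrite -expr2 sqr_ge0.
Qed.

Lemma dotv_eq0 x : dotv x x = 0 -> x = 0.
Proof.
move=> h; apply/rowP => i; rewrite mxE; apply/eqP; rewrite -sqrf_eq0.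
by rewrite eq_le sqr_ge0 andbT -h sqr_le_dotv.
Qed.

Lemma near_norm_lt (r : R) x : `|x| < r -> \forall y \near x, `|y| < r.
Proof.
move=> xr; have H : nbhs x [set y : V | `|y| < r] := @norm_continuous R V x _ (lt_nbhsl xr).
exact: H.
Qed.

Lemma vanish_near0_derive r i phi : vanish_near0 r phi -> vanish_near0 r ('D_'e_i phi).
Proof.
move=> pr x xr; rewrite -(derive_cst (0 : R) x 'e_i); apply: near_eq_derive.
by apply: (@filterS _ (nbhs x) _ _ _ _ (near_norm_lt xr)) => y /= My; exact: pr.
Qed.

Let q xi := dotv xi xi.

Lemma smooth_q : smooth q.
Proof.
apply: (smooth_sum (index_enum 'I_d) (F := fun i (xi : V) => xi ord0 i * xi ord0 i)) => i.
exact: (smoothM (@smooth_coord R d i) (@smooth_coord R d i)).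
Qed.

Lemma derive_q i x : 'D_'e_i q x = 2 * x ord0 i.
Proof.
have : quad_derive 'e_i q (fun x => 2 * x ord0 i).
  exists 1 => y t; rewrite /q dotvDl !(dotvC _ (y + _)) !dotvDl [dotv y 'e_i]dotvC !dotv_delta.
  rewrite mxE !eqxx/= (_ : _ - _ - _ = t ^+ 2) ?mul1r ?ger0_norm ?sqr_ge0//.
  by ring.
move=> H; exact: (@derive_val _ _ _ _ _ _ _ (quad_derive_is_derive x H)).
Qed.

(** Where the function does not vanish identically, [|xi|^2] is bounded away
from 0; the quotients by all powers of [|xi|^2] are stable under differentiation. *)
Lemma smooth_div (r : R) (n : nat) phi : 0 < r -> smooth phi -> vanish_near0 r phi ->
  smooth (fun xi => phi xi * (q xi)^-1 ^+ n).
Proof.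
move=> r0 sp pr.
pose P h := exists2 f, smooth f /\ vanish_near0 r f & exists n, h = fun xi => f xi * (q xi)^-1 ^+ n.
have Pp : P (fun xi => phi xi * (q xi)^-1 ^+ n) by exists phi; [split|exists n].
have q0 x : ~~ (`|x| < r) -> q x != 0.
  by move=> xr; apply/negP => /eqP/dotv_eq0 x0; move: xr; rewrite x0 normr0 r0.
apply: (smooth_ind (P := P)) Pp.
  move=> _ [f [sf fr] [m ->]] x.
  have [xr|/q0 qx] := boolP (`|x| < r).
    have N : \forall y \near (x : V), (cst (0 : R)) y = f y * (q y)^-1 ^+ m.
      by apply: (@filterS _ (nbhs x) _ _ _ _ (near_norm_lt xr)) => y /= My; rewrite fr// mul0r.
    apply: (cvg_trans (near_eq_cvg N)).
    by rewrite fr// mul0r; exact: (@cst_continuous V R 0 x).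
  apply: (@continuousM _ _ f (fun xi => (q xi)^-1 ^+ m)); first exact: (smooth_continuous sf).
  apply: (@continuous_comp _ _ _ (fun xi => (q xi)^-1) (fun t : R => t ^+ m)); last exact: exprn_continuous.
  apply: continuousV => //; exact: (smooth_continuous smooth_q).
move=> _ i [f [sf fr] [m ->]].
exists (fun x => ('D_'e_i f x * q x - f x * (m%:R * (2 * x ord0 i))) * (q x)^-1 ^+ m.+1).
  exists (fun x => 'D_'e_i f x * q x - f x * (m%:R * (2 * x ord0 i))); last by exists m.+1.
  split.
    apply: (smoothB (smoothM (smooth_derive i sf) smooth_q)).
    exact: (smoothM sf (smoothZ m%:R (smoothZ 2 (@smooth_coord R d i)))).
  by move=> x xr; rewrite fr// (vanish_near0_derive i fr)// !mul0r subr0.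
move=> x; have [xr|/q0 qx] := boolP (`|x| < r).
  rewrite fr// (vanish_near0_derive i fr)// !mul0r subr0 mul0r.
  have N : \forall y \near (x : V), (cst (0 : R)) y = f y * (q y)^-1 ^+ m.
    by apply: (@filterS _ (nbhs x) _ _ _ _ (near_norm_lt xr)) => y /= My; rewrite fr// mul0r.
  exact: (near_eq_is_derive N (is_derive_cst (0 : R) x 'e_i)).
have [dq _] := smooth_is_derive i x smooth_q.
have dV := DeriveDef (derivableV qx dq) (deriveV qx dq).
have dX := is_deriveX m dV.
have dM := is_deriveM (smooth_is_derive i x sf) dX.
have Em : (fun y => (q y)^-1) ^+ m = (fun y => (q y)^-1 ^+ m) by rewrite exprfctE.
have -> : (fun xi => f xi * (q xi)^-1 ^+ m) = f * (fun y => (q y)^-1) ^+ m by rewrite Em.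
apply: (is_derive_eq dM).
rewrite Em /GRing.scale/= derive_q.
case: m {dX dM Em} => [|m].
  by rewrite /= !mulr0n !expr0 expr1; field.
rewrite /= -mulr_natl; rewrite !exprS.
by move: ((q x)^-1 ^+ m) => A; rewrite expr0 !mulr1; field.
Qed.

(** Write [phi = \sum_i (phi xi_i / |xi|^2) xi_i].  Each factor [xi_i] will later
be traded for a derivative. *)
Lemma coord_decomposition (r : R) phi : 0 < r -> smoothc phi -> vanish_near0 r phi ->
  exists psi : 'I_d -> V -> R,
    [/\ forall i, smoothc (psi i), forall i, vanish_near0 r (psi i) &
        forall xi, phi xi = \sum_(i < d) psi i xi * xi ord0 i].
Proof.
move=> r0 [sp [M pM]] pr.
exists (fun i xi => phi xi * xi ord0 i * (q xi)^-1 ^+ 1); split.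
- move=> i; split.
    apply: (@smooth_div r 1 (fun xi => phi xi * xi ord0 i) r0 (smoothM sp (@smooth_coord R d i))).
    by move=> xi /pr ->; rewrite mul0r.
  by exists M => xi /pM ->; rewrite !mul0r.
- by move=> i xi /pr ->; rewrite !mul0r.
move=> xi; have [xr|xr] := boolP (`|xi| < r).
  by rewrite pr// big1// => i _; rewrite !mul0r.
have qx : q xi != 0.
  by apply/negP => /eqP/dotv_eq0 x0; move: xr; rewrite x0 normr0 r0.
rewrite (eq_bigr (fun i => phi xi / q xi * (xi ord0 i * xi ord0 i))) => [|i _].
  by rewrite -mulr_sumr -[X in _ * X]/(q xi) divfK.
by rewrite expr1; ring.
Qed.

End division.

Section convolution.
Variables (R : realType) (d : nat).
Local Notation V := 'rV[R]_d.
Local Notation mu := (lebesgue_rV R d).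
Implicit Types (f u psi : V -> R) (x y z h xi X : V) (th : R).

(** Up to constants, the blocks of dilates of [f] in rescaled variables; see
[LP_block_dilate]. *)
Definition conv f th psi (l : R) X := \int[mu]_y (f y * osc th psi (l *: (X - y))).

Lemma continuous_conv_kernel th psi l X : bcs psi ->
  continuous (fun y => osc th psi (l *: (X - y))).
Proof.
move=> bp.
have E : (fun y => osc th psi (l *: (X - y))) = osc th psi \o (fun y => (- l) *: y + l *: X).
  by apply/funext => y /=; rewrite scalerBr addrC scaleNr.
rewrite E => y; apply: continuous_comp; last exact: osc_continuous.
by apply: (@continuousD _ _ _ (fun y : V => - l *: y) (cst (l *: X))); [exact: scaler_continuous|exact: cst_continuous].
Qed.

Lemma bcs_conv f th psi l X : bcs f -> bcs psi ->
  bcs (fun y => f y * osc th psi (l *: (X - y))).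
Proof. by move=> bf bp; apply: bcsM => //; exact: continuous_conv_kernel. Qed.

Lemma conv_bound f th psi (l B : R) X : bcs f -> bcs psi ->
  (forall y, f y != 0 -> `|osc th psi (l *: (X - y))| <= B) ->
  `|conv f th psi l X| <= B * \int[mu]_y `|f y|.
Proof.
move=> bf bp HB; rewrite -(bcs_RintegralZ B (bcs_norm bf)).
apply: le_norm_Rintegral; [exact: bcs_conv|exact: (bcsZ B (bcs_norm bf))|].
move=> y; rewrite normrM mulrC.
have [->|fy] := eqVneq (f y) 0; first by rewrite normr0 !mulr0.
by rewrite ler_wpM2r// HB.
Qed.

(** Peetre inequality. *)
Lemma bracket_le x y (L : nat) : (1 + `|x|) ^+ L <= (1 + `|x - y|) ^+ L * (1 + `|y|) ^+ L.
Proof.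
rewrite -exprMn lerXn2r ?nnegrE ?mulr_ge0 ?addr_ge0//.
have := ler_normD (x - y) y; rewrite subrK.
have : 0 <= `|x - y| * `|y| by exact: mulr_ge0.
rewrite mulrDl mul1r mulrDr mulr1; move: (`|x - y| * `|y|) => a.
by move: `|x| `|y| `|x - y| => b c e; lra.
Qed.

(** The mean value theorem along the segment, with a loss of decay that is
controlled by [bracket_le]. *)
Lemma osc_diff (L : nat) psi : smoothc psi -> exists2 C : R, 0 < C &
  forall th z h, (1 + `|z|) ^+ L * `|osc th psi (z + h) - osc th psi z| <=
    C * (`|h| * (1 + `|h|) ^+ L).
Proof.
move=> sp; have bp := smoothc_bcs sp.
have /choice [D HD] : forall i : 'I_d, exists D : R, forall th x,
    (1 + `|x|) ^+ L * `|osc th (fun xi => psi xi * xi ord0 i) x| <= D.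
  move=> i; have [D _ HD] := osc_decay L (smoothcM sp (@smooth_coord R d i)).
  by exists D.
exists (\sum_(i < d) `|D i| + 1); first by rewrite ltr_wpDl// sumr_ge0.
move=> th z h.
have dg (s : R) : is_derive s 1 (fun s : R => osc th psi (z + s *: h))
    (osc (th + pi / 2) (fun xi => psi xi * dotv h xi) (z + s *: h)).
  by apply: is_derive_line; apply: quad_derive_is_derive; exact: osc_quad_derive.
have [c] := mvt_at 0 1 dg.
rewrite !subr0 scale1r scale0r addr0 mulr1 normr1 => c1 ->.
rewrite mulrC.
have E : osc (th + pi / 2) (fun xi => psi xi * dotv h xi) (z + c *: h) =
   \sum_(i < d) h ord0 i * osc (th + pi / 2) (fun xi => psi xi * xi ord0 i) (z + c *: h).
  rewrite (_ : (fun _ => _) = (fun xi => \sum_(i < d) h ord0 i * (psi xi * xi ord0 i))); last first.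
    by apply/funext => xi; rewrite /dotv mulr_sumr; apply: eq_bigr => i _; ring.
  have bi i : bcs (fun xi => psi xi * xi ord0 i).
    exact: (smoothc_bcs (smoothcM sp (@smooth_coord R d i))).
  rewrite (osc_sum _ _ _ (fun i => bcsZ (h ord0 i) (bi i))).
  by apply: eq_bigr => i _; rewrite oscZ.
apply: (@le_trans _ _ (`|osc (th + pi / 2) (fun xi => psi xi * dotv h xi) (z + c *: h)| *
   ((1 + `|z + c *: h|) ^+ L * (1 + `|h|) ^+ L))).
  rewrite ler_wpM2l//; apply: le_trans (bracket_le z (- (c *: h)) L) _.
  rewrite opprK ler_wpM2l ?exprn_ge0 ?addr_ge0//.
  rewrite lerXn2r ?nnegrE ?addr_ge0// lerD2l normrN normrZ.
  by rewrite ler_piMl.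
rewrite mulrA [leRHS]mulrA ler_wpM2r ?exprn_ge0 ?addr_ge0//.
rewrite E mulrC.
apply: (@le_trans _ _ (\sum_(i < d) `|h| * `|D i|)); last first.
  by rewrite -mulr_sumr mulrC ler_wpM2r// lerDl.
apply: (@le_trans _ _ ((1 + `|z + c *: h|) ^+ L *
  \sum_(i < d) `|h ord0 i * osc (th + pi / 2) (fun xi => psi xi * xi ord0 i) (z + c *: h)|)).
  by rewrite ler_wpM2l ?exprn_ge0 ?addr_ge0// ler_norm_sum.
rewrite mulr_sumr; apply: ler_sum => i _.
rewrite normrM mulrCA ler_pM// ?mulr_ge0 ?exprn_ge0 ?addr_ge0 ?norm_coord//.
by apply: le_trans (HD i _ _) (ler_norm _).
Qed.

(** As the integral of [f] vanishes, the kernel may be replaced by its difference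
to the value at [l *: X].  For small [l] the kernel varies slowly on the support
of [f], which gains the factor [l]. *)
Lemma conv_low (L : nat) f psi : bcs f -> \int[mu]_x f x = 0 -> smoothc psi ->
  exists2 C : R, 0 < C & forall th l X, 0 < l -> l <= 1 ->
    (1 + `|l *: X|) ^+ L * `|conv f th psi l X| <= C * l.
Proof.
move=> bf f0 sp; have bp := smoothc_bcs sp.
have [C C0 HC] := osc_diff L sp.
have [_ [M M0 fM]] := bf.
pose I := \int[mu]_y `|f y|.
have I0 : 0 <= I by apply: Rintegral_ge0.
exists (C * (M * (1 + M) ^+ L) * I + 1).
  by rewrite ltr_wpDl// !mulr_ge0 ?exprn_ge0 ?addr_ge0// ltW.
move=> th l X l0 l1.
pose u0 := osc th psi (l *: X).
pose B := C * (l * M * (1 + M) ^+ L) / (1 + `|l *: X|) ^+ L.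
have nz : 0 < (1 + `|l *: X|) ^+ L by rewrite exprn_gt0// ltr_wpDr.
have -> : conv f th psi l X = \int[mu]_y (f y * (osc th psi (l *: (X - y)) - u0)).
  under [RHS]eq_Rintegral do rewrite mulrBr [_ * u0]mulrC.
  rewrite (bcs_RintegralB (bcs_conv th l X bf bp) (bcsZ u0 bf)).
  by rewrite (bcs_RintegralZ u0 bf) f0 mulr0 subr0.
have H : `|\int[mu]_y (f y * (osc th psi (l *: (X - y)) - u0))| <= B * I.
  rewrite -(bcs_RintegralZ B (bcs_norm bf)).
  apply: le_norm_Rintegral.
  - rewrite (_ : (fun _ => _) = fun y => f y * osc th psi (l *: (X - y)) - u0 * f y).
      exact: (bcsB (bcs_conv th l X bf bp) (bcsZ u0 bf)).
    by apply/funext => y; ring.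
  - exact: (bcsZ B (bcs_norm bf)).
  move=> y; rewrite normrM mulrC.
  have [yM|yM] := leP `|y| M; last by rewrite (fM y).2// normr0 !mulr0.
  rewrite ler_wpM2r// /B ler_pdivlMr// mulrC.
  have := HC th (l *: X) (- (l *: y)).
  rewrite -scalerBr => /le_trans; apply.
  rewrite ler_wpM2l ?(ltW C0)// normrN normrZ gtr0_norm//.
  have lyM : l * `|y| <= l * M by rewrite ler_wpM2l// ltW.
  apply: ler_pM; rewrite ?exprn_ge0 ?addr_ge0 ?mulr_ge0 ?(ltW l0)//.
  rewrite lerXn2r ?nnegrE ?addr_ge0 ?mulr_ge0 ?(ltW l0) ?(ltW M0)// lerD2l.
  by apply: le_trans lyM _; rewrite ler_piMl// ltW.
apply: le_trans (ler_wpM2l (ltW nz) H) _.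
have -> : (1 + `|l *: X|) ^+ L * (B * I) = C * (M * (1 + M) ^+ L) * I * l.
  by rewrite /B; move: nz; move: ((1 + `|l *: X|) ^+ L) => N N0; field; rewrite gt_eqF.
by rewrite ler_wpM2r ?lerDl// ltW.
Qed.

(** For [l >= 1] the kernel decays at least as fast as at scale 1. *)
Lemma conv_decay (L : nat) f psi : bcs f -> smoothc psi ->
  exists2 C : R, 0 < C & forall th l X, 1 <= l ->
    (1 + `|X|) ^+ L * `|conv f th psi l X| <= C.
Proof.
move=> bf sp; have bp := smoothc_bcs sp.
have [C C0 HC] := osc_decay L sp.
have [_ [M M0 fM]] := bf.
pose I := \int[mu]_y `|f y|.
have I0 : 0 <= I by apply: Rintegral_ge0.
exists (C * (1 + M) ^+ L * I + 1).
  by rewrite ltr_wpDl// !mulr_ge0 ?exprn_ge0 ?addr_ge0// ltW.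
move=> th l X l1.
have nz : 0 < (1 + `|X|) ^+ L by rewrite exprn_gt0// ltr_wpDr.
have H : `|conv f th psi l X| <= C * (1 + M) ^+ L / (1 + `|X|) ^+ L * I.
  apply: conv_bound => // y fy.
  have yM : `|y| <= M by rewrite leNgt; apply: contra fy => /(fM y).2 ->.
  rewrite ler_pdivlMr// mulrC.
  apply: le_trans (ler_wpM2r (normr_ge0 _) (bracket_le X y L)) _.
  rewrite mulrAC; apply: ler_pM; rewrite ?mulr_ge0 ?exprn_ge0 ?addr_ge0//; last first.
    by rewrite lerXn2r ?nnegrE ?addr_ge0 ?lerD2l// ltW.
  apply: le_trans (HC th (l *: (X - y))); rewrite ler_wpM2r//.
  rewrite lerXn2r ?nnegrE ?addr_ge0// lerD2l normrZ ler_peMl//.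
  by apply: le_trans l1 (ler_norm _).
apply: le_trans (ler_wpM2l (ltW nz) H) _.
by rewrite mulrA [(1 + _) ^+ L * _]mulrC divfK ?gt_eqF// lerDl.
Qed.

(** A factor [xi_i] of the symbol is a derivative of the kernel, and partial
integration moves it to [f]. *)
Lemma conv_ibp f th psi i (l : R) X : smoothc f -> bcs psi ->
  l * conv f (th + pi / 2) (fun xi => psi xi * xi ord0 i) l X =
  conv ('D_'e_i f) th psi l X.
Proof.
move=> sf bp; have bf := smoothc_bcs sf.
have bpi : bcs (fun xi => psi xi * xi ord0 i).
  by apply: bcsM => //; exact: coord_continuous.
pose u y := osc th psi (l *: (X - y)).
pose u' y := - l * osc (th + pi / 2) (fun xi => psi xi * xi ord0 i) (l *: (X - y)).
have du : quad_derive 'e_i u u'.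
  have [K HK] := osc_quad_derive th 'e_i bp.
  exists (K * l ^+ 2) => y t; rewrite /u /u'.
  have := HK (l *: (X - y)) (- (l * t)); rewrite sqrrN exprMn mulrA.
  have -> : l *: (X - y) + - (l * t) *: 'e_i = l *: (X - (y + t *: 'e_i)).
    by rewrite opprD addrA [in RHS]scalerBr scalerA scaleNr.
  have -> : osc (th + pi / 2) (fun xi => psi xi * dotv 'e_i xi) =
            osc (th + pi / 2) (fun xi => psi xi * xi ord0 i).
    by congr osc; apply/funext => xi; rewrite dotv_delta.
  by congr (`|_ - _| <= _); ring.
have cu : continuous u by exact: continuous_conv_kernel.
have cu' : continuous u'.
  move=> y; apply: (@continuousM _ _ (cst (- l))
     (fun y => osc (th + pi / 2) (fun xi => psi xi * xi ord0 i) (l *: (X - y)))).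
    exact: cst_continuous.
  exact: continuous_conv_kernel.
rewrite /conv (integration_by_parts cu cu' bf (smoothc_bcs (smoothc_derive i sf)) (smoothc_quad_derive i sf) du).
rewrite -(bcs_RintegralZ l (bcs_conv _ l X bf bpi)) -mulN1r -(bcs_RintegralZ _ (bcsM bf cu')).
by apply: eq_Rintegral => y _; rewrite /u'; ring.
Qed.

(** As [psi] vanishes near the origin, [coord_decomposition] splits off a factor
[xi_i], and [conv_ibp] trades it for a derivative of [f] and a factor [1 / l].
The quotients still vanish near the origin, so this can be iterated. *)
Lemma conv_high (K L : nat) (r : R) f psi : 0 < r -> smoothc f -> smoothc psi ->
  vanish_near0 r psi ->
  exists2 C : R, 0 < C & forall th l X, 1 <= l ->
    (1 + `|X|) ^+ L * `|conv f th psi l X| <= C / l ^+ K.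
Proof.
move=> r0; elim: K f psi => [|K IH] f psi sf sp vp.
  have [C C0 HC] := conv_decay L (smoothc_bcs sf) sp.
  by exists C => // th l X l1; rewrite expr0 divr1; exact: HC.
have [psi_ [spi vpi E]] := coord_decomposition r0 sp vp.
have /choice [D HD] : forall i : 'I_d, exists D : R, forall th l X, 1 <= l ->
    (1 + `|X|) ^+ L * `|conv ('D_'e_i f) th (psi_ i) l X| <= D / l ^+ K.
  move=> i; have [D _ HD] := IH _ _ (smoothc_derive i sf) (spi i) (vpi i).
  by exists D.
exists (\sum_(i < d) `|D i| + 1); first by rewrite ltr_wpDl// sumr_ge0.
move=> th l X l1; have l0 : 0 < l := lt_le_trans ltr01 l1.
have bf := smoothc_bcs sf.
have bi i : bcs (fun xi => psi_ i xi * xi ord0 i).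
  exact: (smoothc_bcs (smoothcM (spi i) (@smooth_coord R d i))).
have -> : conv f th psi l X = l^-1 * \sum_(i < d) conv ('D_'e_i f) (th - pi / 2) (psi_ i) l X.
  under eq_bigr => i _.
    rewrite -(conv_ibp (th - pi / 2) i l X sf (smoothc_bcs (spi i))) subrK.
    over.
  rewrite -mulr_sumr mulrA mulVf ?gt_eqF// mul1r.
  rewrite /conv -(bcs_Rintegral_sum _ (fun i => bcs_conv th l X bf (bi i))).
  apply: eq_Rintegral => y _; rewrite -mulr_sumr -(osc_sum _ _ _ bi).
  by congr (_ * osc _ _ _); apply/funext => xi; rewrite E.
have -> : (\sum_(i < d) `|D i| + 1) / l ^+ K.+1 = l^-1 * ((\sum_(i < d) `|D i| + 1) / l ^+ K).
  by rewrite exprS invfM mulrCA.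
rewrite normrM gtr0_norm ?invr_gt0// mulrCA ler_wpM2l ?invr_ge0 ?(ltW l0)//.
apply: (@le_trans _ _ ((1 + `|X|) ^+ L *
   \sum_(i < d) `|conv ('D_'e_i f) (th - pi / 2) (psi_ i) l X|)).
  by rewrite ler_wpM2l ?exprn_ge0 ?addr_ge0// ler_norm_sum.
rewrite mulr_sumr; apply: (@le_trans _ _ (\sum_(i < d) (`|D i| / l ^+ K))).
  apply: ler_sum => i _; apply: le_trans (HD i _ _ _ l1) _.
  by rewrite ler_wpM2r ?invr_ge0 ?exprn_ge0 ?ler_norm// ltW.
by rewrite -mulr_suml ler_wpM2r ?invr_ge0 ?exprn_ge0 ?lerDl// ltW.
Qed.

End convolution.

(** * Non-vanishing of oscillatory integrals *)

Section nonvanishing.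
Variables (R : realType) (d : nat).
Local Notation V := 'rV[R]_d.
Local Notation mu := (lebesgue_rV R d).
Implicit Types (f g u phi psi : V -> R) (x y h xi X a : V) (th : R).

(** A trigonometric polynomial with maximum 1 at [a], which stays in [[0, 1]] and is
strictly smaller than 1 away from [a] in the ball of radius [S]. *)
Definition cosbump a (S : R) : V -> R := fun xi =>
  \sum_(i < d) (2 * d%:R)^-1 * (1 + cos ((xi ord0 i - a ord0 i) / S)).

Lemma cos_lt1 (t : R) : 0 < t -> t <= 1 -> cos t < 1.
Proof.
move=> t0 t1; have pi1 : 1 <= pi / 2 :> R by exact: pihalf_ge1.
rewrite -(@cos0 R) ltr_cos// in_itv/=; apply/andP; split => //; first by rewrite pi_ge0.
- exact: ltW.
- by have := pi_gt0 R; lra.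
Qed.

Lemma cos_le (t s : R) : 0 < t -> t <= `|s| -> `|s| <= 1 -> cos s <= cos t.
Proof.
move=> t0 ts s1; have pi1 : 1 <= pi / 2 :> R by exact: pihalf_ge1.
have -> : cos s = cos `|s| by case: (ger0P s) => // _; rewrite cosN.
rewrite leNgt ltr_cos ?in_itv/= -?leNgt//; apply/andP; split; lra.
Qed.

Lemma cos_ge (s : R) : `|s| <= 1 -> cos 1 <= cos s.
Proof.
move=> s1; have [->|s0] := eqVneq s 0; first by rewrite cos0 (le_trans (ler_norm _) (cos_max _)).
have -> : cos s = cos `|s| by case: (ger0P s) => // _; rewrite cosN.
by apply: cos_le; rewrite ?normr_gt0 ?normr1.
Qed.

Lemma dotv0l xi : dotv 0 xi = 0.
Proof. by rewrite /dotv big1// => i _; rewrite mxE mul0r. Qed.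

Hypothesis d0 : (0 < d)%N.

Let dR : 0 < d%:R :> R. Proof. by rewrite ltr0n. Qed.

Lemma bump_continuous a S : continuous (cosbump a S).
Proof.
have H (r : seq 'I_d) : continuous (fun xi : V =>
    \sum_(i <- r) (2 * d%:R)^-1 * (1 + cos ((xi ord0 i - a ord0 i) / S))).
  elim: r => [|i r IH].
    by under eq_fun do rewrite big_nil; move=> x; exact: cst_continuous.
  under eq_fun do rewrite big_cons.
  move=> x; apply: (@continuousD _ _ _ (fun xi : V => (2 * d%:R)^-1 * (1 + cos ((xi ord0 i - a ord0 i) / S)))
     (fun xi : V => \sum_(i <- r) (2 * d%:R)^-1 * (1 + cos ((xi ord0 i - a ord0 i) / S)))); last exact: IH.
  apply: (@continuous_comp _ _ _ (fun xi : V => xi ord0 i)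
    (fun t : R => (2 * d%:R)^-1 * (1 + cos ((t - a ord0 i) / S)))).
    exact: coord_continuous.
  apply: continuousM; first exact: cst_continuous.
  apply: continuousD; first exact: cst_continuous.
  apply: continuous_comp; last exact: continuous_cos.
  apply: continuousM; last exact: cst_continuous.
  by apply: continuousB; [exact: cvg_id|exact: cst_continuous].
exact: H.
Qed.

Lemma bump_ge0 a S xi : 0 <= cosbump a S xi.
Proof.
apply: sumr_ge0 => i _; rewrite mulr_ge0 ?invr_ge0 ?mulr_ge0//.
Qed.

Lemma bump_center a S : cosbump a S a = 1.
Proof.
rewrite /cosbump; under eq_bigr do rewrite subrr mul0r cos0.
by rewrite sumr_const card_ord -mulr_natl; field; rewrite gt_eqF.
Qed.

Lemma bump_away a S r xi : 0 < r -> 0 < S -> r <= S -> r <= `|xi - a| -> `|xi - a| <= S ->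
  cosbump a S xi <= 1 - (2 * d%:R)^-1 * (1 - cos (r / S)).
Proof.
move=> r0 S0 rS rxi xiS.
have [i ri] : exists i, r <= `|xi ord0 i - a ord0 i|.
  apply/existsP; rewrite -[X in is_true X]negbK negb_exists; apply/negP => /forallP h.
  suff : `|xi - a| < r by rewrite ltNge rxi.
  by apply: norm_rV_lt => // i; have := h i; rewrite -ltNge !mxE.
have iS : `|xi ord0 i - a ord0 i| <= S.
  by apply: le_trans xiS; have := norm_coord (xi - a) i; rewrite !mxE.
rewrite /cosbump (bigD1 i)//=.
have h1 : cos ((xi ord0 i - a ord0 i) / S) <= cos (r / S).
  apply: cos_le; first by rewrite divr_gt0.
    by rewrite normrM (gtr0_norm (x := S^-1)) ?invr_gt0// ler_pM2r ?invr_gt0.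
  by rewrite normrM (gtr0_norm (x := S^-1)) ?invr_gt0// ler_pdivrMr// mul1r.
have h2 : \sum_(j < d | j != i) (2 * d%:R)^-1 * (1 + cos ((xi ord0 j - a ord0 j) / S)) <=
   \sum_(j < d | j != i) (2 * d%:R)^-1 * (1 + 1).
  apply: ler_sum => j _; rewrite ler_wpM2l ?invr_ge0 ?mulr_ge0// lerD2l.
  by apply: le_trans (ler_norm _) (cos_max _).
have h3 : \sum_(j < d) (2 * d%:R)^-1 * (1 + 1) = 1 :> R.
  by rewrite sumr_const card_ord -mulr_natl; field; rewrite gt_eqF.
rewrite (bigD1 i)//= in h3.
have c0 : 0 < (2 * d%:R)^-1 :> R by rewrite invr_gt0 mulr_gt0.
have h4 : (2 * d%:R)^-1 * (1 + cos ((xi ord0 i - a ord0 i) / S)) <= (2 * d%:R)^-1 * (1 + cos (r / S)).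
  by rewrite ler_wpM2l ?(ltW c0)// lerD2l.
move: h2 h3 h4; set A := \sum_(_ < _ | _) _; set B := \sum_(_ < _ | _) _.
by set c := (_ * _)^-1; set e := cos (r / S); rewrite !mulrDr !mulrN !mulr1; lra.
Qed.

Lemma bump_near a S (e : R) : 0 < e -> exists2 r : R, 0 < r & forall xi, `|xi - a| < r -> 1 - e <= cosbump a S xi.
Proof.
move=> e0; have := @bump_continuous a S a.
move=> /(@cvgrPdist_le _ _ _ (nbhs (a : V))) /(_ _ e0) /nbhs_ballP[r /= r0 H].
exists r => // xi xir; have : ball a r xi by rewrite -ball_normE/= distrC.
by move=> /H/=; rewrite bump_center ler_norml => /andP[_]; lra.
Qed.

(** High powers of the bump concentrate at [a]: the part of the integral near [a]
is of order [(1 - e)^n], and the rest is of order [rho^n] with [rho < 1 - e].  The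
lower bound is uniform in [psi], which matters in [conv_neq0], where [psi] depends
on a further variable. *)
Lemma peak a (B S delta r : R) : 0 < B -> 0 < S -> 0 < delta -> 0 < r -> r <= S ->
  exists n : nat, exists2 m : R, 0 < m & forall psi, bcs psi ->
    (forall xi, `|psi xi| <= B) -> (forall xi, S < `|xi - a| -> psi xi = 0) ->
    (forall xi, `|xi - a| < r -> delta <= psi xi) ->
    m <= \int[mu]_xi (psi xi * cosbump a S xi ^+ n).
Proof.
move=> B0 S0 delta0 r0 rS.
pose rho := 1 - (2 * d%:R)^-1 * (1 - cos (r / S)).
have c1 : cos (r / S) < 1.
  by apply: cos_lt1; [rewrite divr_gt0|rewrite ler_pdivrMr// mul1r].
have rho1 : rho < 1 by rewrite /rho ltrBlDr ltrDl mulr_gt0 ?invr_gt0 ?mulr_gt0 ?subr_gt0.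
(* the bump is at least 1 - e > rho near a, and at most rho at distance at least r from a *)
pose e := (1 - rho) / 2.
have e0 : 0 < e by rewrite divr_gt0// subr_gt0.
have [r1 r10 Hr1] := bump_near a S e0.
pose r' := Num.min r r1.
have r'0 : 0 < r' by rewrite lt_min r0.
have rho0 : 0 <= rho.
  rewrite /rho subr_ge0; have : - 1 <= cos (r / S).
    by have := cos_max (r / S); rewrite ler_norml => /andP[].
  have d1 : 1 <= d%:R :> R by rewrite ler1n.
  move=> h; rewrite ler_pdivrMl ?mulr_gt0// mulr1; lra.
have e1 : 0 < 1 - e by rewrite /e; move: rho0 rho1; lra.
have t1 : rho / (1 - e) < 1.
  rewrite ltr_pdivrMr// mul1r.
  by rewrite /e; move: rho1; lra.
pose vr := (2 * r') ^+ d; pose vS := (2 * (S + 1)) ^+ d.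
have vr0 : 0 < vr by rewrite exprn_gt0// mulr_gt0.
have [n Hn] : exists n, B * vS * (rho / (1 - e)) ^+ n <= delta * vr / 2.
  have : (fun n => B * vS * (rho / (1 - e)) ^+ n) @ \oo --> B * vS * 0.
    by apply: cvgMr; apply: cvg_expr; rewrite ger0_norm ?divr_ge0 ?(ltW e1).
  rewrite mulr0 => /cvgr0Pnorm_le /(_ (delta * vr / 2)).
  move=> /(_ _)[|n _ /(_ n (leqnn _))]; first by rewrite divr_gt0// mulr_gt0.
  by move=> h; exists n; apply: le_trans (ler_norm _) h.
exists n; exists (delta * vr / 2 * (1 - e) ^+ n).
  by rewrite mulr_gt0 ?exprn_gt0 ?divr_gt0 ?mulr_gt0.
move=> psi bp pB pS pd.
pose Jr := fun y => \1_[set y : V | `|y - a| < r'] y : R.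
pose JS := fun y => \1_[set y : V | `|y - a| < S + 1] y : R.
have bJr : bcs Jr by exact: bcs_ball.
have S10 : 0 < S + 1 by rewrite addr_gt0.
have bJS : bcs JS by exact: bcs_ball.
have cw : continuous (fun xi => cosbump a S xi ^+ n).
  move=> xi; apply: (@continuous_comp _ _ _ (cosbump a S) (fun t : R => t ^+ n)).
    exact: bump_continuous.
  exact: exprn_continuous.
have H : \int[mu]_xi (delta * (1 - e) ^+ n * Jr xi - B * rho ^+ n * JS xi) <=
    \int[mu]_xi (psi xi * cosbump a S xi ^+ n).
  apply: le_Rintegral => //.
  - exact: (bcs_integrable (bcsB (bcsZ _ bJr) (bcsZ _ bJS))).
  - exact: (bcs_integrable (bcsM bp cw)).
  move=> xi _; rewrite /Jr /JS !indicE.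
  have w0 : 0 <= cosbump a S xi ^+ n by rewrite exprn_ge0// bump_ge0.
  have Br0 : 0 <= B * rho ^+ n by rewrite mulr_ge0 ?exprn_ge0 ?(ltW B0).
  have [xr|xr] := ltP `|xi - a| r.
    rewrite (@mem_set _ [set y : V | `|y - a| < S + 1])/=; last by apply: lt_le_trans xr _; rewrite (le_trans rS)// lerDl.
    rewrite mulr1.
    have [xr'|xr'] := ltP `|xi - a| r'.
      rewrite mem_set//= mulr1; apply: (@le_trans _ _ (delta * (1 - e) ^+ n)).
        by rewrite lerBlDr lerDl.
      apply: ler_pM; rewrite ?(ltW delta0) ?exprn_ge0 ?(ltW e1)//; first exact: pd.
      rewrite lerXn2r ?nnegrE ?bump_ge0 ?(ltW e1)//; apply: Hr1.
      by apply: lt_le_trans xr' _; rewrite ge_min lexx orbT.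
    rewrite memNset/=; last by apply/negP; rewrite -leNgt.
    rewrite mulr0 sub0r; apply: (@le_trans _ _ 0); first by rewrite oppr_le0.
    by rewrite mulr_ge0//; apply: le_trans (pd _ xr); exact: ltW.
  rewrite (@memNset _ [set y : V | `|y - a| < r'])/=; last first.
    by apply/negP; rewrite -leNgt; apply: le_trans xr; rewrite ge_min lexx.
  rewrite mulr0 sub0r.
  have [xS|xS] := ltP S `|xi - a|.
    rewrite pS// mul0r oppr_le0 mulr_ge0//; by case: (_ \in _).
  rewrite mem_set/= ?mulr1; last by apply: le_lt_trans xS _; rewrite ltrDl.
  have : `|psi xi * cosbump a S xi ^+ n| <= B * rho ^+ n.
    rewrite normrM (ger0_norm w0) ler_pM// lerXn2r ?nnegrE ?bump_ge0//.
    exact: bump_away.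
  by rewrite ler_norml => /andP[].
apply: le_trans H.
rewrite (bcs_RintegralB (bcsZ _ bJr) (bcsZ _ bJS)) (bcs_RintegralZ _ bJr) (bcs_RintegralZ _ bJS).
rewrite (Rintegral_ball a r'0) (Rintegral_ball a S10) -/vr -/vS.
have e1n : 0 < (1 - e) ^+ n by rewrite exprn_gt0.
have -> : B * rho ^+ n * vS = B * vS * (rho / (1 - e)) ^+ n * (1 - e) ^+ n.
  by rewrite expr_div_n; field; rewrite gt_eqF.
have := ler_wpM2r (ltW e1n) Hn; move: (_ / (1 - e)) => t; move: ((1 - e) ^+ n) (t ^+ n) => A D h.
have -> : delta * A * vr = delta * vr / 2 * A + delta * vr / 2 * A by field.
by rewrite lerBrDr lerD2l.
Qed.

(** The addition theorem: the product of a wave and the bump is a combination of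
waves. *)
Lemma wave_bump x th a S xi :
  wave x th xi * cosbump a S xi = \sum_(i < d) ((2 * d%:R)^-1 * wave x th xi +
    (4 * d%:R)^-1 * wave (x + S^-1 *: 'e_i) (th - a ord0 i / S) xi +
    (4 * d%:R)^-1 * wave (x - S^-1 *: 'e_i) (th + a ord0 i / S) xi).
Proof.
rewrite /cosbump mulr_sumr; apply: eq_bigr => i _; rewrite /wave.
have -> : dotv (x - S^-1 *: 'e_i) xi = dotv x xi - S^-1 * xi ord0 i.
  by rewrite -scaleNr dotvDl dotv_delta mulNr.
rewrite dotvDl dotv_delta.
have -> : dotv x xi + S^-1 * xi ord0 i + (th - a ord0 i / S) =
  (dotv x xi + th) + (xi ord0 i - a ord0 i) / S by ring.
have -> : dotv x xi - S^-1 * xi ord0 i + (th + a ord0 i / S) =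
  (dotv x xi + th) + - ((xi ord0 i - a ord0 i) / S) by ring.
rewrite !cosD cosN sinN; field; by rewrite gt_eqF.
Qed.

Lemma bcs_combination (c1 c2 c3 : R) f g u : bcs f -> bcs g -> bcs u ->
  bcs (fun x => c1 * f x + c2 * g x + c3 * u x) /\
  \int[mu]_x (c1 * f x + c2 * g x + c3 * u x) =
    c1 * \int[mu]_x f x + c2 * \int[mu]_x g x + c3 * \int[mu]_x u x.
Proof.
move=> bf bg bu; have b1 := bcsZ c1 bf; have b2 := bcsZ c2 bg; have b3 := bcsZ c3 bu.
split; first exact: bcsD (bcsD b1 b2) b3.
rewrite (bcs_RintegralD (bcsD b1 b2) b3) (bcs_RintegralD b1 b2).
by rewrite (bcs_RintegralZ c1 bf) (bcs_RintegralZ c2 bg) (bcs_RintegralZ c3 bu).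
Qed.

Lemma osc_bump th phi a S x : bcs phi ->
  osc th (fun xi => phi xi * cosbump a S xi) x = \sum_(i < d) ((2 * d%:R)^-1 * osc th phi x +
    (4 * d%:R)^-1 * osc (th - a ord0 i / S) phi (x + S^-1 *: 'e_i) +
    (4 * d%:R)^-1 * osc (th + a ord0 i / S) phi (x - S^-1 *: 'e_i)).
Proof.
move=> bp; have bF i := bcs_combination (2 * d%:R)^-1 (4 * d%:R)^-1 (4 * d%:R)^-1
  (bcs_osc th x bp) (bcs_osc (th - a ord0 i / S) (x + S^-1 *: 'e_i) bp)
  (bcs_osc (th + a ord0 i / S) (x - S^-1 *: 'e_i) bp).
under eq_bigr do rewrite -(bF _).2.
rewrite -(bcs_Rintegral_sum _ (fun i => (bF i).1)); apply: eq_Rintegral => xi _.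
by rewrite mulrAC -mulrA wave_bump mulr_sumr; apply: eq_bigr => i _; ring.
Qed.

Lemma conv_bump f th phi a S X : bcs f -> bcs phi ->
  conv f th (fun xi => phi xi * cosbump a S xi) 1 X = \sum_(i < d) ((2 * d%:R)^-1 * conv f th phi 1 X +
    (4 * d%:R)^-1 * conv f (th - a ord0 i / S) phi 1 (X + S^-1 *: 'e_i) +
    (4 * d%:R)^-1 * conv f (th + a ord0 i / S) phi 1 (X - S^-1 *: 'e_i)).
Proof.
move=> bf bp; have bF i := bcs_combination (2 * d%:R)^-1 (4 * d%:R)^-1 (4 * d%:R)^-1
  (bcs_conv th 1 X bf bp) (bcs_conv (th - a ord0 i / S) 1 (X + S^-1 *: 'e_i) bf bp)
  (bcs_conv (th + a ord0 i / S) 1 (X - S^-1 *: 'e_i) bf bp).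
under eq_bigr do rewrite -(bF _).2.
rewrite -(bcs_Rintegral_sum _ (fun i => (bF i).1)); apply: eq_Rintegral => y _.
rewrite osc_bump// mulr_sumr; apply: eq_bigr => i _; rewrite !scale1r.
by rewrite [X - y + _]addrAC [X - y - _]addrAC; ring.
Qed.

Lemma bcs_bump_pow phi a S n : bcs phi -> bcs (fun xi => phi xi * cosbump a S xi ^+ n).
Proof.
move=> bp; apply: bcsM => // xi.
apply: (@continuous_comp _ _ _ (cosbump a S) (fun t : R => t ^+ n)); last exact: exprn_continuous.
exact: bump_continuous.
Qed.

(** Multiplication by the bump only shifts and averages oscillatory integrals. *)
Lemma osc_bump_eq0 phi a S n : bcs phi -> (forall th x, osc th phi x = 0) ->
  forall th x, osc th (fun xi => phi xi * cosbump a S xi ^+ n) x = 0.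
Proof.
move=> bp p0; elim: n => [|n IH] th x.
  by rewrite -(p0 th x); apply: eq_Rintegral => xi _; rewrite expr0 mulr1.
transitivity (osc th (fun xi => (phi xi * cosbump a S xi ^+ n) * cosbump a S xi) x).
  by apply: eq_Rintegral => xi _; rewrite exprSr mulrA.
rewrite osc_bump; last exact: bcs_bump_pow.
by rewrite big1// => i _; rewrite !IH !mulr0 !addr0.
Qed.

Lemma conv_bump_eq0 f phi a S n : bcs f -> bcs phi -> (forall th X, conv f th phi 1 X = 0) ->
  forall th X, conv f th (fun xi => phi xi * cosbump a S xi ^+ n) 1 X = 0.
Proof.
move=> bf bp p0; elim: n => [|n IH] th X.
  rewrite -(p0 th X); apply: eq_Rintegral => y _; congr (_ * _).
  by apply: eq_Rintegral => xi _; rewrite expr0 mulr1.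
transitivity (conv f th (fun xi => (phi xi * cosbump a S xi ^+ n) * cosbump a S xi) 1 X).
  apply: eq_Rintegral => y _; congr (_ * _).
  by apply: eq_Rintegral => xi _; rewrite exprSr mulrA.
rewrite conv_bump//; last exact: bcs_bump_pow.
by rewrite big1// => i _; rewrite !IH !mulr0 !addr0.
Qed.

Lemma continuous_lower_bound phi a : continuous phi -> 0 < phi a ->
  exists2 r : R, 0 < r & forall xi, `|xi - a| < r -> phi a / 2 <= phi xi.
Proof.
move=> cp pa; have e0 : 0 < phi a / 2 by rewrite divr_gt0.
have := cp a; move=> /(@cvgrPdist_le _ _ _ (nbhs (a : V))) /(_ _ e0) /nbhs_ballP[r /= r0 H].
exists r => // xi xir; have : ball a r xi by rewrite -ball_normE/= distrC.
move=> /H/=; rewrite ler_norml => /andP[_].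
by rewrite lerBlDr -lerBlDl {1}(splitr (phi a)) addrK.
Qed.

(** Injectivity of the Fourier transform on continuous functions with compact
support.  Otherwise the integrals of [phi] against all powers of the bump centered
at [a] would vanish, contrary to [peak]. *)
Lemma osc_neq0 phi a : continuous phi -> bcs phi -> phi a != 0 ->
  exists th x, osc th phi x != 0.
Proof.
wlog pa : phi / 0 < phi a => [H cp bp pa|cp bp _].
  have [p0|p0|p0] := ltgtP (phi a) 0; last by rewrite p0 eqxx in pa.
    have [th [x px]] : exists th x, osc th (fun xi => (-1) * phi xi) x != 0.
      apply: H => /=; rewrite ?mulN1r ?oppr_gt0 ?oppr_eq0//.
        by move=> x; apply: (@continuousM _ _ (cst (-1)) phi); [exact: cst_continuous|exact: cp].
      exact: bcsZ.
    by exists th, x; move: px; rewrite oscZ// mulN1r oppr_eq0.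
  exact: H.
apply: contrapT => Hn.
have p0 th x : osc th phi x = 0.
  by apply/eqP; apply: contrapT => /negP px; apply: Hn; exists th, x.
have [_ [M M0 pM]] := bp.
have [r r0 Hr] := continuous_lower_bound cp pa.
pose S := r + M + `|a|.
have S0 : 0 < S by rewrite /S; move: (normr_ge0 a) r0 M0; lra.
have rS : r <= S by rewrite /S; move: (normr_ge0 a) r0 M0; lra.
have [n [m m0 Hm]] := peak a M0 S0 (divr_gt0 pa (ltr0n _ 2)) r0 rS.
have := Hm phi bp (fun xi => (pM xi).1) _ Hr.
have -> : \int[mu]_xi (phi xi * cosbump a S xi ^+ n) = 0.
  rewrite -(osc_bump_eq0 a S n bp p0 0 0); apply: eq_Rintegral => xi _.
  by rewrite /wave dotv0l addr0 cos0 mulr1.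
suff h : forall xi, S < `|xi - a| -> phi xi = 0.
  by move=> /(_ h) h'; move: (lt_le_trans m0 h'); rewrite ltxx.
move=> xi Sxi; apply: (pM xi).2.
have := lt_le_trans Sxi (ler_normB xi a); rewrite /S; move: r0.
by move: `|xi| `|a| => b c; lra.
Qed.

(** The same argument with the bump centered at 0.  A high power of the bump
localizes the frequencies near 0, where the waves [wave (- y) 0] are at least
[cos 1 > 0] for all [y] in the support of [f], so that no cancellation is possible. *)
Lemma conv_neq0 f phi : bcs f -> (forall y, 0 <= f y) -> 0 < \int[mu]_y f y ->
  continuous phi -> bcs phi -> 0 < phi 0 ->
  exists th X, conv f th phi 1 X != 0.
Proof.
move=> bf f0 If cp bp p0; apply: contrapT => Hn.
have c0 th X : conv f th phi 1 X = 0.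
  by apply/eqP; apply: contrapT => /negP px; apply: Hn; exists th, X.
have [_ [M M0 pM]] := bp; have [_ [N N0 fN]] := bf.
have [r1 r10 Hr1] := continuous_lower_bound cp p0.
(* for |y| <= N and |xi| <= r the phase <y, xi> is at most 1 *)
pose r := Num.min r1 (d%:R * N)^-1.
have r0 : 0 < r by rewrite lt_min r10 invr_gt0 mulr_gt0.
pose S := r + M.
have S0 : 0 < S by rewrite addr_gt0.
have rS : r <= S by rewrite lerDl ltW.
have c1 : 0 < phi 0 / 2 * cos 1 by rewrite mulr_gt0 ?divr_gt0 ?cos1_gt0.
have [n [m m0 Hm]] := peak 0 M0 S0 c1 r0 rS.
have := conv_bump_eq0 0 S n bf bp c0 0 0.
have bpn := bcs_bump_pow 0 S n bp.
suff h : m * \int[mu]_y f y <= conv f 0 (fun xi => phi xi * cosbump 0 S xi ^+ n) 1 0.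
  by move=> e; move: (lt_le_trans (mulr_gt0 m0 If) h); rewrite e ltxx.
rewrite -(bcs_RintegralZ m bf); apply: le_Rintegral => //.
- exact: (bcs_integrable (bcsZ m bf)).
- exact: (bcs_integrable (bcs_conv _ _ _ bf bpn)).
move=> y _; rewrite mulrC.
have [->|fy] := eqVneq (f y) 0; first by rewrite !mul0r.
have yN : `|y| <= N by rewrite leNgt; apply: contra fy => /(fN y).2 ->.
rewrite ler_wpM2l// scale1r sub0r.
have := Hm (fun xi => phi xi * wave (- y) 0 xi) (bcs_osc 0 (- y) bp) _ _ _.
rewrite /osc; under eq_Rintegral do rewrite mulrAC; apply.
- move=> xi; rewrite normrM; apply: le_trans (pM xi).1.
  by rewrite ler_piMr// cos_max.
- move=> xi; rewrite subr0 => xiS; rewrite (pM xi).2 ?mul0r//.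
  by apply: lt_trans xiS; rewrite ltrDr.
move=> xi xir.
have xir1 : `|xi - 0| < r1 by apply: lt_le_trans xir _; rewrite ge_min lexx.
have cy : cos 1 <= wave (- y) 0 xi.
  rewrite /wave addr0; apply: cos_ge; apply: le_trans (abs_dotv _ _) _.
  have xir2 : `|xi| <= (d%:R * N)^-1.
    by rewrite subr0 in xir; apply: le_trans (ltW xir) _; rewrite ge_min lexx orbT.
  rewrite normrN; apply: (@le_trans _ _ (d%:R * N * (d%:R * N)^-1)).
    by apply: ler_pM => //; rewrite ?mulr_ge0// ler_wpM2l.
  by rewrite divff// gt_eqF// mulr_gt0.
apply: ler_pM => //; [by rewrite divr_ge0// ltW|by rewrite ltW// cos1_gt0|exact: Hr1].
Qed.

End nonvanishing.

(** * Distributions given by functions with compact support *)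

Section complex_facts.
Variable R : realType.
Local Open Scope complex_scope.
Local Notation normc := (@Normc.normc R).

Lemma normc_ge_Re (z : R[i]) : `|complex.Re z| <= normc z.
Proof.
case: z => a b /=; rewrite -sqrtr_sqr ler_wsqrtr// lerDl sqr_ge0//.
Qed.

Lemma normc_ge_Im (z : R[i]) : `|complex.Im z| <= normc z.
Proof.
case: z => a b /=; rewrite -sqrtr_sqr ler_wsqrtr// lerDr sqr_ge0//.
Qed.

Lemma normc_le (z : R[i]) : normc z <= `|complex.Re z| + `|complex.Im z|.
Proof.
case: z => a b /=; rewrite -[leRHS]ger0_norm ?addr_ge0// -sqrtr_sqr ler_wsqrtr//.
by rewrite sqrrD !real_normK ?num_real// lerD2r lerDl mulrn_wge0// mulr_ge0.
Qed.

Lemma ReM (z w : R[i]) : complex.Re (z * w) = complex.Re z * complex.Re w - complex.Im z * complex.Im w.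
Proof. by case: z w => a b [c e]. Qed.

Lemma ImM (z w : R[i]) : complex.Im (z * w) = complex.Re z * complex.Im w + complex.Im z * complex.Re w.
Proof. by case: z w => a b [c e]. Qed.

Lemma ReD (z w : R[i]) : complex.Re (z + w) = complex.Re z + complex.Re w.
Proof. by case: z w => a b [c e]. Qed.

Lemma ReN (z : R[i]) : complex.Re (- z) = - complex.Re z.
Proof. by case: z. Qed.

Lemma ImN (z : R[i]) : complex.Im (- z) = - complex.Im z.
Proof. by case: z. Qed.

Lemma ImD (z w : R[i]) : complex.Im (z + w) = complex.Im z + complex.Im w.
Proof. by case: z w => a b [c e]. Qed.

Lemma complex_eq (z w : R[i]) : complex.Re z = complex.Re w -> complex.Im z = complex.Im w -> z = w.
Proof. by case: z w => a b [c e] /= -> ->. Qed.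

End complex_facts.

Section rapidly_decreasing.
Variables (R : realType) (d : nat).
Local Notation V := 'rV[R]_d.
Local Notation normc := (@Normc.normc R).
Implicit Types (f g h phi psi : V -> R) (x y xi a : V) (th : R).

(** Real Schwartz functions, with the decay of each derivative stated separately;
[rapid_uniform] recovers the seminorms. *)
Definition rapid h := smooth h /\ forall (L : nat) s, exists C : R, forall y,
  (1 + `|y|) ^+ L * `|pderive s h y| <= C.

Lemma rapid_derive i h : rapid h -> rapid ('D_'e_i h).
Proof.
move=> [sh rh]; split; first exact: smooth_derive.
by move=> L s; rewrite -pderive_rcons; exact: rh.
Qed.

Lemma pderiveD s f g : smooth f -> smooth g ->
  pderive s (fun x => f x + g x) = fun x => pderive s f x + pderive s g x.
Proof.
elim/last_ind: s f g => // s i IH f g sf sg.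
rewrite !pderive_rcons -(IH _ _ (smooth_derive i sf) (smooth_derive i sg)).
congr pderive; apply/funext => x.
exact: (@derive_val _ _ _ _ _ _ _ (is_deriveD (smooth_is_derive i x sf) (smooth_is_derive i x sg))).
Qed.

Lemma derive_scale i (c : R) f : smooth f ->
  'D_'e_i (fun x => c * f x) = fun x => c * 'D_'e_i f x.
Proof.
move=> sf; apply/funext => x.
exact: (@derive_val _ _ _ _ _ _ _ (is_deriveZ c (smooth_is_derive i x sf))).
Qed.

Lemma pderiveZ s (c : R) f : smooth f ->
  pderive s (fun x => c * f x) = fun x => c * pderive s f x.
Proof.
elim/last_ind: s f => // s i IH f sf.
by rewrite !pderive_rcons -(IH _ (smooth_derive i sf)) derive_scale.
Qed.

Lemma derive_affine i f (l : R) b : smooth f ->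
  'D_'e_i (fun x => f (l *: x + b)) = fun x => l * ('D_'e_i f) (l *: x + b).
Proof.
move=> sf; apply/funext => x.
exact: (@derive_val _ _ _ _ _ _ _ (is_derive_affine (smooth_is_derive i (l *: x + b) sf))).
Qed.

Lemma pderive_affine s f (l : R) b : smooth f ->
  pderive s (fun x => f (l *: x + b)) = fun x => l ^+ size s * pderive s f (l *: x + b).
Proof.
elim/last_ind: s f => [|s i IH] f sf; first by apply/funext => x; rewrite expr0 mul1r.
rewrite !pderive_rcons derive_affine// pderiveZ; last exact: (smooth_affine l b (smooth_derive i sf)).
by rewrite (IH _ (smooth_derive i sf)) size_rcons; apply/funext => x; rewrite mulrA -exprS.
Qed.

Lemma rapid_uniform (L m : nat) h : rapid h -> exists2 C : R, 0 < C &
  forall s y, (size s <= m)%N -> (1 + `|y|) ^+ L * `|pderive s h y| <= C.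
Proof.
elim: m h => [|m IH] h rh.
  have [C HC] := rh.2 L [::]; exists (`|C| + 1); first by rewrite ltr_wpDl.
  by move=> [|//] y _; apply: le_trans (HC y) _; rewrite (le_trans (ler_norm C))// lerDl.
have [C HC] := rh.2 L [::].
have /choice [D HD] : forall i : 'I_d, exists D : R, forall s y, (size s <= m)%N ->
    (1 + `|y|) ^+ L * `|pderive s ('D_'e_i h) y| <= D.
  by move=> i; have [D _ HD] := IH _ (rapid_derive i rh); exists D.
exists (`|C| + 1 + \sum_(i < d) `|D i|); first by rewrite ltr_wpDr ?sumr_ge0// ltr_wpDl.
move=> s y; case/lastP: s => [_|s i].
  apply: le_trans (HC y) _; rewrite (le_trans (ler_norm C))//.
  by rewrite -addrA lerDl addr_ge0// sumr_ge0.
rewrite size_rcons ltnS => sm; rewrite pderive_rcons; apply: le_trans (HD i _ _ sm) _.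
apply: le_trans (ler_norm _) _; rewrite (bigD1 i)//= addrCA lerDl.
by rewrite !addr_ge0// sumr_ge0.
Qed.

Lemma smoothc_pderive s phi : smoothc phi -> smoothc (pderive s phi).
Proof.
by elim: s => //= i s IH sp; exact: smoothc_derive (IH sp).
Qed.

Lemma smoothc_rapid phi : smoothc phi -> rapid phi.
Proof.
move=> sp; split; first exact: sp.1.
move=> L s; have [_ [M M0 HM]] := smoothc_bcs (smoothc_pderive s sp).
exists ((1 + M) ^+ L * M) => y; have [yM|yM] := leP `|y| M.
  apply: ler_pM; rewrite ?exprn_ge0 ?addr_ge0//; last exact: (HM y).1.
  by rewrite lerXn2r ?nnegrE ?addr_ge0 ?(ltW M0)// lerD2l.
by rewrite (HM y).2// normr0 mulr0 mulr_ge0 ?exprn_ge0 ?addr_ge0 ?(ltW M0).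
Qed.

Lemma rapidZ (c : R) h : rapid h -> rapid (fun y => c * h y).
Proof.
move=> [sh rh]; split; first exact: smoothZ.
move=> L s; have [C HC] := rh L s; exists (`|c| * C) => y.
by rewrite pderiveZ// normrM mulrCA ler_wpM2l.
Qed.

Lemma rapidD g h : rapid g -> rapid h -> rapid (fun y => g y + h y).
Proof.
move=> [sg rg] [sh rh]; split; first exact: smoothD.
move=> L s; have [C HC] := rg L s; have [D HD] := rh L s; exists (C + D) => y.
rewrite pderiveD//; apply: le_trans (lerD (HC y) (HD y)).
by rewrite -mulrDr ler_wpM2l ?exprn_ge0 ?addr_ge0// ler_normD.
Qed.

(** Each derivative multiplies the density by a coordinate, which keeps it smooth
with compact support. *)
Lemma pderive_osc th phi s : smoothc phi ->
  exists th' psi, smoothc psi /\ pderive s (osc th phi) = osc th' psi.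
Proof.
elim/last_ind: s th phi => [|s i IH] th phi sp; first by exists th, phi.
rewrite pderive_rcons.
have -> : 'D_'e_i (osc th phi) = osc (th + pi / 2) (fun xi => phi xi * xi ord0 i).
  by apply/funext => x; exact: osc_derive (smoothc_bcs sp).
exact: IH (smoothcM sp (@smooth_coord R d i)).
Qed.

Lemma rapid_osc th phi : smoothc phi -> rapid (osc th phi).
Proof.
move=> sp; split; first exact: smooth_osc (smoothc_bcs sp).
move=> L s; have [th' [psi [spsi ->]]] := pderive_osc th s sp.
by have [C _ HC] := osc_decay L spsi; exists C => y.
Qed.

Lemma rapid_reflect h x : rapid h -> rapid (fun y => h (x - y)).
Proof.
move=> [sh rh].
have E : (fun y => h (x - y)) = (fun y => h (-1 *: y + x)).
  by apply/funext => y; rewrite scaleN1r addrC.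
rewrite E; split; first exact: (smooth_affine (-1) x sh).
move=> L s; have [C HC] := rh L s.
exists (C * (1 + `|x|) ^+ L) => y; rewrite pderive_affine// normrM normrX normrN1 expr1n mul1r.
apply: le_trans (ler_wpM2r (normr_ge0 _) (bracket_le y x L)) _.
rewrite mulrAC ler_wpM2r ?exprn_ge0 ?addr_ge0//.
by rewrite -normrN opprB scaleN1r [- y + x]addrC.
Qed.

(** Functions which tend to 0 at the rate [1 / r], locally uniformly with all
derivatives, and grow at most linearly.  The example is [chi (y / r) - 1] for a
cutoff [chi], see [vanishing_cutoff]. *)
Definition vanishing (a : R -> V -> R) := (forall r, smooth (a r)) /\
  forall s, exists2 C : R, 0 <= C & forall r y, 1 <= r -> `|pderive s (a r) y| <= C * (1 + `|y|) / r.

Lemma vanishing_derive i (a : R -> V -> R) : vanishing a -> vanishing (fun r => 'D_'e_i (a r)).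
Proof.
move=> [sa va]; split; first by move=> r; exact: smooth_derive.
move=> s; have [C C0 HC] := va (rcons s i); exists C => // r y r1.
by rewrite -pderive_rcons; exact: HC.
Qed.

(** The additional decay of [h] compensates the linear growth of [a r]. *)
Lemma vanishing_mul (L m : nat) (a : R -> V -> R) h : vanishing a -> rapid h ->
  exists2 C : R, 0 <= C & forall r s y, 1 <= r -> (size s <= m)%N ->
    (1 + `|y|) ^+ L * `|pderive s (fun y => a r y * h y) y| <= C / r.
Proof.
have base (b : R -> V -> R) (g : V -> R) : vanishing b -> rapid g ->
    exists2 C : R, 0 <= C & forall r y, 1 <= r ->
    (1 + `|y|) ^+ L * `|b r y * g y| <= C / r.
  move=> [sb vb] [sg rg]; have [C C0 HC] := vb [::]; have [D HD] := rg L.+1 [::].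
  have D0 : 0 <= D.
    by apply: le_trans (HD 0); rewrite mulr_ge0// exprn_ge0// addr_ge0.
  exists (C * D); first exact: mulr_ge0.
  move=> r y r1; have r0 : 0 < r := lt_le_trans ltr01 r1.
  rewrite normrM mulrCA; apply: le_trans (ler_wpM2r _ (HC r y r1)) _.
    by rewrite mulr_ge0// exprn_ge0// addr_ge0.
  have -> : C * (1 + `|y|) / r * ((1 + `|y|) ^+ L * `|g y|) =
            C * ((1 + `|y|) ^+ L.+1 * `|g y|) / r by rewrite exprS; ring.
  by rewrite ler_wpM2r ?invr_ge0 ?(ltW r0)// ler_wpM2l//; exact: HD.
elim: m a h => [|m IH] a h va rh.
  have [C C0 HC] := base a h va rh.
  by exists C => // r [|//] y r1 _; exact: HC.
have [C C0 HC] := base a h va rh.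
have /choice [D HD] : forall i : 'I_d, exists D : R, 0 <= D /\ forall r s y, 1 <= r -> (size s <= m)%N ->
    (1 + `|y|) ^+ L * `|pderive s (fun y => 'D_'e_i (a r) y * h y) y| <= D / r.
  by move=> i; have [D D0 HD] := IH _ _ (vanishing_derive i va) rh; exists D.
have /choice [E HE] : forall i : 'I_d, exists D : R, 0 <= D /\ forall r s y, 1 <= r -> (size s <= m)%N ->
    (1 + `|y|) ^+ L * `|pderive s (fun y => a r y * 'D_'e_i h y) y| <= D / r.
  by move=> i; have [D' D0 HD'] := IH _ _ va (rapid_derive i rh); exists D'.
exists (C + \sum_(i < d) (D i + E i)).
  by rewrite addr_ge0// sumr_ge0// => i _; rewrite addr_ge0//; [case: (HD i)|case: (HE i)].
move=> r s y r1; have r0 : 0 < r := lt_le_trans ltr01 r1.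
have S0 i : 0 <= D i + E i by rewrite addr_ge0//; [case: (HD i)|case: (HE i)].
case/lastP: s => [_|s i].
  apply: le_trans (HC r y r1) _; rewrite ler_wpM2r ?invr_ge0 ?(ltW r0)// lerDl.
  by rewrite sumr_ge0.
rewrite size_rcons ltnS => sm; rewrite pderive_rcons.
have sa := va.1 r; have [sh _] := rh.
have -> : 'D_'e_i (fun y => a r y * h y) = (fun y => 'D_'e_i (a r) y * h y + a r y * 'D_'e_i h y).
  apply/funext => x.
  rewrite (@derive_val _ _ _ _ _ _ _ (is_deriveM (smooth_is_derive i x sa) (smooth_is_derive i x sh))).
  by rewrite /GRing.scale/=; ring.
rewrite pderiveD; [|exact: (smoothM (smooth_derive i sa) sh)|exact: (smoothM sa (smooth_derive i sh))].
apply: (@le_trans _ _ (D i / r + E i / r)).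
  apply: (@le_trans _ _ ((1 + `|y|) ^+ L * `|pderive s (fun y => 'D_'e_i (a r) y * h y) y| +
     (1 + `|y|) ^+ L * `|pderive s (fun y => a r y * 'D_'e_i h y) y|)).
    by rewrite -mulrDr ler_wpM2l ?exprn_ge0 ?addr_ge0// ler_normD.
  by apply: lerD; [apply: (HD i).2|apply: (HE i).2].
rewrite -mulrDl ler_wpM2r ?invr_ge0 ?(ltW r0)//.
by rewrite (bigD1 i)//= addrCA lerDl addr_ge0// sumr_ge0.
Qed.

End rapidly_decreasing.

Section distributions.
Variables (R : realType) (d : nat).
Local Open Scope complex_scope.
Local Notation V := 'rV[R]_d.
Local Notation mu := (lebesgue_rV R d).
Local Notation normc := (@Normc.normc R).
Implicit Types (G h : V -> R) (x y : V) (phi psi : V -> R[i]).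

Lemma norm_le_euclid x : `|x| <= euclid_norm x.
Proof.
apply: norm_rV_le; first exact: sqrtr_ge0.
by move=> i; rewrite -sqrtr_sqr ler_wsqrtr// sqr_le_dotv.
Qed.

Lemma euclid_le_norm x : euclid_norm x <= d%:R * `|x|.
Proof.
rewrite /euclid_norm -[leRHS]ger0_norm ?mulr_ge0// -sqrtr_sqr ler_wsqrtr//.
apply: le_trans (ler_norm _) (le_trans (abs_dotv x x) _).
rewrite expr2 mulrACA -mulrA ler_wpM2r ?mulr_ge0//.
by case: (d) => [|n]; rewrite ?mulr0// ler_peMr// ler1n.
Qed.

Lemma LP_generator_smoothc (phi0 : V -> R) : LP_generator phi0 -> smoothc phi0.
Proof.
move=> [sp _ p0]; split => //; exists 2 => x x2; apply: p0.
exact: lt_le_trans x2 (norm_le_euclid x).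
Qed.

Definition Re_ phi : V -> R := fun x => complex.Re (phi x).
Definition Im_ phi : V -> R := fun x => complex.Im (phi x).

Definition crapid phi := rapid (Re_ phi) /\ rapid (Im_ phi).

Lemma seminorm_le (m : nat) phi (C : R) :
  (forall s y, (size s <= m)%N -> (1 + `|y|) ^+ m * `|pderive s (Re_ phi) y| <= C) ->
  (forall s y, (size s <= m)%N -> (1 + `|y|) ^+ m * `|pderive s (Im_ phi) y| <= C) ->
  (schwartz_seminorm m phi <= (C + C)%:E)%E.
Proof.
move=> H1 H2; apply: ge_ereal_sup => _ [[s y] sm <-]; rewrite lee_fin.
have b0 : 0 <= (1 + `|y|) ^+ m by rewrite exprn_ge0// addr_ge0.
apply: (le_trans (ler_wpM2l b0 (normc_le (cpderive s phi y)))).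
by rewrite mulrDr lerD//; [exact: H1|exact: H2].
Qed.

Lemma le_seminorm (m : nat) phi x : ((normc (phi x))%:E <= schwartz_seminorm m phi)%E.
Proof.
have h : ((normc (phi x))%:E <= ((1 + `|x|) ^+ m * normc (phi x))%:E)%E.
  rewrite lee_fin ler_peMl//; first by case: (phi x) => a b; exact: sqrtr_ge0.
  by rewrite exprn_ege1// lerDl.
apply: (le_trans h); apply: ereal_sup_ubound; exists ([::], x) => //=.
by rewrite /cpderive/=; case: (phi x).
Qed.

Lemma seminorm_ge0 (m : nat) phi : (0 <= schwartz_seminorm m phi)%E.
Proof.
apply: le_trans (le_seminorm m phi 0); rewrite lee_fin.
by case: (phi 0) => a b; exact: sqrtr_ge0.
Qed.

Lemma crapid_schwartz phi : crapid phi -> schwartz phi.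
Proof.
move=> [r1 r2]; split; first by split; [exact: r1.1|exact: r2.1].
move=> m; have [C C0 HC] := rapid_uniform m m r1; have [D D0 HD] := rapid_uniform m m r2.
apply: le_lt_trans (seminorm_le (C := C + D) _ _) (ltry _).
  by move=> s y sm; apply: le_trans (HC s y sm) _; rewrite lerDl ltW.
by move=> s y sm; apply: le_trans (HD s y sm) _; rewrite lerDr ltW.
Qed.

(** The function vanishes unless [|y|] is at least of order [r], where
[1 <= C |y| / r]; each derivative brings a factor [1 / r]. *)
Lemma vanishing_cutoff (phi0 : V -> R) : LP_generator phi0 ->
  vanishing (fun r y => phi0 (r^-1 *: y) - 1).
Proof.
move=> gp; have sp := LP_generator_smoothc gp; have [sp0 p1 _] := gp.
have sa r : smooth (fun y => phi0 (r^-1 *: y)).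
  have := smooth_affine r^-1 0 sp0.
  by under eq_fun do rewrite addr0.
split; first by move=> r; exact: (smoothB (sa r) (smooth_cst 1)).
have E r : (fun y => phi0 (r^-1 *: y) - 1) = (fun y => phi0 (r^-1 *: y + 0) + -1).
  by apply/funext => y; rewrite addr0.
move=> s; have [_ [M M0 HM]] := smoothc_bcs (smoothc_pderive s sp).
case: s HM => [|i s] HM.
  exists ((M + 1) * d%:R); first by rewrite mulr_ge0// addr_ge0// ltW.
  move=> r y r1; have r0 : 0 < r := lt_le_trans ltr01 r1.
  rewrite /= ler_pdivlMr//.
  have [yr|yr] := leP (euclid_norm (r^-1 *: y)) 1.
    by rewrite p1// subrr normr0 mul0r !mulr_ge0// ?addr_ge0// ltW.
  have : r <= d%:R * (1 + `|y|).
    have := lt_le_trans yr (euclid_le_norm _).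
    rewrite normrZ gtr0_norm ?invr_gt0// mulrCA -ltr_pdivrMl ?invr_gt0// invrK mulr1.
    by move=> /ltW/le_trans; apply; rewrite ler_wpM2l// lerDr.
  move=> h; rewrite -mulrA; apply: ler_pM => //; first exact: ltW.
  apply: le_trans (ler_normB _ _) _; rewrite normr1 lerD2r; exact: (HM _).1.
exists M; first exact: ltW.
move=> r y r1; have r0 : 0 < r := lt_le_trans ltr01 r1.
rewrite E pderiveD; [|exact: (smooth_affine r^-1 0 sp0)|exact: (smooth_cst (-1))].
have -> : pderive (i :: s) (fun _ : V => -1) y = 0 :> R.
  suff -> : pderive (i :: s) (fun _ : V => -1) = cst (0 : R) by [].
  elim: s i {HM} => [|j s IH] i; first by apply/funext => x; exact: derive_cst.
  have -> : pderive [:: i, j & s] (fun _ : V => -1) = 'D_'e_i (pderive (j :: s) (fun _ : V => -1 : R)) by [].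
  by rewrite IH; apply/funext => x; exact: derive_cst.
rewrite addr0 pderive_affine// normrM mulrC ler_pdivlMr// -mulrA.
apply: ler_pM => //; [by rewrite mulr_ge0// ltW|exact: (HM _).1|].
rewrite /= exprS normrM mulrC mulrA ger0_norm ?invr_ge0 ?(ltW r0)// divff ?gt_eqF// mul1r.
rewrite normrX ger0_norm ?invr_ge0 ?(ltW r0)//.
apply: (@le_trans _ _ 1); last by rewrite lerDl.
by rewrite exprn_ile1 ?invr_ge0 ?(ltW r0)// invf_le1.
Qed.

Lemma Re_M_real (a : V -> R) phi : Re_ (fun y => (a y)%:C * phi y) = fun y => a y * Re_ phi y.
Proof. by apply/funext => y; rewrite /Re_ ReM/= mul0r subr0. Qed.

Lemma Im_M_real (a : V -> R) phi : Im_ (fun y => (a y)%:C * phi y) = fun y => a y * Im_ phi y.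
Proof. by apply/funext => y; rewrite /Im_ ImM/= mul0r addr0. Qed.

(** The distribution [T] is known on test functions only.  The products
[chi (y / r) phi] with a cutoff are test functions that converge to [phi] in the
Schwartz space by [vanishing_mul], and for large [r] they agree with [phi] on the
support of [G]. *)
Lemma distribution_of_rapid (phi0 : V -> R) G T phi : LP_generator phi0 -> bcs G ->
  distribution_of (fun y => (G y)%:C) T -> crapid phi ->
  T phi = cintegral (fun y => (G y)%:C * phi y).
Proof.
move=> gp bG [[Tlin [C0 [m TC]]] Ttest] rphi.
have sp := LP_generator_smoothc gp; have [sp0 p1 _] := gp.
have [_ [M M0 GM]] := bG.
pose chi (r : R) y := phi0 (r^-1 *: y).
have schi r : 0 < r -> smoothc (chi r).
  move=> r0; have := smoothc_affine (l := r^-1) 0 _ sp.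
  by rewrite /chi; under eq_fun do rewrite addr0; apply; rewrite invr_gt0.
have [r1 r2] := rphi.
have va := vanishing_cutoff gp.
have [A A0 HA] := vanishing_mul m m va r1; have [B B0 HB] := vanishing_mul m m va r2.
pose I := cintegral (fun y => (G y)%:C * phi y).
pose D := `|C0| * (A + B + (A + B)).
have key r : 1 <= r -> d%:R * M <= r -> normc (T phi - I) <= D / r.
  move=> r1' rM; have r0 : 0 < r := lt_le_trans ltr01 r1'.
  pose cphi := fun y => (chi r y)%:C * phi y.
  have s1 : smoothc (Re_ cphi).
    by rewrite Re_M_real; exact: (smoothcM (schi r r0) r1.1).
  have s2 : smoothc (Im_ cphi).
    by rewrite Im_M_real; exact: (smoothcM (schi r r0) r2.1).
  have ccphi : crapid cphi by split; exact: smoothc_rapid.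
  have tcphi : test_function cphi.
    split; first by split; [exact: s1.1|exact: s2.1].
    have [N HN] := (schi r r0).2; exists N => y /HN; rewrite /cphi => ->.
    by rewrite mul0r.
  have TI : T cphi = I.
    rewrite Ttest//; congr cintegral; apply/funext => y; rewrite /cphi.
    have [yM|yM] := leP `|y| M; last by rewrite (GM y).2//= !mul0r.
    rewrite /chi p1 ?mul1r//; apply: le_trans (euclid_le_norm _) _.
    rewrite normrZ gtr0_norm ?invr_gt0// mulrCA mulrC ler_pdivrMr// mul1r.
    by apply: le_trans rM; rewrite ler_wpM2l.
  have E : T (fun y => (-1) * cphi y + phi y) = T phi - I.
    rewrite (Tlin (-1) cphi phi (crapid_schwartz ccphi) (crapid_schwartz rphi)).
    by rewrite TI mulN1r addrC.
  have ER : Re_ (fun y => (-1) * cphi y + phi y) = fun y => - 1 * ((phi0 (r^-1 *: y) - 1) * Re_ phi y).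
    by apply/funext => y; rewrite /Re_ /cphi mulN1r ReD ReN ReM/= /chi; ring.
  have EI : Im_ (fun y => (-1) * cphi y + phi y) = fun y => - 1 * ((phi0 (r^-1 *: y) - 1) * Im_ phi y).
    by apply/funext => y; rewrite /Im_ /cphi mulN1r ImD ImN ImM/= /chi; ring.
  have sv := va.1 r.
  have sm : (schwartz_seminorm m (fun y => (-1) * cphi y + phi y)%R <= ((A + B) / r + (A + B) / r)%:E)%E.
    apply: seminorm_le => s y sm.
      rewrite ER pderiveZ; last exact: (smoothM sv r1.1).
      rewrite normrM normrN1 mul1r; apply: le_trans (HA r s y r1' sm) _.
      by rewrite ler_wpM2r ?invr_ge0 ?(ltW r0)// lerDl.
    rewrite EI pderiveZ; last exact: (smoothM sv r2.1).
    rewrite normrM normrN1 mul1r; apply: le_trans (HB r s y r1' sm) _.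
    by rewrite ler_wpM2r ?invr_ge0 ?(ltW r0)// lerDr.
  have sch : schwartz (fun y => (-1) * cphi y + phi y).
    apply: crapid_schwartz; split.
      rewrite (_ : Re_ _ = fun y => -1 * Re_ cphi y + Re_ phi y); first exact: (rapidD (rapidZ _ ccphi.1) r1).
      by apply/funext => y; rewrite /Re_ mulN1r ReD ReN mulN1r.
    rewrite (_ : Im_ _ = fun y => -1 * Im_ cphi y + Im_ phi y); first exact: (rapidD (rapidZ _ ccphi.2) r2).
    by apply/funext => y; rewrite /Im_ mulN1r ImD ImN mulN1r.
  rewrite -E -lee_fin; apply: le_trans (TC _ sch) _.
  apply: (@le_trans _ _ (`|C0|%:E * schwartz_seminorm m (fun y => (-1) * cphi y + phi y)%R)%E).
    apply: lee_wpmul2r; last by rewrite lee_fin ler_norm.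
    exact: seminorm_ge0.
  apply: (le_trans (lee_wpmul2l _ sm)); first by rewrite lee_fin.
  by rewrite -EFinM lee_fin /D -mulrDl mulrA.
apply/eqP; rewrite -subr_eq0; apply/eqP; apply: Normc.eq0_normc.
set z := normc _; have z0 : 0 <= z by rewrite /z; case: (T phi - I) => a b; exact: sqrtr_ge0.
apply/eqP; rewrite eq_le z0 andbT leNgt; apply/negP => zp.
have D0 : 0 <= D by rewrite /D mulr_ge0// !addr_ge0.
(* large enough to have D / r < z, against [key] *)
pose r := 1 + d%:R * M + D / z.
have dM : 0 <= d%:R * M by rewrite mulr_ge0// ltW.
have Dz : 0 <= D / z by rewrite divr_ge0.
have r1' : 1 <= r by rewrite /r; lra.
have := key r r1' _; rewrite -/z => /(_ _)h.
have : z <= D / r by apply: h; rewrite /r; lra.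
rewrite ler_pdivlMr ?(lt_le_trans ltr01 r1')// /r mulrDr [z * (D / z)]mulrC divfK ?gt_eqF//.
have : 0 < z * (1 + d%:R * M) by rewrite mulr_gt0// ltr_wpDr.
by move: (z * _) => e; lra.
Qed.

Lemma exists_distribution G : bcs G -> exists T, distribution_of (fun y => (G y)%:C) T.
Proof.
move=> bG; exists (fun phi => cintegral (fun y => (G y)%:C * phi y)); split => //.
have ER phi : (fun y => complex.Re ((G y)%:C * phi y)) = (fun y => G y * Re_ phi y) := Re_M_real G phi.
have EI phi : (fun y => complex.Im ((G y)%:C * phi y)) = (fun y => G y * Im_ phi y) := Im_M_real G phi.
have bR phi : schwartz phi -> bcs (fun y => G y * Re_ phi y).
  by move=> [[s1 _] _]; apply: bcsM => //; exact: (smooth_continuous s1).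
have bI phi : schwartz phi -> bcs (fun y => G y * Im_ phi y).
  by move=> [[_ s2] _]; apply: bcsM => //; exact: (smooth_continuous s2).
split.
  move=> a phi psi sphi spsi; rewrite /cintegral !ER !EI.
  have [b1 b2 b3 b4] := And4 (bR _ sphi) (bR _ spsi) (bI _ sphi) (bI _ spsi).
  apply: complex_eq.
    rewrite ReD ReM/= -(bcs_RintegralZ (complex.Re a) b1) -(bcs_RintegralZ (complex.Im a) b3).
    rewrite -(bcs_RintegralB (bcsZ (complex.Re a) b1) (bcsZ (complex.Im a) b3)).
    rewrite -(bcs_RintegralD (bcsB (bcsZ (complex.Re a) b1) (bcsZ (complex.Im a) b3)) b2).
    by apply: eq_Rintegral => y _; rewrite /Re_ /Im_ ReD ReM; ring.
  rewrite ImD ImM/= -(bcs_RintegralZ (complex.Re a) b3) -(bcs_RintegralZ (complex.Im a) b1).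
  rewrite -(bcs_RintegralD (bcsZ (complex.Re a) b3) (bcsZ (complex.Im a) b1)).
  rewrite -(bcs_RintegralD (bcsD (bcsZ (complex.Re a) b3) (bcsZ (complex.Im a) b1)) b4).
  by apply: eq_Rintegral => y _; rewrite /Re_ /Im_ ImD ImM; ring.
pose I := \int[mu]_y `|G y|.
exists (I + I), 0%N => phi sphi.
have sfin : (schwartz_seminorm 0 phi < +oo)%E by exact: sphi.2.
have := seminorm_ge0 0 phi; have := le_seminorm 0 phi; move: sfin.
case: (schwartz_seminorm 0 phi) => // S _ HS S0; rewrite -EFinM lee_fin.
have H (h : V -> R) : bcs (fun y => G y * h y) -> (forall y, `|h y| <= S) -> `|\int[mu]_y (G y * h y)| <= I * S.
  move=> bh hS; rewrite mulrC -(bcs_RintegralZ S (bcs_norm bG)).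
  apply: le_norm_Rintegral (bcsZ S (bcs_norm bG)) _ => //.
  by move=> y; rewrite normrM mulrC ler_wpM2r.
apply: le_trans (normc_le _) _; rewrite /cintegral/= ER EI mulrDl lerD//.
  apply: H; first exact: bR.
  by move=> y; apply: le_trans (normc_ge_Re (phi y)) _; rewrite -lee_fin.
apply: H; first exact: bI.
by move=> y; apply: le_trans (normc_ge_Im (phi y)) _; rewrite -lee_fin.
Qed.

End distributions.

(** * Littlewood-Paley blocks of dilated functions *)

Section littlewood_paley_blocks.
Variables (R : realType) (d : nat).
Local Open Scope complex_scope.
Local Notation V := 'rV[R]_d.
Local Notation mu := (lebesgue_rV R d).
Local Notation normc := (@Normc.normc R).
Implicit Types (f h : V -> R) (x y X : V) (k n : nat).

(** The symbols of all blocks [k >= 1] are dilates of a single function, see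
[LP_symbolE]. *)
Definition base_symbol (phi0 : V -> R) k : V -> R := fun xi =>
  if k is 0 then phi0 xi else phi0 xi - phi0 (2 *: xi).

Lemma LP_symbolE (phi0 : V -> R) k xi :
  LP_symbol phi0 k xi = base_symbol phi0 k ((2 ^+ k)^-1 *: xi).
Proof.
case: k => [|k] /=; first by rewrite expr0 invr1 scale1r.
by rewrite scalerA exprS invfM mulrA divff ?mul1r.
Qed.

Lemma smoothc_base_symbol (phi0 : V -> R) k : LP_generator phi0 -> smoothc (base_symbol phi0 k).
Proof.
move=> /LP_generator_smoothc sp; case: k => [|k] //=.
have := smoothc_affine (l := 2) 0 _ sp; move=> /(_ _)h.
have {h} : smoothc (fun xi => phi0 (2 *: xi + 0)) by apply: h.
by under eq_fun do rewrite addr0; exact: smoothcB.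
Qed.

Lemma base_symbol_vanish (phi0 : V -> R) k : (0 < k)%N -> (0 < d)%N -> LP_generator phi0 ->
  vanish_near0 (2 * d%:R)^-1 (base_symbol phi0 k).
Proof.
case: k => // k _ d0 [_ p1 _] xi /= xir.
have dR : 0 < d%:R :> R by rewrite ltr0n.
have H (l : R) : 0 <= l -> l <= 2 -> euclid_norm (l *: xi) <= 1.
  move=> l0 l2; apply: le_trans (euclid_le_norm _) _; rewrite normrZ ger0_norm// mulrA.
  apply: (@le_trans _ _ (d%:R * 2 * (2 * d%:R)^-1)).
    by apply: ler_pM; rewrite ?mulr_ge0 ?ler_wpM2l ?(ltW dR) ?(ltW xir).
  by rewrite [d%:R * 2]mulrC divff// gt_eqF// mulr_gt0.
by rewrite p1 ?p1 ?subrr//; [exact: H|rewrite -[xi]scale1r; apply: H => //; lra].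
Qed.

Definition fourier_cst : R := (2 * pi) ^- d.

Lemma fourier_cst_gt0 : 0 < fourier_cst.
Proof. by rewrite invr_gt0 exprn_gt0// mulr_gt0// pi_gt0. Qed.

Lemma inverse_fourierE (g : V -> R) x :
  inverse_fourier (fun xi => (g xi)%:C) x =
  (fourier_cst * osc 0 g x) +i* (fourier_cst * osc (- (pi / 2)) g x).
Proof.
apply: complex_eq; rewrite /inverse_fourier ?ReM ?ImM/= ?mul0r ?subr0 ?addr0; congr (_ * _).
  by apply: eq_Rintegral => xi _; rewrite mulr0 subr0 mulrC /wave addr0.
by apply: eq_Rintegral => xi _; rewrite mulr0 add0r mulrC /wave cosBpihalf.
Qed.

Lemma LP_kernelE (phi0 : V -> R) k x : LP_generator phi0 ->
  inverse_fourier (fun xi => (LP_symbol phi0 k xi)%:C) x =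
  (fourier_cst * (2 ^+ k) ^+ d * osc 0 (base_symbol phi0 k) (2 ^+ k *: x)) +i*
  (fourier_cst * (2 ^+ k) ^+ d * osc (- (pi / 2)) (base_symbol phi0 k) (2 ^+ k *: x)).
Proof.
move=> gp; have k0 : 0 < 2 ^+ k :> R by rewrite exprn_gt0.
have b := smoothc_bcs (smoothc_base_symbol k gp).
rewrite inverse_fourierE -!mulrA -!(osc_scale _ _ k0 b).
by congr (_ +i* _); congr (_ * osc _ _ _); apply/funext => xi; rewrite LP_symbolE.
Qed.

(** The dilation that preserves the integral. *)
Definition dilate n f : V -> R := fun y => (2 ^+ n) ^+ d * f (2 ^+ n *: y).

Lemma bcs_dilate n f : bcs f -> bcs (dilate n f).
Proof.
move=> bf; apply: bcsZ; have := bcs_affine (l := 2 ^+ n) 0 _ bf.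
by under eq_fun do rewrite addr0; apply; rewrite exprn_gt0.
Qed.

(** Scaling the frequency variable by [2^k] and the integration variable by [2^n]
leaves only the ratio [2^k / 2^n]. *)
Lemma LP_block_dilate (phi0 : V -> R) k n f T x : LP_generator phi0 -> bcs f ->
  distribution_of (fun y => (dilate n f y)%:C) T ->
  LP_block phi0 k T x =
  (fourier_cst * (2 ^+ k) ^+ d * conv f 0 (base_symbol phi0 k) (2 ^+ k / 2 ^+ n) (2 ^+ n *: x)) +i*
  (fourier_cst * (2 ^+ k) ^+ d * conv f (- (pi / 2)) (base_symbol phi0 k) (2 ^+ k / 2 ^+ n) (2 ^+ n *: x)).
Proof.
move=> gp bf dT; have sp := smoothc_base_symbol k gp; have b := smoothc_bcs sp.
set A := fourier_cst * _.
have n0 : 0 < 2 ^+ n :> R by rewrite exprn_gt0.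
pose ker y := inverse_fourier (fun xi => (LP_symbol phi0 k xi)%:C) (x - y).
have rk th : rapid (fun y => A * osc th (base_symbol phi0 k) (2 ^+ k *: (x - y))).
  apply: rapidZ; apply: (rapid_reflect (h := fun z => osc th (base_symbol phi0 k) (2 ^+ k *: z))).
  have -> : (fun z => osc th (base_symbol phi0 k) (2 ^+ k *: z)) =
    (fun z => (2 ^+ k) ^- d * osc th (fun xi => base_symbol phi0 k ((2 ^+ k)^-1 *: xi)) z).
    apply/funext => z; rewrite osc_scale// mulrA mulVf ?mul1r//.
  apply: rapidZ; apply: rapid_osc.
  have := smoothc_affine (l := (2 ^+ k)^-1) 0 _ sp.
  by under eq_fun do rewrite addr0; apply; rewrite invr_gt0.
have ckr : crapid ker.
  split.
    rewrite (_ : Re_ _ = fun y => A * osc 0 (base_symbol phi0 k) (2 ^+ k *: (x - y)))//.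
    by apply/funext => y; rewrite /Re_ /ker LP_kernelE.
  rewrite (_ : Im_ _ = fun y => A * osc (- (pi / 2)) (base_symbol phi0 k) (2 ^+ k *: (x - y)))//.
  by apply/funext => y; rewrite /Im_ /ker LP_kernelE.
rewrite /LP_block (distribution_of_rapid gp (bcs_dilate n bf) dT ckr).
have H th : \int[mu]_y (dilate n f y * (A * osc th (base_symbol phi0 k) (2 ^+ k *: (x - y)))) =
    A * conv f th (base_symbol phi0 k) (2 ^+ k / 2 ^+ n) (2 ^+ n *: x).
  have bc := bcs_conv th (2 ^+ k / 2 ^+ n) (2 ^+ n *: x) bf b.
  have bc' := bcs_affine 0 n0 bc.
  rewrite /conv -(Rintegral_affine 0 n0 bc).
  rewrite mulrA -(bcs_RintegralZ _ bc'); apply: eq_Rintegral => y _.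
  rewrite addr0 /dilate -scalerBr scalerA divfK ?gt_eqF//.
  by ring.
apply: complex_eq; rewrite [RHS]/= -H.
  transitivity (\int[mu]_y (complex.Re ((dilate n f y)%:C * ker y))) => //.
  by apply: eq_Rintegral => y _; rewrite ReM /ker LP_kernelE//= mul0r subr0.
transitivity (\int[mu]_y (complex.Im ((dilate n f y)%:C * ker y))) => //.
by apply: eq_Rintegral => y _; rewrite ImM /ker LP_kernelE//= mul0r addr0.
Qed.

Lemma normc_real_scale (c a b : R) : 0 <= c ->
  normc ((c * a) +i* (c * b)) <= c * (`|a| + `|b|).
Proof.
move=> c0; apply: le_trans (normc_le _) _ => /=.
by rewrite !normrM (ger0_norm c0) mulrDr.
Qed.

(** By the addition theorem the phases 0 and [- pi / 2] determine all others. *)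
Lemma conv_phase f th psi l X : bcs f -> bcs psi ->
  conv f th psi l X = cos th * conv f 0 psi l X - sin th * conv f (- (pi / 2)) psi l X.
Proof.
move=> bf bp.
have H x : osc th psi x = cos th * osc 0 psi x - sin th * osc (- (pi / 2)) psi x.
  rewrite /osc -(bcs_RintegralZ _ (bcs_osc _ _ bp)) -(bcs_RintegralZ _ (bcs_osc _ _ bp)).
  rewrite -(bcs_RintegralB (bcsZ _ (bcs_osc _ _ bp)) (bcsZ _ (bcs_osc _ _ bp))).
  by apply: eq_Rintegral => xi _; rewrite /wave addr0 cosBpihalf cosD; ring.
rewrite /conv -(bcs_RintegralZ _ (bcs_conv _ _ _ bf bp)) -(bcs_RintegralZ _ (bcs_conv _ _ _ bf bp)).
rewrite -(bcs_RintegralB (bcsZ _ (bcs_conv _ _ _ bf bp)) (bcsZ _ (bcs_conv _ _ _ bf bp))).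
by apply: eq_Rintegral => y _; rewrite H; ring.
Qed.

(** [conv_phase] writes the convolution with the phase [th] in terms of the real and
the imaginary part, with coefficients bounded by 1. *)
Lemma normc_ge_conv (c : R) f th psi l X : 0 <= c -> bcs f -> bcs psi ->
  c * `|conv f th psi l X| <= 2 * normc ((c * conv f 0 psi l X) +i* (c * conv f (- (pi / 2)) psi l X)).
Proof.
move=> c0 bf bp; rewrite (conv_phase th _ _ bf bp).
set a := conv f 0 _ _ _; set b := conv f _ _ _ _; set z := _ +i* _.
have h1 : c * `|a| <= normc z by have := normc_ge_Re z; rewrite /= normrM ger0_norm.
have h2 : c * `|b| <= normc z by have := normc_ge_Im z; rewrite /= normrM ger0_norm.
have hc := cos_max th; have hs : `|sin th| <= 1 by rewrite -cosBpihalf cos_max.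
apply: (@le_trans _ _ (c * (`|a| + `|b|))); last first.
  by rewrite mulrDr mulrDl mul1r; exact: (lerD h1 h2).
rewrite ler_wpM2l//; apply: le_trans (ler_normB _ _) _.
by rewrite !normrM; apply: lerD; exact: ler_piMl.
Qed.

End littlewood_paley_blocks.

Section block_bounds.
Variables (R : realType) (d : nat).
Local Open Scope complex_scope.
Local Notation V := 'rV[R]_d.
Local Notation mu := (lebesgue_rV R d).
Local Notation normc := (@Normc.normc R).
Implicit Types (f G psi : V -> R) (x y X : V) (k n : nat) (t th : R).

Definition gap k n : nat := (k - n + (n - k))%N.

Lemma powR2_nat (n : nat) : 2 `^ n%:R = 2 ^+ n :> R.
Proof. by rewrite powR_mulrn. Qed.

Lemma powRe_gt0 (a : R) : 0 < 2 `^ a :> R.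
Proof. by rewrite powR_gt0. Qed.

Lemma powR2D (a b : R) : 2 `^ (a + b) = 2 `^ a * 2 `^ b :> R.
Proof. by rewrite powRD// pnatr_eq0 implybT. Qed.

Lemma powR2_le (a b : R) : a <= b -> 2 `^ a <= 2 `^ b :> R.
Proof. by move=> ab; rewrite ler_powR// ler1n. Qed.

Lemma expr_le_powR (b t : R) (m : nat) : 1 <= b -> t <= m%:R -> b `^ t <= b ^+ m.
Proof.
move=> b1 tm; rewrite -powR_mulrn ?(le_trans ler01)//.
exact: ler_powR.
Qed.

Variable al : R.
Hypothesis al0 : 0 <= al.

(** The [p]-th power of the profile is integrable with an integral independent of
[n], if [al = d / p]; the surplus 1/2 in the exponent makes it decay at infinity. *)
Definition profile n x : R := 2 `^ (n%:R * al) / (1 + `|2 ^+ n *: x|) `^ (al + 2^-1).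

(** The geometric rate at which the blocks [k] of the dilate [n] decay in [|k - n|]. *)
Definition decay : R := 2 `^ (- 2^-1).

(** Put [l = 2^k / 2^n <= 1].  The power [l^(al + 1/2)] turns decay in [l X] into
decay in [X]; of the factor [l] and the weight there remains [l^(1/2)], which is the
geometric factor. *)
Lemma low_to_profile k n x (C c : R) (L : nat) : (k <= n)%N -> al + 2^-1 <= L%:R -> 0 <= C ->
  (1 + `|(2 ^+ k / 2 ^+ n) *: (2 ^+ n *: x)|) ^+ L * c <= C * (2 ^+ k / 2 ^+ n) ->
  2 `^ (k%:R * al) * c <= C * (decay ^+ gap k n * profile n x).
Proof.
move=> kn aL C0 H.
set X := 2 ^+ n *: x in H *.
set l := 2 ^+ k / 2 ^+ n in H.
have l0 : 0 < l by rewrite divr_gt0.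
have l1 : l <= 1 by rewrite ler_pdivrMr// mul1r ler_eXn2l// ltr1n.
pose lam := al + 2^-1.
have b1 : 1 <= 1 + `|l *: X| by rewrite lerDl.
have h1 : c <= C * l / (1 + `|l *: X|) ^+ L by rewrite ler_pdivlMr// mulrC.
have h2 : (l * (1 + `|X|)) `^ lam <= (1 + `|l *: X|) ^+ L.
  apply: le_trans (expr_le_powR b1 aL); apply: ge0_ler_powR; rewrite ?nnegrE ?mulr_ge0 ?addr_ge0 ?(ltW l0)//.
  have -> : `|l *: X| = l * `|X| by rewrite (normrZ l X) (gtr0_norm l0).
  by rewrite mulrDr mulr1 lerD2r.
rewrite powRM ?(ltW l0)// in h2.
have lE : l = 2 `^ (- (gap k n)%:R).
  rewrite /gap (eqP (_ : (k - n == 0)%N)) ?subn_eq0// add0n.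
  rewrite natrB// opprB powR2D powRN !powR_mulrn//.
have h3 : 2 `^ (k%:R * al) = 2 `^ (n%:R * al) * l `^ al.
  rewrite lE -powRrM -powR2D; congr (_ `^ _).
  by rewrite /gap (eqP (_ : (k - n == 0)%N)) ?subn_eq0// add0n natrB//; ring.
have h4 : l `^ al * l / l `^ lam = decay ^+ gap k n.
  rewrite /decay -[_ ^+ gap k n]powR_mulrn ?powR_ge0// -powRrM.
  rewrite {2}[l]lE lE -!powRrM -powRN -!powR2D; congr (_ `^ _).
  by rewrite /lam; field.
apply: (@le_trans _ _ (2 `^ (k%:R * al) * (C * l / (l `^ lam * (1 + `|X|) `^ lam)))).
  rewrite ler_wpM2l ?powR_ge0//; apply: le_trans h1 _.
  rewrite ler_wpM2l ?mulr_ge0 ?(ltW l0)// lef_pV2 ?posrE// mulr_gt0// powR_gt0//.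
rewrite h3 /profile -/lam -/X -h4 le_eqVlt; apply/orP; left; apply/eqP.
have ll : l `^ lam != 0 by rewrite gt_eqF// powR_gt0.
have pX : (1 + `|X|) `^ lam != 0 by rewrite gt_eqF.
by field; rewrite ll pX.
Qed.

(** The decay in [X] is already that of the profile, and the powers of
[1 / l] beat the weight [l^al] with a geometric factor to spare. *)
Lemma high_to_profile k n x (C c : R) (K L : nat) : (n <= k)%N -> al + 2^-1 <= L%:R ->
  al + 2^-1 <= K%:R -> 0 <= C ->
  (1 + `|2 ^+ n *: x|) ^+ L * c <= C / (2 ^+ k / 2 ^+ n) ^+ K ->
  2 `^ (k%:R * al) * c <= C * (decay ^+ gap k n * profile n x).
Proof.
move=> nk aL aK C0 H.
set X := 2 ^+ n *: x in H *.
set l := 2 ^+ k / 2 ^+ n in H.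
have l1 : 1 <= l by rewrite ler_pdivlMr// mul1r ler_eXn2l// ltr1n.
have l0 : 0 < l := lt_le_trans ltr01 l1.
pose lam := al + 2^-1.
have b1 : 1 <= 1 + `|X| by rewrite lerDl.
have h1 : c <= C / l ^+ K / (1 + `|X|) ^+ L by rewrite ler_pdivlMr// mulrC.
have lE : l = 2 `^ (gap k n)%:R.
  rewrite /gap (eqP (_ : (n - k == 0)%N)) ?subn_eq0// addn0.
  by rewrite natrB// powR2D powRN !powR_mulrn.
have h3 : 2 `^ (k%:R * al) = 2 `^ (n%:R * al) * l `^ al.
  rewrite lE -powRrM -powR2D; congr (_ `^ _).
  by rewrite /gap (eqP (_ : (n - k == 0)%N)) ?subn_eq0// addn0 natrB//; ring.
have h4 : l `^ al / l ^+ K <= decay ^+ gap k n.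
  apply: (@le_trans _ _ (l `^ al / l `^ lam)).
    by rewrite ler_wpM2l ?powR_ge0// lef_pV2 ?posrE ?powR_gt0 ?exprn_gt0// expr_le_powR.
  rewrite /decay -[_ ^+ gap k n]powR_mulrn ?powR_ge0// -powRrM.
  rewrite lE -!powRrM -powRN -!powR2D; apply: powR2_le.
  by rewrite /lam le_eqVlt; apply/orP; left; apply/eqP; ring.
have h5 : ((1 + `|X|) ^+ L)^-1 <= ((1 + `|X|) `^ lam)^-1.
  by rewrite lef_pV2 ?posrE// expr_le_powR.
apply: (@le_trans _ _ (2 `^ (k%:R * al) * (C / l ^+ K / (1 + `|X|) ^+ L))).
  by rewrite ler_wpM2l ?powR_ge0.
rewrite h3 /profile -/lam -/X.
have -> : 2 `^ (n%:R * al) * l `^ al * (C / l ^+ K / (1 + `|X|) ^+ L) =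
  (C * 2 `^ (n%:R * al)) * ((l `^ al / l ^+ K) * ((1 + `|X|) ^+ L)^-1) by ring.
have -> : C * (decay ^+ gap k n * (2 `^ (n%:R * al) / (1 + `|X|) `^ lam)) =
  (C * 2 `^ (n%:R * al)) * (decay ^+ gap k n * ((1 + `|X|) `^ lam)^-1) by ring.
rewrite ler_wpM2l ?mulr_ge0 ?powR_ge0//; apply: ler_pM => //.
by rewrite mulr_ge0 ?invr_ge0 ?powR_ge0 ?exprn_ge0 ?(ltW l0).
Qed.

Lemma convZ t f th psi (l : R) X : bcs f -> bcs psi ->
  conv (fun z => t * f z) th psi l X = t * conv f th psi l X.
Proof.
move=> bf bp; rewrite /conv -(bcs_RintegralZ _ (bcs_conv _ _ _ bf bp)).
by apply: eq_Rintegral => y _; rewrite mulrA.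
Qed.

(** [conv_low] and [conv_high] in one estimate.  The factor [t] records that the
bound is homogeneous in [f]. *)
Lemma block_upper_bound (phi0 : V -> R) f : (0 < d)%N -> LP_generator phi0 -> smoothc f ->
  \int[mu]_x f x = 0 ->
  exists2 C : R, 0 < C & forall n k t T x, 0 <= t ->
    distribution_of (fun y => (dilate n (fun z => t * f z) y)%:C) T ->
    2 `^ (k%:R * (al - d%:R)) * normc (LP_block phi0 k T x) <=
      t * C * (decay ^+ gap k n * profile n x).
Proof.
move=> d0 gp sf f0.
have bf := smoothc_bcs sf.
have [L aL] : exists L : nat, al + 2^-1 <= L%:R.
  by exists (Num.bound (al + 2^-1)); apply: ltW; apply: archi_boundP; rewrite addr_ge0// invr_ge0.
have [C1 C10 H1] := conv_low L bf f0 (smoothc_base_symbol 0 gp).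
have [C2 C20 H2] := conv_low L bf f0 (smoothc_base_symbol 1 gp).
have r0 : 0 < (2 * d%:R)^-1 :> R by rewrite invr_gt0 mulr_gt0// ltr0n.
have [C3 C30 H3] := conv_high L L r0 sf (smoothc_base_symbol 1 gp) (base_symbol_vanish (ltn0Sn 0) d0 gp).
pose C := C1 + C2 + C3.
have C0 : 0 < C by rewrite !addr_gt0.
have key th k n x : 2 `^ (k%:R * al) * `|conv f th (base_symbol phi0 k) (2 ^+ k / 2 ^+ n) (2 ^+ n *: x)| <=
    C * (decay ^+ gap k n * profile n x).
  have k0 : 0 < 2 ^+ k :> R by rewrite exprn_gt0.
  have l0 : 0 < 2 ^+ k / 2 ^+ n :> R by rewrite divr_gt0.
  have [kn|nk] := leqP k n.
    have l1 : 2 ^+ k / 2 ^+ n <= 1 :> R by rewrite ler_pdivrMr// mul1r ler_eXn2l// ltr1n.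
    apply: (low_to_profile kn aL (ltW C0)).
    case: k k0 l0 l1 {kn} => [|k] k0 l0 l1.
      apply: le_trans (H1 th _ _ l0 l1) _; rewrite ler_wpM2r ?(ltW l0)//.
      by rewrite /C -addrA lerDl addr_ge0// ltW.
    apply: le_trans (H2 th _ _ l0 l1) _; rewrite ler_wpM2r ?(ltW l0)//.
    by rewrite /C addrAC lerDr addr_ge0// ltW.
  have l1 : 1 <= 2 ^+ k / 2 ^+ n :> R by rewrite ler_pdivlMr// mul1r ler_eXn2l ?ltr1n// ltnW.
  apply: (high_to_profile (ltnW nk) aL aL (ltW C0)).
  case: k k0 l0 l1 nk => // k k0 l0 l1 nk.
  apply: le_trans (H3 th _ _ l1) _; rewrite ler_wpM2r ?invr_ge0 ?exprn_ge0 ?(ltW l0)//.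
  by rewrite /C lerDr addr_ge0// ltW.
exists (fourier_cst R d * (C + C)).
  by rewrite mulr_gt0 ?addr_gt0 ?fourier_cst_gt0.
move=> n k t T x t0 dT; rewrite (LP_block_dilate k x gp (bcsZ t bf) dT).
have bk := smoothc_bcs (smoothc_base_symbol k gp).
rewrite !(convZ t _ _ _ bf bk).
have c0 := @fourier_cst_gt0 R d.
apply: (le_trans (ler_wpM2l (powR_ge0 _ _) (normc_real_scale _ _ _))).
  by rewrite mulr_ge0 ?exprn_ge0// ltW.
rewrite !normrM (ger0_norm t0).
have Ha := key 0 k n x; have Hb := key (- (pi / 2)) k n x.
set a := `|conv _ 0 _ _ _| in Ha *; set b := `|conv _ (- _) _ _ _| in Hb *.
set G := decay ^+ _ * _ in Ha Hb *.
have -> : 2 `^ (k%:R * (al - d%:R)) * (fourier_cst R d * (2 ^+ k) ^+ d * (t * a + t * b)) =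
   t * fourier_cst R d * (2 `^ (k%:R * al) * a + 2 `^ (k%:R * al) * b).
  have -> : 2 `^ (k%:R * al) = 2 `^ (k%:R * (al - d%:R)) * (2 ^+ k) ^+ d :> R.
    by rewrite -exprM -powR_mulrn// -powR2D natrM; congr (_ `^ _); ring.
  by move: (a) (b) => a' b'; ring.
rewrite [t * (_ * _)]mulrA -[leRHS]mulrA.
apply: ler_wpM2l; first exact: mulr_ge0 t0 (ltW c0).
by rewrite mulrDl; exact: lerD Ha Hb.
Qed.

End block_bounds.

(** * Sequence norms and a fixed profile *)

Section sequence_norms.
Variable R : realType.
Local Open Scope ereal_scope.
Implicit Types (q : \bar R) (r a rho : R).

(** Both integrals are suprema over nonnegative simple functions, and the larger
function admits more of them. *)
Lemma le_integral_pointwise d (T : measurableType d) (m : {measure set T -> \bar R}) (f g : T -> \bar R) :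
  (forall x, 0 <= f x) -> (forall x, f x <= g x) -> \int[m]_x f x <= \int[m]_x g x.
Proof.
move=> f0 fg; have g0 x : 0 <= g x := le_trans (f0 x) (fg x).
rewrite !ge0_integralTE//; apply: le_ereal_sup => _ [h hf <-].
by exists h => // x; apply: le_trans (fg x); exact: hf.
Qed.

Lemma le_poweR r (x y : \bar R) : (0 <= r)%R -> 0 <= x -> x <= y -> x `^ r <= y `^ r.
Proof.
by move=> r0 x0 xy; apply: gt0_ler_poweR; rewrite ?in_itv/= ?leey ?andbT ?(le_trans x0).
Qed.

Lemma le_Lnorm_pointwise d (T : measurableType d) (m : {measure set T -> \bar R}) (r : R) (f g : T -> \bar R) :
  (0 < r)%R -> (forall x, 0 <= f x) -> (forall x, f x <= g x) -> Lnorm m r%:E f <= Lnorm m r%:E g.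
Proof.
move=> r0 f0 fg; rewrite unlock /Lnorm; apply: le_poweR.
- by rewrite invr_ge0 ltW.
- by apply: integral_ge0 => x _; exact: poweR_ge0.
apply: le_integral_pointwise => x; first exact: poweR_ge0.
apply: le_poweR; rewrite ?abse_ge0 ?(ltW r0)//.
by rewrite !gee0_abs// (le_trans (f0 x)).
Qed.

Lemma counting_setT_gt0 : 0 < (counting [set: nat] : \bar R).
Proof. by rewrite /counting; case: asboolP => [fin|]//; case: (infinite_nat fin). Qed.

(** For the counting measure only the empty set is negligible. *)
Lemma le_ess_sup_counting (f : nat -> \bar R) k : f k <= ess_sup_inf.ess_sup counting f.
Proof.
have := @ess_sup_inf.ess_sup_ge _ _ R counting f; case=> N [mN N0 HN].
have [//|/negP h] := boolP (f k <= ess_sup_inf.ess_sup counting f).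
have Nk : N k by apply: HN.
 have : (counting [set k] : \bar R) <= counting N.
  by apply: le_measure => //; rewrite ?inE// => _ ->.
rewrite N0 /counting; case: asboolP => [h1|h1]; last by rewrite leye_eq.
rewrite (_ : #|` _ | = 1%N) ?lee_fin ?ler10//.
by rewrite fset_set1 cardfs1.
Qed.

(** For [q = +oo] the exponent [1 / q] is 0 and a single term suffices. *)
Lemma counting_Lnorm_ge q (f : nat -> \bar R) (n1 n2 : nat) (c : R) : 0 < q -> (n1 < n2)%N ->
  (0 <= c)%R -> (forall k, (n1 <= k < n2)%N -> c%:E <= `|f k|) ->
  (c * (n2 - n1)%:R `^ fine q^-1)%:E <= Lnorm counting q f.
Proof.
move=> q0 n12 c0 cf; case: q q0 => [r| |]//; last first.
  move=> _; rewrite invey/= powRr0 mulr1 unlock /Lnorm counting_setT_gt0.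
  apply: le_trans (cf n1 _) _; first by rewrite leqnn.
  exact: (le_ess_sup_counting (abse \o f) n1).
rewrite lte_fin => r0; rewrite Lnorm_counting// inver gt_eqF//=.
have -> : (c * (n2 - n1)%:R `^ r^-1)%:E = ((n2 - n1)%:R * c `^ r)%:E `^ r^-1.
  rewrite poweR_EFin powRM ?powR_ge0// -powRrM divff ?gt_eqF// powRr1// mulrC//.
apply: le_poweR; rewrite ?invr_ge0 ?(ltW r0)//.
  by rewrite lee_fin mulr_ge0 ?powR_ge0.
apply: (@le_trans _ _ (\sum_(n1 <= k < n2) `|f k| `^ r)); last first.
  apply: (@le_trans _ _ (\sum_(0 <= k < n2) `|f k| `^ r)).
    rewrite (@big_cat_nat _ _ _ n1 0%N)//= ?(ltnW n12)//.
    by rewrite leeDr// sume_ge0// => i _; exact: poweR_ge0.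
  by apply: nneseries_lim_ge => k _ _; exact: poweR_ge0.
have -> : ((n2 - n1)%:R * c `^ r)%:E = \sum_(n1 <= k < n2) (c `^ r)%:E.
  by rewrite sumEFin big_const_nat iter_addr_0 mulr_natl.
rewrite big_nat [leRHS]big_nat; apply: lee_sum => k kn.
rewrite -poweR_EFin; apply: le_poweR; rewrite ?(ltW r0) ?lee_fin//; exact: cf.
Qed.

(** Both tails are geometric series.  The subtracted power of [rho] makes the bound
inductive in [M]. *)
Lemma geometric_gap_sum rho (M n : nat) : (0 < rho)%R -> (rho < 1)%R ->
  ((1 - rho) * \sum_(k < n) rho ^+ gap k M <= 2 - rho ^+ M)%R.
Proof.
move=> r0 r1; elim: M n => [|M IH] [|n].
- by rewrite big_ord0 mulr0 expr0; lra.
- have -> : (\sum_(k < n.+1) rho ^+ gap k 0 = \sum_(k < n.+1) rho ^+ k)%R.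
    by apply: eq_bigr => k _; rewrite /gap subn0 sub0n addn0.
  rewrite -opprB mulNr -subrX1 opprB expr0.
  by have : (0 < rho ^+ n.+1)%R by [rewrite exprn_gt0]; lra.
- rewrite big_ord0 mulr0 subr_ge0.
  by apply: (@le_trans _ _ 1%R); rewrite ?exprn_ile1 ?(ltW r0) ?(ltW r1)//; lra.
rewrite big_ord_recl /= /bump/=.
have -> : (\sum_(i < n) rho ^+ gap (1 + i) M.+1 = \sum_(i < n) rho ^+ gap i M)%R.
  by apply: eq_bigr => i _; rewrite /gap add1n !subSS.
rewrite mulrDr; apply: (le_trans (lerD (lexx _) (IH n))).
rewrite {1}/gap sub0n subn0 add0n exprS.
have : (0 <= rho ^+ M * (1 - rho) ^+ 2)%R by rewrite mulr_ge0 ?sqr_ge0 ?exprn_ge0 ?(ltW r0).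
by move: (rho ^+ M)%R => t; nra.
Qed.

Lemma nneseries_le (u : nat -> \bar R) (b : \bar R) : (forall k, 0 <= u k) ->
  (forall n, \sum_(k < n) u k <= b) -> \sum_(0 <= k <oo) u k <= b.
Proof.
move=> u0 ub; apply: lime_le; first by apply: is_cvg_nneseries => n _ _; exact: u0.
by apply: nearW => n; rewrite big_mkord.
Qed.

Lemma powR2_gt1 (e : R) : (0 < e -> 1 < 2 `^ e)%R.
Proof.
move=> e0; have e1 : (1 `^ e = 1 :> R)%R by rewrite powR1.
by rewrite -[ltLHS]e1 gt0_ltr_powR ?nnegrE ?ler0n ?ler01// ltr1n.
Qed.

Lemma decay_gt0 : (0 < decay R)%R. Proof. exact: powRe_gt0. Qed.

Lemma decay_lt1 : (decay R < 1)%R.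
Proof.
rewrite /decay powRN invf_lt1 ?powRe_gt0//.
by rewrite powR2_gt1// invr_gt0.
Qed.

(** The constant [B] does not depend on the position [M] of the peak; this is
what makes the upper bounds uniform in the dilation. *)
Lemma counting_Lnorm_geometric q : 0 < q -> exists2 B : R, (0 < B)%R &
  forall (f : nat -> \bar R) (a : R) (M : nat), (0 <= a)%R ->
    (forall k, 0 <= f k) -> (forall k, f k <= (a * decay R ^+ gap k M)%:E) ->
    Lnorm counting q f <= (a * B)%:E.
Proof.
have d0 := decay_gt0; have d1 := decay_lt1.
case: q => [r| |]// q0; last first.
  exists 1%R => // f a M a0 f0 fa; rewrite mulr1 unlock /Lnorm counting_setT_gt0.
  apply/ess_sup_inf.ess_supP; apply: nearW => k /=; rewrite gee0_abs//; apply: le_trans (fa k) _.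
  by rewrite lee_fin ler_piMr// exprn_ile1// ltW.
rewrite lte_fin in q0; set rho := (decay R `^ r)%R.
have rho0 : (0 < rho)%R by rewrite powR_gt0.
have rho1 : (rho < 1)%R.
  have e1 : (1 `^ r = 1 :> R)%R by rewrite powR1.
  by rewrite -[ltRHS]e1 gt0_ltr_powR// nnegrE ?ler01 ?(ltW d0).
exists ((2 / (1 - rho)) `^ r^-1)%R; first by apply: powR_gt0; rewrite divr_gt0// subr_gt0.
move=> f a M a0 f0 fa; rewrite Lnorm_counting//.
have -> : (a * (2 / (1 - rho)) `^ r^-1)%:E = (a `^ r * (2 / (1 - rho)))%:E `^ r^-1.
  rewrite poweR_EFin powRM ?powR_ge0 ?divr_ge0 ?subr_ge0 ?(ltW rho1)//.
  by rewrite -powRrM divff ?gt_eqF// powRr1.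
apply: le_poweR; first by rewrite invr_ge0 ltW.
  by apply: nneseries_ge0 => k _ _; exact: poweR_ge0.
apply: nneseries_le => [k|n]; first exact: poweR_ge0.
apply: (@le_trans _ _ (\sum_(k < n) (a `^ r * rho ^+ gap k M)%:E)).
  apply: lee_sum => k _.
  have -> : (a `^ r * rho ^+ gap k M)%:E = (a * decay R ^+ gap k M)%:E `^ r.
    rewrite poweR_EFin powRM ?exprn_ge0 ?(ltW d0)//.
    by rewrite -(powR_mulrn (gap k M) (ltW d0)) -(powR_mulrn (gap k M) (ltW rho0)) /rho -!powRrM [(r * _)%R]mulrC.
  by apply: le_poweR; rewrite ?(ltW q0) ?abse_ge0// gee0_abs.
rewrite sumEFin lee_fin -mulr_sumr ler_wpM2l ?powR_ge0//.
rewrite ler_pdivlMr ?subr_gt0// mulrC; apply: le_trans (geometric_gap_sum _ _ rho0 rho1) _.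
by rewrite gerBl exprn_ge0// ltW.
Qed.

End sequence_norms.

Section profile_integral.
Variables (R : realType) (d : nat).
Local Notation V := 'rV[R]_d.
Local Notation mu := (lebesgue_rV R d).

Lemma continuous_bracket (t : R) : continuous (fun y : V => (1 + `|y|) `^ t).
Proof.
move=> y; apply: (@continuous_comp _ _ _ (fun y : V => 1 + `|y|) (fun s : R => s `^ t)).
  apply: (@continuousD _ _ _ (cst (1:R)) (fun y : V => `|y| : R)); first exact: cst_continuous.
  exact: norm_continuous.
apply: (@differentiable_continuous _ _ _ _ _).
apply/derivable1_diffP.
by apply: derivable_powR; rewrite in_itv/= andbT ltr_wpDr.
Qed.

(** The function is dominated by a sum of multiples of indicator functions of the
balls [|y| < 2^k]; the multiples are bounds for it where [|y| >= 2^(k - 1)]. *)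
Lemma integral_bracket (e : R) : 0 < e -> exists2 K : R, 0 < K &
  (\int[mu]_y ((1 + `|y|) `^ (- (d%:R + e)))%:E <= K%:E)%E.
Proof.
move=> e0; pose t := d%:R + e.
pose c k : R := 2 `^ (t - k%:R * t).
pose B k : set V := [set y : V | `|y - 0| < 2 ^+ k].
have mB k : measurable (B k) by exact: measurable_norm_ball.
have t0 : 0 < t by rewrite ltr_wpDl.
pose rho : R := 2 `^ (- e).
have rho0 : 0 < rho by exact: powRe_gt0.
have rho1 : rho < 1.
  by rewrite /rho powRN invf_lt1 ?powRe_gt0// powR2_gt1.
exists (2 `^ (t + d%:R) / (1 - rho)); first by rewrite divr_gt0 ?powRe_gt0// subr_gt0.
have h1 y : (((1 + `|y|) `^ (- t))%:E <= \big[+%E/0%E]_(0 <= k <oo) (c k * \1_(B k) y)%:E)%E.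
  have c0 k : 0 <= c k * \1_(B k) y by rewrite mulr_ge0 ?powR_ge0// indicE.
  have ex : exists k : nat, `|y| < 2 ^+ k.
    exists (Num.bound `|y|); apply: lt_le_trans (archi_boundP (normr_ge0 y)) _.
    by rewrite -natrX ler_nat ltnW// ltn_expl.
  case: (ex_minnP ex) => k yk kmin.
  apply: (@le_trans _ _ (\sum_(0 <= i < k.+1) (c i * \1_(B i) y)%:E)%E); last first.
    by apply: nneseries_lim_ge => i _ _; rewrite lee_fin.
  rewrite big_nat_recr//=.
  apply: (@le_trans _ _ (c k * \1_(B k) y)%:E); last first.
    by rewrite leeDr// sume_ge0// => i _; rewrite lee_fin.
  rewrite indicE mem_set ?mulr1; last by rewrite /B/= subr0.
  have y1 : 0 < 1 + `|y| by rewrite ltr_wpDr.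
  rewrite lee_fin /c; case: k yk kmin => [|k] yk kmin.
    apply: (@le_trans _ _ 1); last by rewrite mul0r subr0 ltW// powR2_gt1.
    by rewrite -[leRHS](powRr0 (1 + `|y|)); apply: ler_powR; rewrite ?lerDl// oppr_le0 ltW.
  have ky : 2 ^+ k <= `|y| by rewrite leNgt; apply/negP => /kmin; rewrite ltnn.
  have -> : t - k.+1%:R * t = k%:R * - t by rewrite -natr1; ring.
  rewrite mulrN !powRN lef_pV2 ?posrE ?powR_gt0// powRrM powR2_nat.
  by rewrite ge0_ler_powR ?nnegrE ?(ltW t0) ?exprn_ge0 ?(ltW y1)// (le_trans ky)// lerDr.
have f0 (y : V) : (0 <= ((1 + `|y|) `^ (- t))%:E)%E by rewrite lee_fin powR_ge0.
apply: (le_trans (le_integral_pointwise mu f0 h1)).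
rewrite integral_nneseries//; last 2 first.
- move=> k; apply/measurable_EFinP; apply: measurable_funM => //.
- by move=> k y _; rewrite lee_fin mulr_ge0 ?powR_ge0// indicE.
apply: nneseries_le => [k|n].
  by apply: integral_ge0 => y _; rewrite lee_fin mulr_ge0 ?powR_ge0// indicE.
have h2 k : (\int[mu]_y (c k * \1_(B k) y)%:E = (2 `^ (t + d%:R) * rho ^+ k)%:E)%E.
  under eq_integral do rewrite EFinM.
  rewrite ge0_integralZl_EFin ?powR_ge0//; last first.
    by apply/measurable_EFinP; exact: measurable_indic.
  rewrite integral_indic// setIT.
  transitivity ((c k)%:E * ((2 * 2 ^+ k) ^+ d)%:E)%E.
    by congr (_ * _)%E; apply: lebesgue_rV_ball; rewrite exprn_gt0.
  rewrite -EFinM; congr EFin; rewrite /c /rho -exprS -exprM -powR2_nat.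
  rewrite -[_ ^+ k]powR_mulrn ?powR_ge0// -powRrM -!powR2D; congr (_ `^ _).
  by rewrite /t natrM -natr1; ring.
under eq_bigr do rewrite h2.
rewrite sumEFin lee_fin -mulr_sumr ler_wpM2l ?powR_ge0// -div1r ler_pdivlMr ?subr_gt0//.
rewrite mulrC -opprB mulNr -subrX1 opprB gerBl exprn_ge0//.
exact: ltW.
Qed.

(** The change of variables by [2^n] cancels the factor [2^(n d)] of the [p]-th
power. *)
Lemma Lnorm_profile (p : R) : 0 < p -> exists2 K : R, 0 < K & forall n (c : R), 0 <= c ->
  (Lnorm mu p%:E (fun x => (c * profile (d%:R / p) n x)%:E) <= (c * K)%:E)%E.
Proof.
move=> p0; have e0 : 0 < p / 2 by rewrite divr_gt0.
have [K K0 HK] := integral_bracket e0.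
exists (K `^ p^-1) => [|n c c0]; first by rewrite powR_gt0.
have -> : ((c * K `^ p^-1)%:E = (c `^ p * K)%:E `^ p^-1)%E.
  by rewrite poweR_EFin powRM ?powR_ge0 ?(ltW K0)// -powRrM divff ?gt_eqF// powRr1.
rewrite unlock /Lnorm; apply: le_poweR; first by rewrite invr_ge0 ltW.
  by apply: integral_ge0 => y _; exact: poweR_ge0.
pose g (y : V) : \bar R := ((c `^ p) * (1 + `|y|) `^ (- (d%:R + p / 2)))%:E.
have mb : measurable_fun [set: V] (fun y : V => (1 + `|y|) `^ (- (d%:R + p / 2))).
  by apply: continuous_measurable_rV; exact: continuous_bracket.
have mg : measurable_fun [set: V] g by apply/measurable_EFinP; exact: measurable_funM.
have g0 y : (0 <= g y)%E by rewrite lee_fin mulr_ge0 ?powR_ge0.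
have -> : (\int[mu]_x (`|(c * profile (d%:R / p) n x)%:E| `^ p) =
   \int[mu]_x (((2 ^+ n) ^+ d)%:E * g (2 ^+ n *: x + 0)%R))%E.
  apply: eq_integral => x _; rewrite abse_EFin poweR_EFin /g -EFinM; congr EFin.
  have pr0 : 0 <= profile (d%:R / p) n x by rewrite divr_ge0 ?powR_ge0.
  rewrite addr0 ger0_norm ?mulr_ge0// powRM// /profile powRM ?powR_ge0 ?invr_ge0 ?powR_ge0//.
  rewrite -powRN -!powRrM.
  have -> : n%:R * (d%:R / p) * p = n%:R * d%:R by rewrite -mulrA divfK ?gt_eqF.
  have -> : - (d%:R / p + 2^-1) * p = - (d%:R + p / 2).
    by rewrite mulNr mulrDl divfK ?gt_eqF// [_ * p]mulrC.
  by rewrite -natrM powR2_nat exprM mulrCA.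
rewrite ge0_integralZl_EFin//; last first.
  exact: (measurableT_comp mg (measurable_fun_affine (2 ^+ n) 0)).
rewrite ge0_integral_affine// /g.
under eq_integral do rewrite EFinM.
rewrite ge0_integralZl_EFin ?powR_ge0//; last exact/measurable_EFinP.
by rewrite EFinM lee_wpmul2l// lee_fin powR_ge0.
Qed.

End profile_integral.

(** * Besov and Triebel-Lizorkin norms from pointwise bounds *)

Section function_space_norms.
Variables (R : realType) (d : nat).
Local Open Scope complex_scope.
Local Notation V := 'rV[R]_d.
Local Notation mu := (lebesgue_rV R d).
Local Notation normc := (@Normc.normc R).
Implicit Types (f : V -> R) (x : V) (k n : nat) (q : \bar R).

Variable p : R.
Hypothesis p0 : 0 < p.
Let al : R := d%:R / p.

Lemma normc_ge0 (z : R[i]) : 0 <= normc z.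
Proof. exact: le_trans (normr_ge0 _) (normc_ge_Re z). Qed.

(** Uniformity in [n] is the point: [n] only shifts the peak of the geometric
sequence and dilates the profile. *)
Lemma norms_upper_bound (phi0 : V -> R) q f : (0 < q)%E -> (0 < d)%N -> LP_generator phi0 ->
  smoothc f -> \int[mu]_x f x = 0 ->
  exists2 C : R, 0 < C & forall n t T, 0 <= t ->
    distribution_of (fun y => (dilate n (fun z => t * f z) y)%:C) T ->
    (besov_norm_distr phi0 (al - d%:R) p q T <= (t * C)%:E)%E /\
    (triebel_lizorkin_norm_distr phi0 (al - d%:R) p q T <= (t * C)%:E)%E.
Proof.
move=> q0 d0 gp sf f0.
have al0 : 0 <= al by rewrite divr_ge0// ltW.
have [C C0 HC] := block_upper_bound al0 d0 gp sf f0.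
have [B B0 HB] := counting_Lnorm_geometric q0.
have [K K0 HK] := Lnorm_profile d p0.
have pr0 n x : 0 <= profile al n x by rewrite divr_ge0 ?powR_ge0.
have de0 : 0 < decay R := decay_gt0 R.
exists (C * B * K) => [|n t T t0 dT]; first by rewrite !mulr_gt0.
have tC0 : 0 <= t * C by rewrite mulr_ge0// ltW.
split.
  have -> : t * (C * B * K) = t * C * K * B by rewrite -!mulrA [B * K]mulrC.
  apply: (HB _ _ n) => [||k].
  - by rewrite mulr_ge0// ltW.
  - by move=> k; rewrite mule_ge0 ?lee_fin ?powR_ge0// Lnorm_ge0.
  have w0 : 0 < 2 `^ (k%:R * (al - d%:R)) :> R by exact: powRe_gt0.
  pose c : R := t * C * decay R ^+ gap k n / 2 `^ (k%:R * (al - d%:R)).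
  have c0 : 0 <= c by rewrite !mulr_ge0 ?invr_ge0 ?exprn_ge0 ?(ltW w0) ?(ltW C0) ?(ltW de0).
  have h : (Lp_norm p%:E (LP_block phi0 k T) <= (c * K)%:E)%E.
    apply: le_trans (HK n c c0); apply: le_Lnorm_pointwise => // x.
      by rewrite lee_fin normc_ge0.
    by rewrite lee_fin /c mulrAC ler_pdivlMr// mulrC -[leRHS]mulrA; exact: HC.
  apply: (le_trans (lee_wpmul2l _ h)); first by rewrite lee_fin ltW.
  by rewrite -EFinM lee_fin /c le_eqVlt; apply/orP; left; apply/eqP; field; rewrite gt_eqF.
rewrite mulrA EFinM.
have CB0 : 0 <= t * (C * B) by rewrite mulrA mulr_ge0// ltW.
apply: le_trans (HK n (t * (C * B)) CB0); apply: le_Lnorm_pointwise => // x.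
  exact: Lnorm_ge0.
have -> : t * (C * B) * profile (d%:R / p) n x = t * C * profile al n x * B.
  by rewrite -/al; move: (profile al n x) => P; ring.
apply: (HB _ _ n) => [||k].
- by rewrite mulr_ge0// ltW.
- by move=> k; rewrite lee_fin mulr_ge0 ?powR_ge0 ?normc_ge0.
rewrite lee_fin; apply: le_trans (HC n k t T x t0 dT) _.
by rewrite -[leRHS]mulrA [profile _ _ _ * _]mulrC.
Qed.

Lemma scaled_ballE k (x0 : V) (rho : R) : [set x : V | `|2 ^+ k *: x - x0| < rho] =
  [set x : V | `|x - (2 ^+ k)^-1 *: x0| < rho / 2 ^+ k].
Proof.
have k0 : 0 < 2 ^+ k :> R by rewrite exprn_gt0.
have E x : 2 ^+ k *: x - x0 = 2 ^+ k *: (x - (2 ^+ k)^-1 *: x0).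
  by rewrite scalerBr scalerA divff ?scale1r// gt_eqF.
apply/seteqP; split => x /=;
  by rewrite E (normrZ (2 ^+ k) (x - _)) (gtr0_norm k0) ltr_pdivlMr// mulrC.
Qed.

Lemma measurable_scaled_ball k (x0 : V) (rho : R) :
  measurable [set x : V | `|2 ^+ k *: x - x0| < rho].
Proof. by rewrite scaled_ballE; exact: measurable_norm_ball. Qed.

Lemma lebesgue_scaled_ball k (x0 : V) (rho : R) : 0 < rho ->
  mu [set x : V | `|2 ^+ k *: x - x0| < rho] = ((2 * rho / 2 ^+ k) ^+ d)%:E.
Proof.
by move=> r0; rewrite scaled_ballE [LHS]lebesgue_rV_ball ?divr_gt0 ?exprn_gt0// mulrA.
Qed.

Lemma integral_scaled_ball k (x0 : V) (rho c : R) : 0 < rho -> 0 <= c ->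
  (\int[mu]_x (c * \1_[set x : V | (`|2 ^+ k *: x - x0| < rho)%R] x)%:E =
   (c * (2 * rho / 2 ^+ k) ^+ d)%:E)%E.
Proof.
move=> r0 c0; have mB := measurable_scaled_ball k x0 rho.
under eq_integral do rewrite EFinM.
rewrite ge0_integralZl_EFin//; last by apply/measurable_EFinP; exact: measurable_indic.
by rewrite integral_indic// setIT EFinM; congr (_ * _)%E; exact: lebesgue_scaled_ball.
Qed.

(** The ball where the block [k] is large has measure of order [2^(- k d)].
With the exponent [al - d], the weight, the size [2^(k d)] and the [p]-th root of
this measure multiply to a constant. *)
Lemma besov_lower_bound (phi0 : V -> R) q T (x0 : V) (rho c : R) n1 n2 : (0 < q)%E ->
  0 < rho -> 0 <= c -> (n1 < n2)%N ->
  (forall k x, (n1 <= k < n2)%N -> `|2 ^+ k *: x - x0| < rho ->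
     c * (2 ^+ k) ^+ d <= normc (LP_block phi0 k T x)) ->
  ((c * (2 * rho) `^ al * (n2 - n1)%:R `^ fine q^-1)%:E <=
     besov_norm_distr phi0 (al - d%:R) p q T)%E.
Proof.
move=> q0 r0 c0 n12 H; apply: counting_Lnorm_ge => //.
  by rewrite mulr_ge0 ?powR_ge0.
move=> k kn; rewrite gee0_abs; last by rewrite mule_ge0 ?lee_fin ?powR_ge0// Lnorm_ge0.
have k0 : 0 < 2 ^+ k :> R by rewrite exprn_gt0.
pose g (x : V) : \bar R := (c * (2 ^+ k) ^+ d * \1_[set x : V | `|2 ^+ k *: x - x0| < rho] x)%:E.
have g0 x : (0 <= g x)%E by rewrite lee_fin mulr_ge0 ?indicE// mulr_ge0 ?exprn_ge0 ?(ltW k0).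
have : (Lnorm mu p%:E g <= Lp_norm p%:E (LP_block phi0 k T))%E.
  apply: le_Lnorm_pointwise => // x; rewrite /g indicE.
  case: (boolP (x \in _)) => [|_]; last by rewrite mulr0 lee_fin normc_ge0.
  by rewrite inE/= mulr1 lee_fin; exact: H.
move=> h; have w0 : (0 <= (2 `^ (k%:R * (al - d%:R)))%:E :> \bar R)%E by rewrite lee_fin powR_ge0.
apply: le_trans (lee_wpmul2l w0 h).
have -> : Lnorm mu p%:E g = ((c `^ p * ((2 ^+ k) ^+ d) `^ p * (2 * rho / 2 ^+ k) ^+ d)%:E `^ p^-1)%E.
  rewrite unlock /Lnorm; congr (_ `^ _)%E.
  rewrite -(integral_scaled_ball k x0 r0) ?mulr_ge0 ?powR_ge0//.
  apply: eq_integral => x _; rewrite /g !indicE.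
  rewrite abse_EFin poweR_EFin; congr EFin.
  case: (x \in _); last by rewrite !mulr0 normr0 powR0// gt_eqF.
  by rewrite !mulr1 ger0_norm ?mulr_ge0 ?exprn_ge0 ?(ltW k0)// powRM ?exprn_ge0 ?(ltW k0).
rewrite poweR_EFin -EFinM lee_fin.
have rk0 : 0 <= 2 * rho / 2 ^+ k by rewrite !mulr_ge0 ?invr_ge0 ?(ltW k0) ?(ltW r0).
have -> : (c `^ p * ((2 ^+ k) ^+ d) `^ p * (2 * rho / 2 ^+ k) ^+ d) `^ p^-1 =
    c * (2 ^+ k) ^+ d * (2 * rho / 2 ^+ k) `^ al.
  rewrite powRM ?mulr_ge0 ?powR_ge0 ?exprn_ge0// powRM ?powR_ge0//.
  rewrite -!powRrM divff ?gt_eqF// !powRr1 ?exprn_ge0 ?(ltW k0)//.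
  by rewrite -(powR_mulrn d rk0) -powRrM -/al.
have r20 : 0 <= 2 * rho by rewrite mulr_ge0// ltW.
rewrite [X in _ <= _ * (_ * X)]powRM ?invr_ge0 ?(ltW k0)//.
rewrite -exprM -!powR2_nat -powRN -powRrM natrM.
have E : 2 `^ (k%:R * (al - d%:R)) * (2 `^ (k%:R * d%:R) * 2 `^ (- k%:R * al)) = 1 :> R.
  by rewrite -!powR2D -[RHS](powRr0 (2:R)); congr (_ `^ _); ring.
by rewrite le_eqVlt; apply/orP; left; apply/eqP; rewrite -[LHS]mul1r -[X in X * _]E; ring.
Qed.

(** At a point of the [k]-th ball the sequence norm is at least its [k]-th term.
As the balls are disjoint, the [p]-th powers of these terms can be summed, and each
summand has the same integral. *)
Lemma triebel_lizorkin_lower_bound (phi0 : V -> R) q T (x0 : V) (rho c : R) n1 n2 : (0 < q)%E ->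
  0 < rho -> 0 <= c -> (n1 < n2)%N ->
  (forall k l x, (n1 <= k < n2)%N -> (n1 <= l < n2)%N ->
     `|2 ^+ k *: x - x0| < rho -> `|2 ^+ l *: x - x0| < rho -> k = l) ->
  (forall k x, (n1 <= k < n2)%N -> `|2 ^+ k *: x - x0| < rho ->
     c * (2 ^+ k) ^+ d <= normc (LP_block phi0 k T x)) ->
  ((c * (2 * rho) `^ al * (n2 - n1)%:R `^ p^-1)%:E <=
     triebel_lizorkin_norm_distr phi0 (al - d%:R) p q T)%E.
Proof.
move=> q0 r0 c0 n12 disj H.
pose E k : set V := [set x : V | `|2 ^+ k *: x - x0| < rho].
pose a k : R := c * 2 `^ (k%:R * al).
have a0 k : 0 <= a k by rewrite mulr_ge0 ?powR_ge0.
pose F (x : V) := Lnorm counting q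
  (fun k => (2 `^ (k%:R * (al - d%:R)) * normc (LP_block phi0 k T x))%:E).
have F0 x : (0 <= F x)%E by exact: Lnorm_ge0.
have h1 k x : (n1 <= k < n2)%N -> E k x -> ((a k)%:E <= F x)%E.
  move=> kn kx; have := @counting_Lnorm_ge R q
    (fun k => (2 `^ (k%:R * (al - d%:R)) * normc (LP_block phi0 k T x))%:E) k k.+1 (a k) q0 (ltnSn k) (a0 k).
  rewrite subSnn powR1 mulr1; apply => j; rewrite ltnS -eqn_leq => /eqP <-.
  rewrite lee_fin ger0_norm ?mulr_ge0 ?powR_ge0 ?normc_ge0//.
  apply: le_trans (ler_wpM2l (powR_ge0 _ _) (H k x kn kx)).
  rewrite -exprM -powR2_nat natrM mulrCA -powR2D ler_wpM2l//.
  by apply: powR2_le; rewrite le_eqVlt; apply/orP; left; apply/eqP; ring.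
have h2 x : (\sum_(n1 <= k < n2) (a k `^ p * \1_(E k) x)%:E <= F x `^ p)%E.
  have [[k [kn kx]]|nk] := pselect (exists k, (n1 <= k < n2)%N /\ E k x); last first.
    rewrite big_nat big1 ?poweR_ge0// => k kn; rewrite indicE memNset ?mulr0// => kx.
    by apply: nk; exists k.
  apply: (@le_trans _ _ ((a k)%:E `^ p)%E); last by apply: le_poweR; rewrite ?(ltW p0) ?lee_fin//; exact: h1.
  rewrite poweR_EFin (bigD1_seq k) ?mem_index_iota ?iota_uniq//=.
  have -> : a k `^ p * \1_(E k) x = a k `^ p by rewrite indicE (mem_set kx) mulr1.
  rewrite [X in (_ + X)%E]big1_seq; first by rewrite adde0.
  move=> j /andP[jk]; rewrite mem_index_iota => jn; rewrite indicE memNset ?mulr0// => jx; move: jk.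
  by rewrite (disj j k x jn kn jx kx) eqxx.
rewrite /triebel_lizorkin_norm_distr -/F unlock /Lnorm.
have -> : ((c * (2 * rho) `^ al * (n2 - n1)%:R `^ p^-1)%:E =
   (\sum_(n1 <= k < n2) c `^ p * (2 * rho) ^+ d)%:E `^ p^-1)%E.
  rewrite poweR_EFin big_const_nat iter_addr_0 -[(c `^ p * _) *+ _]mulr_natr.
  have r20 : 0 <= 2 * rho by rewrite mulr_ge0// ltW.
  rewrite [in RHS]powRM ?mulr_ge0 ?powR_ge0 ?exprn_ge0// [in RHS]powRM ?powR_ge0 ?exprn_ge0//.
  by rewrite -(powR_mulrn d r20) -!powRrM divff ?gt_eqF// powRr1.
apply: le_poweR; first by rewrite invr_ge0 ltW.
  by rewrite lee_fin sumr_ge0// => k _; rewrite mulr_ge0 ?powR_ge0 ?exprn_ge0 ?mulr_ge0 ?(ltW r0).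
have -> : ((\sum_(n1 <= k < n2) c `^ p * (2 * rho) ^+ d)%:E =
  \int[mu]_x (\sum_(n1 <= k < n2) (a k `^ p * \1_(E k) x)%:E))%E.
  rewrite ge0_integral_sum//; last 2 first.
  - move=> k; apply/measurable_EFinP; apply: measurable_funM => //.
    by apply: measurable_indic; exact: measurable_scaled_ball.
  - by move=> k x _; rewrite lee_fin mulr_ge0 ?powR_ge0// indicE.
  rewrite -sumEFin; apply: eq_bigr => k _.
  rewrite integral_scaled_ball ?powR_ge0//; congr EFin.
  have alp : k%:R * al * p = (k * d)%N%:R by rewrite -mulrA divfK ?gt_eqF// natrM.
  rewrite /a powRM ?powR_ge0// -powRrM alp powR2_nat -mulrA; congr (_ * _).
  by rewrite exprM -exprMn mulrCA divff ?mulr1// gt_eqF.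
apply: le_integral_pointwise => x; last by rewrite gee0_abs.
by apply: sume_ge0 => k _; rewrite lee_fin mulr_ge0 ?powR_ge0// indicE.
Qed.

End function_space_norms.

(** * Blocks of the dilated unit cell *)

Section cell_blocks.
Variables (R : realType) (d : nat).
Hypothesis d0 : (0 < d)%N.
Local Open Scope complex_scope.
Local Notation V := 'rV[R]_d.
Local Notation mu := (lebesgue_rV R d).
Local Notation normc := (@Normc.normc R).
Implicit Types (f psi : V -> R) (x y X : V) (k n : nat) (t th : R).

Definition cell_set : set V := [set x | forall i, 0 <= x ord0 i < 1].

Definition cell : V -> R := \1_cell_set.

Lemma measurable_cell_set : measurable cell_set.
Proof.
apply: (measurable_rV_box (A := fun=> [set s | 0 <= s < 1])) => i.
rewrite (_ : mkset _ = `[0, 1[%classic); first exact: measurable_itv.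
by apply/seteqP; split => s /=; rewrite in_itv.
Qed.

Lemma cell_norm y : cell y != 0 -> `|y| <= 1.
Proof.
rewrite /cell indicE; case: (boolP (y \in _)) => [|_]; last by rewrite eqxx.
rewrite inE => yQ _; apply: norm_rV_le => // i.
by have /andP[h1 h2] := yQ i; rewrite ger0_norm// ltW.
Qed.

Lemma cell_ge0 y : 0 <= cell y.
Proof. by rewrite /cell indicE. Qed.

Lemma bcs_cell : bcs cell.
Proof.
split; first by apply: measurable_indic; exact: measurable_cell_set.
exists 1 => // y; split; first by rewrite /cell indicE; case: (_ \in _); rewrite ?normr1 ?normr0.
by move=> y1; apply/eqP; apply: contraTT y1 => /cell_norm; rewrite leNgt.
Qed.

Lemma Rintegral_cell : \int[mu]_y cell y = 1.
Proof.
rewrite /Rintegral /cell integral_indic//; last exact: measurable_cell_set.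
rewrite setIT; have := @lebesgue_rV_box R d (fun=> `[0, 1[%classic) (fun=> measurable_itv _).
rewrite big1 => [|i _]; last by rewrite lebesgue_measure_itv/= lte01 oppr0 adde0.
move=> h; rewrite -[RHS](congr1 fine h); congr (fine (mu _)).
Qed.

(** The sign [e] treats positive and negative values at once. *)
Lemma continuous_nonzero_near (g : V -> R) a : continuous g -> g a != 0 ->
  exists (e r : R), [/\ `|e| = 1, 0 < r & exists2 b : R, 0 < b & forall x, `|x - a| < r -> b <= e * g x].
Proof.
move=> cg ga; have [h|h|h] := ltgtP (g a) 0; last by rewrite h eqxx in ga.
  have cg' : continuous (fun x => -1 * g x).
    by move=> x; apply: (@continuousM _ _ (cst (-1)) g); [exact: cst_continuous|exact: cg].
  have [|r r0 Hr] := continuous_lower_bound (a := a) cg'; first by rewrite mulN1r oppr_gt0.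
  exists (-1), r; split; rewrite ?normrN1//; exists (-1 * g a / 2) => //.
  by rewrite mulN1r divr_gt0// oppr_gt0.
have [r r0 Hr] := continuous_lower_bound cg h.
exists 1, r; split; rewrite ?normr1//; exists (g a / 2); first by rewrite divr_gt0.
by move=> x xr; rewrite mul1r; exact: Hr.
Qed.

(** The cell is nonnegative with integral 1, so the convolution is an average of
values of one sign. *)
Lemma conv_cell_lower_bound th psi (e b l : R) X : bcs psi -> `|e| = 1 ->
  (forall y, cell y != 0 -> b <= e * osc th psi (l *: (X - y))) ->
  b <= `|conv cell th psi l X|.
Proof.
move=> bp e1 H; have bc := bcs_conv th l X bcs_cell bp.
apply: (@le_trans _ _ (e * conv cell th psi l X)); last first.
  by apply: le_trans (ler_norm _) _; rewrite normrM e1 mul1r.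
rewrite -subr_ge0 /conv -(bcs_RintegralZ e bc).
have -> : b = \int[mu]_y (b * cell y) by rewrite (bcs_RintegralZ b bcs_cell) Rintegral_cell mulr1.
rewrite -(bcs_RintegralB (bcsZ e bc) (bcsZ b bcs_cell)); apply: Rintegral_ge0 => y _.
rewrite mulrCA [b * _]mulrC -mulrBr.
have [->|cy] := eqVneq (cell y) 0; first by rewrite mul0r.
by rewrite mulr_ge0 ?cell_ge0// subr_ge0 H.
Qed.

(** On the diagonal choose [z] with [|z| < 1] and [4 |z| > 2].  The symbol is
[phi0 z - phi0 (2 z)] at [z] and [phi0 (2 z) - phi0 (4 z)] at [2 z]; as [phi0 z = 1] and
[phi0 (4 z) = 0], these two values cannot both vanish. *)
Lemma base_symbol1_neq0 (phi0 : V -> R) : LP_generator phi0 -> exists a, base_symbol phi0 1 a != 0.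
Proof.
move=> [_ p1 p2]; pose z : V := const_mx 1.
have dz (l : R) : 0 <= l -> euclid_norm (l *: z) = l * Num.sqrt d%:R.
  move=> l0; rewrite /euclid_norm.
  have -> : dotv (l *: z) (l *: z) = l ^+ 2 * d%:R.
    rewrite /dotv (eq_bigr (fun=> l ^+ 2)) => [|i _]; last by rewrite !mxE mulr1 expr2.
    by rewrite sumr_const card_ord mulr_natr.
  by rewrite sqrtrM ?sqr_ge0// sqrtr_sqr ger0_norm.
have s0 : 0 < Num.sqrt d%:R :> R by rewrite sqrtr_gt0 ltr0n.
(* the points l z, 2 l z and 4 l z have euclidean norms 3/4, 3/2 and 3 *)
pose l : R := 3 / 4 / Num.sqrt d%:R.
have l0 : 0 < l by rewrite divr_gt0.
have E1 : phi0 (l *: z) = 1.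
  by apply: p1; rewrite dz ?ltW// /l divfK ?gt_eqF//; lra.
have E2 : phi0 (2 *: (2 *: (l *: z))) = 0.
  apply: p2; rewrite !scalerA dz ?mulr_ge0 ?(ltW l0)// -mulrA.
  by rewrite /l -mulrA divfK ?gt_eqF//; lra.
have [h|h] := eqVneq (base_symbol phi0 1 (l *: z)) 0; last by exists (l *: z).
exists (2 *: (l *: z)); rewrite /= E2 subr0.
by move/eqP: h; rewrite /= E1 subr_eq0 => /eqP <-; rewrite oner_eq0.
Qed.

(** The center [x0] is moved off the origin, since the dilates of a ball around
[x0] are disjoint only if the ball is small compared to [|x0|]. *)
Lemma osc_base_symbol_lower_bound (phi0 : V -> R) : LP_generator phi0 ->
  exists th (x0 : V) (e b rho : R), [/\ `|e| = 1, 0 < b, 0 < rho, 3 * rho <= `|x0| &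
    forall x, `|x - x0| < 2 * rho -> b <= e * osc th (base_symbol phi0 1) x].
Proof.
move=> gp; have sp := smoothc_base_symbol 1 gp; have bp := smoothc_bcs sp.
have [a pa] := base_symbol1_neq0 gp.
have [th [x1 ox]] := osc_neq0 d0 (smoothc_continuous sp) bp pa.
have [e [r [e1 r0 [b b0 Hb]]]] := continuous_nonzero_near (osc_continuous bp) ox.
(* a point different from 0, also if the nonzero value is taken at 0 *)
pose x0 : V := if x1 == 0 then const_mx (r / 2) else x1.
have x00 : 0 < `|x0|.
  rewrite normr_gt0 /x0; have [_|//] := eqVneq x1 0.
  apply/eqP => /rowP /(_ (Ordinal d0)); rewrite !mxE => /eqP.
  by rewrite gt_eqF// divr_gt0.
have x01 : `|x0 - x1| <= r / 2.
  rewrite /x0; have [->|_] := eqVneq x1 0; last by rewrite subrr normr0 divr_ge0// ltW.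
  rewrite subr0; apply: norm_rV_le => [|i]; first by rewrite divr_ge0// ltW.
  by rewrite mxE ger0_norm// divr_ge0// ltW.
exists th, x0, e, b, (Num.min (r / 4) (`|x0| / 3)); split => //.
- by rewrite lt_min !divr_gt0.
- by rewrite mulrC -ler_pdivlMr// ge_min lexx orbT.
move=> x xr; apply: Hb; rewrite -(subrKA x0).
apply: le_lt_trans (ler_normD _ _) _; rewrite [ltRHS](splitr r); apply: ltr_leD => //.
apply: lt_le_trans xr _; rewrite mulrC -ler_pdivlMr// ge_min; apply/orP; left.
by rewrite -mulrA -invfM -natrM.
Qed.

(** If [2^k / 2^n] is smaller than [rho], the kernel at [2^k x - (2^k / 2^n) y]
is evaluated close to [x0] for all [y] in the cell, where it has one sign.  [J] is
chosen to ensure this. *)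
Lemma block_cell_high (phi0 : V -> R) : LP_generator phi0 ->
  exists (x0 : V) (rho c : R) (J : nat), [/\ 0 < rho, 3 * rho <= `|x0|, 0 < c &
    forall n k t T x, 0 <= t -> (0 < k)%N -> (k + J <= n)%N ->
      distribution_of (fun y => (dilate n (fun z => t * cell z) y)%:C) T ->
      `|2 ^+ k *: x - x0| < rho ->
      t * c * (2 ^+ k) ^+ d <= normc (LP_block phi0 k T x)].
Proof.
move=> gp; have [th [x0 [e [b [rho [e1 b0 r0 rx H]]]]]] := osc_base_symbol_lower_bound gp.
have c0 := @fourier_cst_gt0 R d.
(* J satisfies 2^(- J) <= rho *)
exists x0, rho, (fourier_cst R d * b / 2), (Num.bound rho^-1); split => //.
  by rewrite divr_gt0// mulr_gt0.
move=> n k t T x t0 k0 kJ dT xr.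
have bp := smoothc_bcs (smoothc_base_symbol 1 gp).
have k20 : 0 < 2 ^+ k :> R by rewrite exprn_gt0.
have n20 : 0 < 2 ^+ n :> R by rewrite exprn_gt0.
rewrite (LP_block_dilate k x gp (bcsZ t bcs_cell) dT).
have -> : base_symbol phi0 k = base_symbol phi0 1 by case: (k) k0.
have cc0 : 0 <= fourier_cst R d * (2 ^+ k) ^+ d.
  by apply: mulr_ge0; [exact: ltW|rewrite exprn_ge0// ltW].
have := normc_ge_conv th (2 ^+ k / 2 ^+ n) (2 ^+ n *: x) cc0 (bcsZ t bcs_cell) bp.
rewrite (convZ t _ _ _ bcs_cell bp) normrM (ger0_norm t0) => h.
rewrite -(ler_pM2l (ltr0n R 2)); apply: le_trans h.
have h1 : b <= `|conv cell th (base_symbol phi0 1) (2 ^+ k / 2 ^+ n) (2 ^+ n *: x)|.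
  apply: (conv_cell_lower_bound bp e1) => y cy; apply: H.
  rewrite scalerBr scalerA divfK ?gt_eqF//.
  rewrite addrAC; apply: le_lt_trans (ler_normB _ _) _.
  rewrite mulrDl mul1r; apply: ltr_leD => //.
  rewrite normrZ gtr0_norm ?divr_gt0//.
  apply: (@le_trans _ _ (2 ^+ k / 2 ^+ n)).
    by rewrite ler_piMr ?divr_ge0 ?(ltW k20) ?(ltW n20)// cell_norm.
  rewrite ler_pdivrMr// -(subnKC kJ) !exprD.
  apply: (@le_trans _ _ (2 ^+ k * (rho * 2 ^+ Num.bound rho^-1))).
    rewrite ler_pMr// -ler_pdivrMl// mulr1.
    apply: le_trans (ltW (archi_boundP _)) _; first by rewrite invr_ge0 ltW.
    by rewrite -natrX ler_nat ltnW// ltn_expl.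
  rewrite mulrCA -mulrA ler_pM2l//; apply: ler_wpM2l; first exact: ltW.
  by rewrite ler_peMr ?exprn_ge0// exprn_ege1// ler1n.
have -> : 2 * (t * (fourier_cst R d * b / 2) * (2 ^+ k) ^+ d) =
    fourier_cst R d * (2 ^+ k) ^+ d * (t * b) by field.
by apply: ler_wpM2l => //; exact: ler_wpM2l.
Qed.

Lemma conv_continuous f th psi : bcs f -> bcs psi -> continuous (conv f th psi 1).
Proof.
move=> bf bp X; set K := d%:R * \int[mu]_xi `|psi xi * `|xi| | * \int[mu]_y `|f y|.
have K0 : 0 <= K by rewrite !mulr_ge0// Rintegral_ge0.
have lip X' : `|conv f th psi 1 X - conv f th psi 1 X'| <= K * `|X - X'|.
  rewrite /conv -(bcs_RintegralB (bcs_conv _ _ _ bf bp) (bcs_conv _ _ _ bf bp)).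
  rewrite /K mulrAC -(bcs_RintegralZ _ (bcs_norm bf)).
  apply: le_norm_Rintegral; [|exact: (bcsZ _ (bcs_norm bf))|].
    by apply: bcsB; exact: bcs_conv.
  move=> y; rewrite -mulrBr normrM mulrC ler_wpM2r//.
  apply: le_trans (osc_lip th _ _ bp) _; rewrite !scale1r opprB addrA subrK.
  by rewrite mulrAC.
apply/(@cvgrPdist_le _ _ _ (nbhs (X : V))) => e e0.
near=> X'; apply: le_trans (lip X') _.
apply: (@le_trans _ _ ((K + 1) * `|X - X'|)); first by rewrite ler_wpM2r// lerDl.
rewrite mulrC -ler_pdivlMr ?ltr_wpDl//.
near: X'.
have e1 : 0 < e / (K + 1) by rewrite divr_gt0// ltr_wpDl.
apply/nbhs_ballP; exists (e / (K + 1)) => //= X'; rewrite -ball_normE/=; exact: ltW.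
Unshelve. all: by end_near.
Qed.

(** At scale 0 the kernel is not slowly varying on the cell, so that the argument
of [block_cell_high] fails; [conv_neq0] takes its place, with the symbol [phi0]
that is positive at 0. *)
Lemma block_cell_low (phi0 : V -> R) : LP_generator phi0 ->
  exists (x0 : V) (rho c : R), [/\ 0 < rho, 0 < c &
    forall t T x, 0 <= t ->
      distribution_of (fun y => (dilate 0 (fun z => t * cell z) y)%:C) T ->
      `|2 ^+ 0 *: x - x0| < rho ->
      t * c * (2 ^+ 0) ^+ d <= normc (LP_block phi0 0 T x)].
Proof.
move=> gp; have sp := smoothc_base_symbol 0 gp; have bp := smoothc_bcs sp.
have p00 : 0 < base_symbol phi0 0 0.
  have [_ p1 _] := gp; rewrite /= p1 ?ltr01//.
  by rewrite /euclid_norm dotv0l sqrtr0.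
have [|th [x0 hx]] := conv_neq0 d0 bcs_cell cell_ge0 _ (smoothc_continuous sp) bp p00.
  by rewrite Rintegral_cell.
have [e [r [e1 r0 [b b0 Hb]]]] := continuous_nonzero_near (conv_continuous bcs_cell bp) hx.
have c0 := @fourier_cst_gt0 R d.
exists x0, r, (fourier_cst R d * b / 2); split => //; first by rewrite divr_gt0// mulr_gt0.
move=> t T x t0 dT xr.
rewrite (LP_block_dilate 0 x gp (bcsZ t bcs_cell) dT).
have cc0 : 0 <= fourier_cst R d * (2 ^+ 0) ^+ d by rewrite expr0 expr1n mulr1 ltW.
have := normc_ge_conv th (2 ^+ 0 / 2 ^+ 0) (2 ^+ 0 *: x) cc0 (bcsZ t bcs_cell) bp.
rewrite (convZ t _ _ _ bcs_cell bp) normrM (ger0_norm t0) => h.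
rewrite -(ler_pM2l (ltr0n R 2)); apply: le_trans h.
have -> : 2 * (t * (fourier_cst R d * b / 2) * (2 ^+ 0) ^+ d) =
    fourier_cst R d * (2 ^+ 0) ^+ d * (t * b) by field.
apply: ler_wpM2l => //; apply: ler_wpM2l => //.
rewrite expr0 divr1; apply: le_trans (Hb _ xr) _; rewrite expr0.
by apply: le_trans (ler_norm _) _; rewrite normrM e1 mul1r.
Qed.

End cell_blocks.

(** * Haar functions at the corner of the unit cube *)

Section haar_projections.
Variables (R : realType) (d : nat).
Hypothesis d0 : (0 < d)%N.
Local Open Scope complex_scope.
Local Notation V := 'rV[R]_d.
Local Notation mu := (lebesgue_rV R d).
Local Notation normc := (@Normc.normc R).
Implicit Types (u : V -> R) (x : V) (k n : nat) (s : R) (e : {ffun 'I_d -> bool}).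

Local Notation eps0 := ([ffun=> false] : {ffun 'I_d -> bool}).

Lemma haar1E (b : bool) s : haar1 b s =
  (if (0 <= s < 1) then (if b && (2^-1 <= s) then -1 else 1) else 0).
Proof.
have E (a c : R) : (\1_`[a, c[%classic s : R) = ((a <= s) && (s < c))%:R.
  rewrite indicE; have -> : (s \in `[a, c[%classic) = ((a <= s) && (s < c)) => //.
  by apply/idP/idP; rewrite inE /= in_itv.
have h0 : 0 < 2^-1 :> R by rewrite invr_gt0.
have h1 : 2^-1 < 1 :> R by rewrite invf_lt1// ltr1n.
rewrite /haar1 !E; case: b => /=; last by case: ifP.
have [a1|a1] := leP 2^-1 s.
  rewrite (le_trans (ltW h0) a1) /=; have [a2|a2] := ltP s 1.
    by rewrite sub0r.
  by rewrite subr0.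
by rewrite /= (lt_trans a1 h1) andbT subr0; case: ifP.
Qed.

(** The Haar functions whose supports have the origin as their lower corner. *)
Definition haar0 (ek : {ffun 'I_d -> bool} * nat) : V -> R := haar ek.1 ek.2 (fun=> 0).

Lemma haar0E e k x : haar0 (e, k) x = \prod_(i < d) haar1 (e i) (2 ^+ k * x ord0 i).
Proof. by apply: eq_bigr => i _; rewrite subr0. Qed.

Lemma cellE x : cell x = \prod_(i < d) haar1 false (x ord0 i).
Proof.
rewrite /cell indicE; have [|h] := boolP (x \in _).
  by rewrite inE => h; rewrite big1// => i _; rewrite haar1E h.
have /existsP[i hi] : [exists i, ~~ (0 <= x ord0 i < 1)].
  rewrite -negb_forall; apply: contra h => /forallP h; rewrite inE => i; exact: h.
by rewrite (bigD1 i)// haar1E (negbTE hi) [RHS]mul0r.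
Qed.

Lemma norm_haar0 e k x : `|haar0 (e, k) x| = cell (2 ^+ k *: x).
Proof.
rewrite haar0E cellE normr_prod; apply: eq_bigr => i _.
by rewrite !haar1E mxE /=; case: ifP => _; rewrite ?normr0//; case: ifP; rewrite ?normrN1 ?normr1.
Qed.

Lemma haar0_scaling k x : haar0 (eps0, k) x = cell (2 ^+ k *: x).
Proof. by rewrite haar0E cellE; apply: eq_bigr => i _; rewrite ffunE mxE. Qed.

Lemma haar1_sum s : haar1 false s + haar1 true s = 2 * haar1 false (2 * s).
Proof.
have E : (0 <= 2 * s < 1) = ((0 <= s < 1) && (s < 2^-1)).
  rewrite pmulr_rge0// -ltr_pdivlMl// mulr1; have [a1|a1] := leP 0 s => //=.
  apply/idP/idP => [a2|/andP[]//]; rewrite a2 andbT (lt_trans a2)// invf_lt1// ltr1n//.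
rewrite !haar1E E; case: ifP => _ /=; last by rewrite addr0 mulr0.
by case: (ltP s 2^-1) => _; lra.
Qed.

(** Expanding [\prod_i (h^(0) + h^(1)) (2^k x_i)] over the subsets of coordinates,
with [h^(0) + h^(1) = 2 h^(0) (2 .)]. *)
Lemma haar0_sum k x : \sum_e haar0 (e, k) x = 2 ^+ d * cell (2 ^+ k.+1 *: x).
Proof.
under eq_bigr do rewrite haar0E.
rewrite -(bigA_distr_bigA (fun i b => haar1 b (2 ^+ k * x ord0 i))) cellE.
rewrite -[2 ^+ d](_ : \prod_(i < d) 2 = _); last by rewrite prodr_const card_ord.
rewrite -big_split/=; apply: eq_bigr => i _.
by rewrite big_bool/= addrC haar1_sum mxE mulrA -exprS.
Qed.

(** By [haar0_sum], the sum over one level is the difference of two consecutive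
dilates of the cell. *)
Lemma haar_telescope n x : haar0 (eps0, 0%N) x +
  \sum_(k < n) \sum_(e | e != eps0) (2 ^+ k) ^+ d * haar0 (e, k : nat) x = dilate n (@cell R d) x.
Proof.
have H k : \sum_(e | e != eps0) (2 ^+ k) ^+ d * haar0 (e, k) x = dilate k.+1 (@cell R d) x - dilate k (@cell R d) x.
  rewrite -mulr_sumr; have := haar0_sum k x; rewrite (bigD1 eps0)//= haar0_scaling => h.
  by rewrite -[\sum_(_ | _) _](addKr (cell (2 ^+ k *: x))) h /dilate exprS exprMn; ring.
rewrite haar0_scaling; elim: n => [|n IH].
  by rewrite big_ord0 addr0 /dilate expr0 expr1n mul1r.
by rewrite big_ord_recr/= addrA IH H addrC subrK.
Qed.

Lemma haar0_scale k k' e e' : haar0 (e, k) = haar0 (e', k') -> (k <= k')%N.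
Proof.
move=> h; rewrite leqNgt; apply/negP => kk.
pose x : V := const_mx (2 ^- k).
have : cell (2 ^+ k *: x) = cell (2 ^+ k' *: x) by rewrite -(norm_haar0 e k) h norm_haar0.
rewrite !cellE (bigD1 (Ordinal d0))// !mxE haar1E divff ?gt_eqF ?exprn_gt0//.
rewrite ltxx andbF [LHS]mul0r big1 => [/eqP|i _]; first by rewrite eq_sym oner_eq0.
rewrite !mxE haar1E divr_ge0 ?exprn_ge0//= ltr_pdivrMr ?exprn_gt0// mul1r.
by rewrite ltr_eXn2l ?ltr1n// kk.
Qed.

(** The support determines [k], and the sign at a point of the [i]-th axis
determines [e i].  Injectivity matters since the projection sums over a set of
functions, not over their indices. *)
Lemma haar0_inj : injective haar0.
Proof.
move=> [e k] [e' k'] h.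
have kE : k = k' by apply/eqP; rewrite eqn_leq (haar0_scale h) (haar0_scale (esym h)).
rewrite -kE in h *; congr (_, _); apply/ffunP => i.
(* h^(0) and h^(1) agree at 0 and have opposite signs at 1/2 *)
pose x : V := \row_j (if j == i then 2 ^- k * (2^-1) else 0).
have xE j : haar0 (j, k) x = if j i then -1 else 1.
  rewrite haar0E (bigD1 i)//= big1 ?mulr1 => [|l li].
    rewrite mxE eqxx mulrA divff ?mul1r ?gt_eqF ?exprn_gt0// haar1E lexx andbT.
    by rewrite invr_ge0 ler0n invf_lt1// ltr1n.
  rewrite mxE (negbTE li) mulr0 haar1E lexx ltr01/=.
  by rewrite leNgt invr_gt0 ltr0n andbF.
have := congr1 (fun g => g x) h; rewrite !xE.
by case: (e i); case: (e' i) => // h11; exfalso; move: h11; lra.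
Qed.

Definition haar_indices n : seq ({ffun 'I_d -> bool} * nat) :=
  (eps0, 0%N) :: [seq (e, k) | k <- iota 0 n, e <- enum (predC1 eps0)].

Definition haar_family n : {fset (V -> R)} :=
  seq_fset tt (map haar0 (haar_indices n)).

Lemma haar_indices_uniq n : uniq (haar_indices n).
Proof.
rewrite /=; apply/andP; split.
  apply/negP => /allpairsPdep[k [e [_ + [e0 _]]]].
  by rewrite mem_enum inE -e0 eqxx.
apply: allpairs_uniq; rewrite ?iota_uniq ?enum_uniq//.
by move=> [k e] [k' e'] _ _ /= [-> ->].
Qed.

Lemma size_haar_indices n : size (haar_indices n) = (n * (2 ^ d - 1)).+1.
Proof.
rewrite /= size_allpairs size_iota -cardE.
by have := cardC1 eps0; rewrite card_ffun card_bool card_ord subn1 => ->.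
Qed.

Lemma perm_haar_family n : perm_eq (haar_family n) (map haar0 (haar_indices n)).
Proof.
apply: uniq_perm; first exact: fset_uniq.
  by rewrite (map_inj_uniq haar0_inj) haar_indices_uniq.
exact: seq_fsetE.
Qed.

Lemma card_haar_family n N : (n <= N)%N -> (0 < N)%N -> (#|` haar_family n| <= 2 ^ d * N)%N.
Proof.
move=> nN N0; rewrite (perm_size (perm_haar_family n)) size_map size_haar_indices.
have d2 : (0 < 2 ^ d)%N by rewrite expn_gt0.
apply: (@leq_trans (N * (2 ^ d - 1)).+1); first by rewrite ltnS leq_mul2r nN orbT.
have <- : (N * (2 ^ d - 1) + N = 2 ^ d * N)%N.
  by rewrite mulnBr muln1 subnK; [exact: mulnC|exact: leq_pmulr].
by rewrite -addn1 leq_add2l.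
Qed.

Lemma mem_haar_family n u : u \in haar_family n ->
  exists e k, [/\ u = haar0 (e, k), (k <= n)%N & e = eps0 -> k = 0%N].
Proof.
rewrite seq_fsetE => /mapP[[e k]]; rewrite inE => /orP[/eqP[-> ->] ->|].
  by exists eps0, 0%N.
move=> /allpairsPdep[k' [e' [+ + [-> ->]]]] ->.
rewrite mem_iota mem_enum inE /= add0n => kn en; exists e', k'; split => //; first exact: ltnW.
by move=> h; rewrite h eqxx in en.
Qed.

Lemma haar_family_sub n : [set` haar_family n] `<=` @haar_system R d.
Proof.
move=> u /mem_haar_family[e [k [-> _ ek]]].
have [e0|e0] := eqVneq e eps0; last by right; exists e, k, (fun=> 0).
by left; exists (fun=> 0); rewrite /haar0 (ek e0) e0.
Qed.

Lemma closed_unit_cube : closed (@unit_cube R d).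
Proof.
rewrite (_ : @unit_cube R d = \bigcap_(i in [set: 'I_d]) ((fun x : V => x ord0 i) @^-1` `[0, 1]%classic)).
  apply: closed_bigI => i _; apply: closed_comp; last exact: interval_closed.
  by move=> x _; exact: coord_continuous.
by apply/seteqP; split => x /= h i; [move=> _|]; have := h i; rewrite /= in_itv/=; [exact|exact].
Qed.

Lemma supp_haar_family n u : u \in haar_family n -> supp u `<=` @unit_cube R d.
Proof.
move=> /mem_haar_family[e [k [-> _ _]]].
rewrite /supp [X in _ `<=` X](closure_id _).1; last exact: closed_unit_cube.
apply: closure_subset => x /=; rewrite -normr_eq0 norm_haar0 => cx i.
have : (2 ^+ k *: x) \in (@cell_set R d).
  by apply: contraNT cx => h; rewrite /cell indicE (negbTE h).
rewrite inE => /(_ i); rewrite mxE => /andP[h1 h2].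
have k0 : 0 < 2 ^+ k :> R by rewrite exprn_gt0.
rewrite -(pmulr_rge0 _ k0) h1 -(ler_pM2l k0) mulr1 (le_trans (ltW h2))//.
by rewrite exprn_ege1// ler1n.
Qed.

Lemma haar0_norm e k : (fine (Lnorm mu 2%:E (EFin \o haar0 (e, k)))) ^- 2 = (2 ^+ k) ^+ d.
Proof.
have k0 : 0 < 2 ^+ k :> R by rewrite exprn_gt0.
have -> : Lnorm mu 2%:E (EFin \o haar0 (e, k)) = (((2 ^+ k) ^- d) `^ 2^-1)%:E.
  rewrite -poweR_EFin unlock /Lnorm; congr (_ `^ _)%E.
  rewrite (_ : (\int[mu]_x _)%E = \int[mu]_x (cell (2 ^+ k *: x + 0))%:E)%E; last first.
    apply: eq_integral => x _; rewrite abse_EFin norm_haar0 poweR_EFin addr0; congr EFin.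
    by rewrite /cell indicE; case: (_ \in _); rewrite ?powR1// powR0// pnatr_eq0.
  have bc := bcs_affine 0 k0 (bcs_cell R d).
  rewrite -[LHS]fineK; last exact: (integrable_fin_num _ (bcs_integrable bc)).
  congr EFin; have := Rintegral_affine 0 k0 (bcs_cell R d).
  rewrite Rintegral_cell => h; apply: (@mulfI _ ((2 ^+ k) ^+ d)); first by rewrite gt_eqF// exprn_gt0.
  by rewrite divff ?gt_eqF ?exprn_gt0// -h.
rewrite /= -[_ ^+ 2]powR_mulrn ?powR_ge0// -powRrM mulVf ?pnatr_eq0//.
by rewrite powRr1 ?invrK// invr_ge0 exprn_ge0 ?(ltW k0).
Qed.

End haar_projections.

(** * The projection of a pair of bumps *)

Section main_construction.
Variables (R : realType) (d : nat).
Hypothesis d0 : (0 < d)%N.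
Local Open Scope complex_scope.
Local Notation V := 'rV[R]_d.
Local Notation mu := (lebesgue_rV R d).
Local Notation normc := (@Normc.normc R).
Local Notation cell := (@cell R d).
Implicit Types (f u : V -> R) (x y : V) (k n M : nat) (t : R) (e : {ffun 'I_d -> bool}).

Variable phi0 : V -> R.
Hypothesis gp : LP_generator phi0.

(* the support of phi0 has coordinates in [-2, 2], so its translates by a and by - a
   keep the distance 1 from the coordinate hyperplanes *)
Let a : V := const_mx 3.

Definition positive_bump y : R := phi0 (1 *: y + - a) * phi0 (1 *: y + - a).
Definition negative_bump y : R := phi0 (1 *: y + a) * phi0 (1 *: y + a).
(** The two bumps have opposite signs, so the integral vanishes, but they sit in
opposite orthants, so Haar functions at the corner see only one of them. *)
Definition test_bump y : R := positive_bump y - negative_bump y.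

Lemma smoothc_positive_bump : smoothc positive_bump.
Proof.
have h := smoothc_affine (- a) ltr01 (LP_generator_smoothc gp).
exact: smoothcM h h.1.
Qed.

Lemma smoothc_negative_bump : smoothc negative_bump.
Proof.
have h := smoothc_affine a ltr01 (LP_generator_smoothc gp).
exact: smoothcM h h.1.
Qed.

Lemma smoothc_test_bump : smoothc test_bump.
Proof. exact: smoothcB smoothc_positive_bump smoothc_negative_bump. Qed.

Lemma bcs_square_generator : bcs (fun y => phi0 y * phi0 y).
Proof.
have h := LP_generator_smoothc gp; exact: smoothc_bcs (smoothcM h h.1).
Qed.

Lemma Rintegral_test_bump : \int[mu]_y test_bump y = 0.
Proof.
rewrite (bcs_RintegralB (smoothc_bcs smoothc_positive_bump) (smoothc_bcs smoothc_negative_bump)).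
have h1 := Rintegral_affine (- a) (ltr01 : 0 < 1 :> R) bcs_square_generator.
have h2 := Rintegral_affine a (ltr01 : 0 < 1 :> R) bcs_square_generator.
by apply/eqP; rewrite subr_eq0; apply/eqP; move: h1 h2; rewrite expr1n !mul1r => -> <-.
Qed.

Lemma Rintegral_positive_bump : 0 < \int[mu]_y positive_bump y.
Proof.
have cp := smoothc_continuous smoothc_positive_bump.
have bp := smoothc_bcs smoothc_positive_bump.
have pa : 0 < positive_bump a.
  have [_ p1 _] := gp; rewrite /positive_bump scale1r subrr p1 ?mulr1//.
  by rewrite /euclid_norm dotv0l sqrtr0.
have [r r0 Hr] := continuous_lower_bound cp pa.
have h : 0 < positive_bump a / 2 * (2 * r) ^+ d by rewrite mulr_gt0 ?divr_gt0// exprn_gt0// mulr_gt0.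
apply: lt_le_trans h _; have := Rintegral_ball a r0; rewrite -/mu => <-.
rewrite -(bcs_RintegralZ _ (bcs_ball a r0)) -subr_ge0.
rewrite -(bcs_RintegralB bp (bcsZ _ (bcs_ball a r0))); apply: Rintegral_ge0 => y _.
rewrite subr_ge0 indicE; case: (boolP (y \in _)) => [|_].
  by rewrite inE/= mulr1; exact: Hr.
by rewrite mulr0 /positive_bump -expr2 sqr_ge0.
Qed.

Lemma generator_support y i : phi0 y != 0 -> `|y ord0 i| <= 2.
Proof.
move=> py; apply: le_trans (norm_coord _ _) _; apply: le_trans (norm_le_euclid _) _.
by rewrite leNgt; apply: contraNN py => h; have [_ _ ->] := gp.
Qed.

(** The coordinates of the dilated bump lie in [[2^(-M), 5 2^(-M)]], and
[5 2^(k - M) < 1/2]: this is the left half of the interval in each coordinate. *)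
Lemma haar0_positive_bump e k M y : (k + 4 <= M)%N -> positive_bump (2 ^+ M *: y) != 0 ->
  haar0 (e, k) y = 1.
Proof.
move=> kM; rewrite /positive_bump mulf_eq0 negb_or => /andP[h _].
rewrite haar0E big1// => i _; have := generator_support i h.
rewrite !mxE mul1r ler_norml => /andP[h1 h2].
have yE : 2 ^+ M * y ord0 i = 2 ^+ (M - k) * (2 ^+ k * y ord0 i).
  by rewrite mulrA -exprD subnK// (leq_trans _ kM)// leq_addr.
have M16 : 16 <= 2 ^+ (M - k) :> R.
  by rewrite -[16](_ : 2 ^+ 4 = _) ?ler_eXn2l ?ltr1n// ?leq_subRL// ?(leq_trans _ kM) ?leq_addr//; ring.
rewrite yE in h1 h2; rewrite haar1E.
set z := 2 ^+ k * y ord0 i in h1 h2 *; set m := 2 ^+ (M - k) in h1 h2 M16.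
have z0 : 0 < z.
  have : 0 < m * z by move: h1; lra.
  by rewrite pmulr_rgt0// (lt_le_trans _ M16).
have z1 : z < 2^-1 by nra.
rewrite (ltW z0) (lt_trans z1)/= ?invf_lt1 ?ltr1n//.
by rewrite [2^-1 <= z]leNgt z1 andbF.
Qed.

Lemma haar0_negative_bump e k M y : negative_bump (2 ^+ M *: y) != 0 -> haar0 (e, k) y = 0.
Proof.
rewrite /negative_bump mulf_eq0 negb_or => /andP[h _].
rewrite haar0E (bigD1 (Ordinal d0))//= haar1E.
have := generator_support (Ordinal d0) h.
rewrite !mxE mul1r ler_norml => /andP[_ h2].
have M0 : 0 < 2 ^+ M :> R by rewrite exprn_gt0.
have yn : y ord0 (Ordinal d0) < 0.
  rewrite -(pmulr_rlt0 _ M0); move: h2; lra.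
by rewrite leNgt pmulr_rlt0// yn/= mul0r.
Qed.

Lemma haar0_coefficient e k M t : (k + 4 <= M)%N ->
  \int[mu]_y (dilate M (fun z => t * test_bump z) y * haar0 (e, k) y) =
  t * \int[mu]_y positive_bump y.
Proof.
move=> kM; have bp := smoothc_bcs smoothc_positive_bump.
have M0 : 0 < 2 ^+ M :> R by rewrite exprn_gt0.
have bpM := bcs_affine 0 M0 bp.
rewrite -(Rintegral_affine 0 M0 bp) mulrA -(bcs_RintegralZ _ bpM).
apply: eq_Rintegral => y _; rewrite addr0 /dilate /test_bump.
have E : (positive_bump (2 ^+ M *: y) - negative_bump (2 ^+ M *: y)) * haar0 (e, k) y =
   positive_bump (2 ^+ M *: y).
  rewrite mulrBl.
  have -> : positive_bump (2 ^+ M *: y) * haar0 (e, k) y = positive_bump (2 ^+ M *: y).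
    have [->|h] := eqVneq (positive_bump (2 ^+ M *: y)) 0; first by rewrite mul0r.
    by rewrite (haar0_positive_bump e kM h) mulr1.
  have [->|h] := eqVneq (negative_bump (2 ^+ M *: y)) 0; first by rewrite mul0r subr0.
  by rewrite (haar0_negative_bump e k h) mulr0 subr0.
by rewrite -mulrA -mulrA E mulrCA mulrA.
Qed.

(** All coefficients are equal up to the normalization of the Haar functions, so
[haar_telescope] computes the projection. *)
Lemma haar_projection_test_bump n M t : (n + 4 <= M)%N ->
  haar_projection (haar_family R d n) (fun y => (dilate M (fun z => t * test_bump z) y)%:C) =
  (fun x => (dilate n (fun z => (t * \int[mu]_y positive_bump y) * cell z) x)%:C).
Proof.
move=> nM; apply/funext => x; set I := \int[mu]_y _.
pose F (u : V -> R) : R[i] := ((fine (Lnorm mu 2%:E (EFin \o u))) ^- 2)%:C *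
  cintegral (fun y => (dilate M (fun z => t * test_bump z) y)%:C * (u y)%:C) * (u x)%:C.
have coef e k : (k <= n)%N -> F (haar0 (e, k)) = (t * I * ((2 ^+ k) ^+ d * haar0 (e, k) x))%:C.
  rewrite /F => kn; have kM : (k + 4 <= M)%N by rewrite (leq_trans _ nM)// leq_add2r.
  rewrite haar0_norm//.
  have -> : cintegral (fun y => (dilate M (fun z => t * test_bump z) y)%:C * (haar0 (e, k) y)%:C) =
      (t * I)%:C.
    apply: complex_eq => /=.
      rewrite -(haar0_coefficient e t kM).
      by apply: eq_Rintegral => y _; rewrite mul0r subr0.
    under eq_Rintegral do rewrite mulr0 mul0r addr0.
    by rewrite /Rintegral integral0.
  by rewrite -!rmorphM/=; congr (_%:C); ring.
transitivity (\sum_(u <- haar_family R d n) F u) => //.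
rewrite (perm_big _ (perm_haar_family R d0 n))/= big_cons big_map coef// expr0 expr1n mul1r.
rewrite big_allpairs_dep/=.
have -> : \sum_(k <- iota 0 n) \sum_(e <- enum (predC1 ([ffun=> false] : {ffun 'I_d -> bool}))) F (haar0 (e, k)) =
   (t * I * \sum_(k < n) \sum_(e | e != [ffun=> false]) ((2 ^+ k) ^+ d * haar0 (e, k : nat) x))%:C.
  rewrite -[n in iota 0 n]subn0 -/(index_iota 0 n) big_mkord mulr_sumr rmorph_sum/=.
  apply: eq_bigr => k _; rewrite mulr_sumr rmorph_sum/= big_enum/=.
  by apply: eq_bigr => e _; rewrite coef// ltnW.
rewrite -rmorphD/= -mulrDr haar_telescope.
by rewrite /dilate; congr (_%:C); ring.
Qed.

Lemma locally_integrable_real f : bcs f -> locally_integrable_rV (fun y => (f y)%:C).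
Proof.
move=> bf; split => [||K cK] /=; first exact: bf.1.
  exact: measurable_cst.
have mK : measurable K.
  have clK : closed K by apply: compact_closed => //; exact: norm_hausdorff.
  by rewrite -[K]setCK; apply: measurableC; apply: open_measurable_rV; rewrite openC.
have nE y : normc ((f y)%:C) = `|f y| by rewrite /Normc.normc/= expr0n/= addr0 sqrtr_sqr.
rewrite (eq_integral (fun x => (`|f x|)%:E)) => [|x _]; last by rewrite -nE.
have bn := bcs_integrable (bcs_norm bf).
apply: (@le_lt_trans _ _ (\int[mu]_x (`|f x|)%:E)%E).
  apply: ge0_subset_integral => //; first by have /integrableP[] := bn.
have /integrableP[_] := bn; apply: le_lt_trans; rewrite le_eqVlt; apply/orP; left; apply/eqP.
by apply: eq_integral => x _ /=; rewrite normr_id.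
Qed.

(** An upper bound is needed for some distribution given by [f], a lower bound for
all distributions given by [P f]; functions of class [bcs] have one by
[exists_distribution]. *)
Lemma operator_norm_ge (X : ((V -> R[i]) -> R[i]) -> \bar R) (P : (V -> R[i]) -> V -> R[i])
    (f : V -> R) (b : \bar R) : bcs f ->
  (forall T, distribution_of (fun y => (f y)%:C) T -> X T <= 1)%E ->
  (forall T, distribution_of (P (fun y => (f y)%:C)) T -> b <= X T)%E ->
  (b <= operator_norm (norm_of_function X) P)%E.
Proof.
move=> bf H1 H2; have [T dT] := exists_distribution bf.
apply: (@le_trans _ _ (norm_of_function X (P (fun y => (f y)%:C)))).
  by apply: le_ereal_inf_tmp => _ [T' dT' <-]; exact: H2.
apply: ereal_sup_ubound; exists (fun y => (f y)%:C) => //; split.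
  exact: locally_integrable_real.
by apply: (le_trans (ereal_inf_lbound _) (H1 T dT)); exists T.
Qed.

End main_construction.

(** * Growth of the projection norms *)

Section growth.
Variables (R : realType) (d : nat).
Hypothesis d0 : (0 < d)%N.
Local Open Scope complex_scope.
Local Notation V := 'rV[R]_d.
Local Notation normc := (@Normc.normc R).

(** The norm of [2^k x] lies between 2/3 and 4/3 of [|x0|], which determines [k]. *)
Lemma scaled_balls_disjoint (x0 : V) (rho : R) k l x : 0 < rho -> 3 * rho <= `|x0| ->
  `|2 ^+ k *: x - x0| < rho -> `|2 ^+ l *: x - x0| < rho -> k = l.
Proof.
move=> r0 rx.
wlog kl : k l / (k <= l)%N => [H hk hl|].
  by have [kl|lk] := leqP k l; [exact: H|apply/esym; apply: H => //; exact: ltnW].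
move=> hk hl; apply/eqP; rewrite eqn_leq kl leqNgt; apply/negP => kl'.
have a1 : `|x0| - rho < `|2 ^+ k *: x|.
  by have := ler_distD x0 (2 ^+ k *: x) 0; have := lerB_dist x0 (2 ^+ k *: x); rewrite distrC; lra.
have a2 : `|2 ^+ l *: x| < `|x0| + rho.
  by have := lerB_dist (2 ^+ l *: x) x0; lra.
have a3 : 2 * `|2 ^+ k *: x| <= `|2 ^+ l *: x|.
  rewrite !normrZ mulrA ler_wpM2r// !ger0_norm ?exprn_ge0// -exprS.
  by rewrite ler_eXn2l ?ltr1n.
lra.
Qed.

Lemma powR_half (N m : nat) (b : R) : 0 <= b -> (N <= 2 * m)%N -> N%:R `^ b / 2 `^ b <= m%:R `^ b.
Proof.
move=> b0 Nm; rewrite -powRN.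
have -> : 2 `^ (- b) = 2^-1 `^ b by rewrite -[in RHS](powRr1 (ler0n R 2)) -powRN -powRrM mulN1r.
rewrite -powRM ?invr_ge0//; apply: ge0_ler_powR; rewrite ?nnegrE ?divr_ge0//.
by rewrite ler_pdivrMr// mulrC -natrM ler_nat.
Qed.

Lemma half_range (N J : nat) : (2 * J <= N)%N -> (0 < N)%N ->
  [/\ (1 < (N - J).+1)%N, (N <= 2 * ((N - J).+1 - 1))%N &
      forall k, (k < (N - J).+1)%N -> (k + J <= N)%N].
Proof. by move=> JN N0; split => [||k kN]; lia. Qed.

(** Half of the [N] levels are available as soon as [2 J <= N].  The finitely many
smaller values of [N] only affect the constant. *)
Lemma haar_projection_growth (phi0 : V -> R) (p : R) (q : \bar R) : 0 < p -> (0 < q)%E ->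
  LP_generator phi0 ->
  exists2 c : R, 0 < c & forall N : nat, (0 < N)%N -> exists2 n, (n <= N)%N &
    ((c * N%:R `^ fine (q^-1)%E)%:E <=
       operator_norm (besov_norm phi0 (d%:R / p - d%:R) p q) (haar_projection (haar_family R d n)))%E /\
    ((c * N%:R `^ p^-1)%:E <=
       operator_norm (triebel_lizorkin_norm phi0 (d%:R / p - d%:R) p q) (haar_projection (haar_family R d n)))%E.
Proof.
move=> p0 q0 gp.
have [C C0 HC] := norms_upper_bound p0 q0 d0 gp (smoothc_test_bump gp) (Rintegral_test_bump gp).
have I0 := Rintegral_positive_bump gp.
set I := Rintegral _ _ _ in I0.
have t0 : 0 <= C^-1 by rewrite invr_ge0 ltW.
have tau0 : 0 < C^-1 * I by rewrite mulr_gt0// invr_gt0.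
set tau := C^-1 * I in tau0.
have [x0 [rho [b [J [r0 rx b0 Hb]]]]] := block_cell_high d0 gp.
have [x1 [rho1 [b1 [r10 b10 Hb1]]]] := block_cell_low d0 gp.
have bM n : bcs (dilate n (fun z => C^-1 * test_bump phi0 z)).
  by apply: bcs_dilate; apply: bcsZ; exact: smoothc_bcs (smoothc_test_bump gp).
pose al : R := d%:R / p.
have up n T : distribution_of (fun y => (dilate n (fun z => C^-1 * test_bump phi0 z) y)%:C) T ->
    (besov_norm_distr phi0 (al - d%:R) p q T <= 1)%E /\
    (triebel_lizorkin_norm_distr phi0 (al - d%:R) p q T <= 1)%E.
  by move=> dT; have := HC n _ T t0 dT; rewrite mulVf// gt_eqF.
have proj n : haar_projection (haar_family R d n)
    (fun y => (dilate (n + 4) (fun z => C^-1 * test_bump phi0 z) y)%:C) =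
    (fun x => (dilate n (fun z => tau * @cell R d z) x)%:C).
  exact: (haar_projection_test_bump d0 gp).
(* the ranges used are the levels 1, ..., N - J and the single level 0 *)
have lower n (z : V) (r b' : R) n1 n2 : 0 < r -> 0 < b' -> (n1 < n2)%N ->
    (forall k l x, (n1 <= k < n2)%N -> (n1 <= l < n2)%N ->
       `|2 ^+ k *: x - z| < r -> `|2 ^+ l *: x - z| < r -> k = l) ->
    (forall T, distribution_of (fun x => (dilate n (fun z => tau * @cell R d z) x)%:C) T ->
      forall k x, (n1 <= k < n2)%N -> `|2 ^+ k *: x - z| < r ->
        tau * b' * (2 ^+ k) ^+ d <= normc (LP_block phi0 k T x)) ->
    ((tau * b' * (2 * r) `^ al * (n2 - n1)%:R `^ fine q^-1)%:E <=
       operator_norm (besov_norm phi0 (al - d%:R) p q) (haar_projection (haar_family R d n)))%E /\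
    ((tau * b' * (2 * r) `^ al * (n2 - n1)%:R `^ p^-1)%:E <=
       operator_norm (triebel_lizorkin_norm phi0 (al - d%:R) p q) (haar_projection (haar_family R d n)))%E.
  move=> r'0 b'0 n12 disj H; have tb0 : 0 <= tau * b' by rewrite mulr_ge0// ltW.
  split; (apply: (@operator_norm_ge R d _ _ _ _ (bM (n + 4)%N)); first by move=> T /up[]);
    rewrite proj => T dT.
    exact: (besov_lower_bound p0 q0 r'0 tb0 n12 (H T dT)).
  exact: (triebel_lizorkin_lower_bound p0 q0 r'0 tb0 n12 disj (H T dT)).
pose bq := fine (q^-1)%E.
have bq0 : 0 <= bq by apply: fine_ge0; rewrite inve_ge0 ltW.
have bp0 : 0 <= p^-1 by rewrite invr_ge0 ltW.
(* c1 is for N >= 2 J, and c2 for the finitely many smaller N *)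
pose c1 (a : R) := tau * b * (2 * rho) `^ al / 2 `^ a.
pose c2 (a : R) := tau * b1 * (2 * rho1) `^ al / (2 * J).+1%:R `^ a.
have cst0 (u v w : R) : 0 < u -> 0 < v -> 0 < w -> 0 < tau * u * (2 * v) `^ al / w.
  move=> u0 v0 w0; apply: divr_gt0 => //.
  by apply: mulr_gt0; [exact: mulr_gt0|apply: powR_gt0; exact: mulr_gt0].
have c10 a : 0 < c1 a by apply: cst0 => //; exact: powR_gt0.
have c20 a : 0 < c2 a by apply: cst0 => //; apply: powR_gt0; rewrite ltr0n.
exists (Num.min (Num.min (c1 bq) (c2 bq)) (Num.min (c1 p^-1) (c2 p^-1))).
  by rewrite !lt_min !c10 !c20.
set c := Num.min _ _.
have cq1 : c <= c1 bq by rewrite /c !ge_min lexx.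
have cq2 : c <= c2 bq by rewrite /c !ge_min lexx !orbT.
have cp1 : c <= c1 p^-1 by rewrite /c !ge_min lexx !orbT.
have cp2 : c <= c2 p^-1 by rewrite /c !ge_min lexx !orbT.
have weaken (u v w a m M : R) : 0 < u -> 0 < v -> c <= tau * u * (2 * v) `^ al / w `^ a ->
    M `^ a / w `^ a <= m `^ a -> c * M `^ a <= tau * u * (2 * v) `^ al * m `^ a.
  move=> u0 v0 cw Mm; apply: (le_trans (ler_wpM2r (powR_ge0 _ _) cw)).
  rewrite -[leLHS]mulrA [X in _ * X <= _]mulrC; apply: ler_wpM2l => //.
  by apply: mulr_ge0; [apply: ltW; exact: mulr_gt0|exact: powR_ge0].
move=> N N0; have [JN|NJ] := leqP (2 * J) N.
  have [JN1 JN2 JN3] := half_range JN N0.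
  exists N => //; have [||HB HF] := lower N x0 rho b 1%N (N - J).+1 r0 b0 JN1.
  - by move=> k l x _ _; exact: scaled_balls_disjoint.
  - move=> T dT k x /andP[k1 kN] kx; apply: (Hb N) => //; first exact: ltW.
    exact: JN3.
  by split; [apply: le_trans HB|apply: le_trans HF]; rewrite lee_fin; apply: weaken => //;
    [exact: cq1|exact: powR_half|exact: cp1|exact: powR_half].
exists 0%N => //; have [||HB HF] := lower 0%N x1 rho1 b1 0%N 1%N r10 b10 (ltn0Sn 0).
- by move=> [|k] [|l].
- by move=> T dT [|k] x // _ kx; apply: Hb1 => //; exact: ltW.
have NJa a : 0 <= a -> N%:R `^ a / (2 * J).+1%:R `^ a <= (1 - 0)%:R `^ a :> R.
  move=> a0; rewrite subn0 powR1 ler_pdivrMr ?mul1r ?powR_gt0//; apply: ge0_ler_powR; rewrite ?nnegrE//.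
  by rewrite ler_nat ltnW// ltnS ltnW.
by split; [apply: le_trans HB|apply: le_trans HF]; rewrite lee_fin; apply: weaken => //;
  [exact: cq2|exact: NJa|exact: cp2|exact: NJa].
Qed.

End growth.

Theorem theorem13p1 (R : realType) (d : nat) (p : R) (q : \bar R)
    (phi0 : 'rV[R]_d -> R) (hd : (1 <= d)%N)
    (hp : (d%:R - 1) / d%:R < p) (hq : (0 < q)%E) (hphi0 : LP_generator phi0) :
  let s : R := d%:R * (p^-1 - 1) in
  exists2 c : R, 0 < c & forall N : nat, (1 <= N)%N ->
    exists A : {fset ('rV[R]_d -> R)},
      [/\ [set` A] `<=` @haar_system R d,
          forall u, u \in A -> supp u `<=` @unit_cube R d,
          (#|` A| <= 2 ^ d * N)%N,
          ((c * N%:R `^ fine (q^-1)%E)%:E <=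
             operator_norm (besov_norm phi0 s p q) (haar_projection A))%E &
          ((c * N%:R `^ p^-1)%:E <=
             operator_norm (triebel_lizorkin_norm phi0 s p q) (haar_projection A))%E].
Proof.
move=> s.
have p0 : 0 < p by apply: le_lt_trans hp; rewrite divr_ge0// subr_ge0 ler1n.
have sE : s = d%:R / p - d%:R by rewrite /s mulrBr mulr1.
have [c c0 H] := haar_projection_growth hd p0 hq hphi0.
exists c => // N N1; have [n nN [HB HF]] := H N N1.
exists (haar_family R d n); rewrite sE; split => //.
- exact: haar_family_sub.
- by move=> u; exact: supp_haar_family.
- exact: card_haar_family.
Qed.
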